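(* Let $m\ge 1$ be an integer. For all $0<p<q<\infty$, all $\alpha>0$, and all $f\in\mathcal{L}^p_\alpha(\mathbb{R}^m)$, we have $f\in\mathcal{L}^q_\alpha(\mathbb{R}^m)$ and $$\|f\|_{q,\alpha}\le\|f\|_{p,\alpha},$$ with equality for $f=f_a$, where $f_a(x)=e^{\alpha\langle a,x\rangle-\frac{\alpha}{2}|a|^2}$ and $a\in\mathbb{R}^m$ is arbitrary.
   Context: $\mathbb{R}^m$ carries the Euclidean inner product $\langle\cdot,\cdot\rangle$ and norm $|\cdot|$, and $dA$ is Lebesgue measure on $\mathbb{R}^m$. For $p>0$, $\alpha>0$ and measurable $f:\mathbb{R}^m\to\mathbb{C}$, define $$\|f\|_{p,\alpha}^p=c_{p,\alpha}\int_{\mathbb{R}^m}|f(x)|^p e^{-\frac{\alpha}{2}p|x|^2}\,dA(x),\qquad c_{p,\alpha}=\left(\frac{\alpha p}{2\pi}\right)^{m/2}.$$ A complex-valued real-analytic function $f$ on $\mathbb{R}^m$ (equivalently, its absolute value $|f|$) is called log-subharmonic if $\log|f|$ is subharmonic on $\mathbb{R}^m\setminus f^{-1}(0)$, i.e. $\Delta\log|f(x)|\ge 0$ at every $x$ with $f(x)\neq 0$. $\mathcal{L}^p_\alpha(\mathbb{R}^m)$ is the set of complex-valued real-analytic functions $f$ on $\mathbb{R}^m$ such that $|f|$ is log-subharmonic and $\|f\|_{p,\alpha}<\infty$. *)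

(* Defs.v *)
From HB Require Import structures.
From mathcomp Require Import all_boot all_order all_algebra.
From mathcomp Require Import all_classical all_reals all_analysis.
From mathcomp Require Import complex.

Set Implicit Arguments.
Unset Strict Implicit.
Unset Printing Implicit Defensive.

Import Order.TTheory GRing.Theory Num.Theory.
Import numFieldNormedType.Exports.
Import ComplexField.Normc.

Local Open Scope classical_set_scope.
Local Open Scope ring_scope.

(* Lebesgue measure on m-tuples of reals (the library has no product over a
   finite index set): the point mass on R^0, and on R^(n+1) the image of
   lebesgue_measure \x mu_n under (x, t) |-> x :: t.  The sigma-algebra is the
   product of the Borel ones. *)
Section lebesgue_tuple.
Variable R : realType.
Local Notation mR := (measurableTypeR R).

Definition tuple_cons (n : nat) (z : mR * n.-tuple mR) : n.+1.-tuple mR :=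
  [tuple of z.1 :: z.2].

Lemma measurable_tuple_cons (n : nat) :
  measurable_fun [set: mR * n.-tuple mR] (@tuple_cons n).
Proof. exact: (@measurable_cons _ _ (mR * n.-tuple mR)%type mR). Qed.

Section step.
Context (n : nat) (mu : {sigma_finite_measure set (n.-tuple mR) -> \bar R}).

Definition lebesgue_cons : set (n.+1.-tuple mR) -> \bar R :=
  pushforward (lebesgue_measure \x mu)%E (@tuple_cons n).

Let lebesgue_cons0 : lebesgue_cons set0 = 0%E.
Proof. by rewrite /lebesgue_cons /pushforward preimage_set0 measure0. Qed.

Let lebesgue_cons_ge0 A : (0 <= lebesgue_cons A)%E.
Proof. by rewrite /lebesgue_cons /pushforward; exact: measure_ge0. Qed.

Let lebesgue_cons_sigma_additive : semi_sigma_additive lebesgue_cons.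
Proof.
have mpre (A : set (n.+1.-tuple mR)) :
    measurable A -> measurable (@tuple_cons n @^-1` A).
  by move=> mA; rewrite -[X in measurable X]setTI; exact: measurable_tuple_cons.
move=> F mF tF mUF; rewrite /lebesgue_cons /pushforward preimage_bigcup.
apply: measure_semi_sigma_additive.
- by move=> k; exact: mpre.
- apply/trivIsetP => /= i j _ _ ij; rewrite -preimage_setI.
  by move/trivIsetP : tF => /(_ _ _ _ _ ij) ->//; rewrite preimage_set0.
- by rewrite -preimage_bigcup; exact: mpre.
Qed.

HB.instance Definition _ := isMeasure.Build _ _ _ lebesgue_cons
  lebesgue_cons0 lebesgue_cons_ge0 lebesgue_cons_sigma_additive.

Lemma lebesgue_cons_sigma_finite : sigma_finite setT lebesgue_cons.
Proof.
have /sigma_finiteP[F [TF ndF Foo]] := sigma_finiteT (@lebesgue_measure R).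
have /sigma_finiteP[G [TG ndG Goo]] := sigma_finiteT mu.
pose uncons (t : n.+1.-tuple mR) : mR * n.-tuple mR :=
  (thead t, [tuple of behead t]).
have unconsK : cancel uncons (@tuple_cons n).
  by move=> t; rewrite [RHS]tuple_eta; apply: val_inj.
have consK : cancel (@tuple_cons n) uncons.
  by move=> [x t]; congr pair; apply: val_inj.
have muncons : measurable_fun [set: n.+1.-tuple mR] uncons.
  apply/measurable_fun_pair; first exact: measurable_tnth.
  exact: measurable_behead.
exists (fun k => uncons @^-1` (F k `*` G k)).
  rewrite -preimage_bigcup; apply/esym; rewrite -subTset => t _ /=.
  have [k1 _ Fk1] : (\bigcup_k F k) (uncons t).1 by rewrite -TF.
  have [k2 _ Gk2] : (\bigcup_k G k) (uncons t).2 by rewrite -TG.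
  exists (maxn k1 k2) => //; split.
    by move: Fk1; exact/subsetPset/ndF/leq_maxl.
  by move: Gk2; exact/subsetPset/ndG/leq_maxr.
move=> k; have [mFk Fk] := Foo k; have [mGk Gk] := Goo k; split.
  by rewrite -[X in measurable X]setTI; apply: muncons => //; exact: measurableX.
rewrite /lebesgue_cons /pushforward.
rewrite (_ : _ @^-1` _ = F k `*` G k); last first.
  by rewrite -comp_preimage (_ : uncons \o _ = id)//; exact/funext.
by rewrite product_measure1E// lte_mul_pinfty// ge0_fin_numE.
Qed.

HB.instance Definition _ := Measure_isSigmaFinite.Build _ _ _ lebesgue_cons
  lebesgue_cons_sigma_finite.

End step.

Fixpoint lebesgue_tuple (n : nat) :
    {sigma_finite_measure set (n.-tuple mR) -> \bar R} :=
  match n with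
  | 0 => dirac ([tuple] : 0.-tuple mR)
  | n'.+1 => lebesgue_cons (lebesgue_tuple n')
  end.

Lemma lebesgue_tuple_box (n : nat) (A : 'I_n -> set mR) :
  (forall i, measurable (A i)) ->
  lebesgue_tuple n [set t | forall i, A i (tnth t i)] =
    (\prod_(i < n) lebesgue_measure (A i))%E.
Proof.
elim: n A => [|n IH] A mA.
  by rewrite big_ord0 /= diracE mem_set// => -[].
have mB : measurable [set t : n.-tuple mR | forall i, A (lift ord0 i) (tnth t i)].
  rewrite (_ : [set _ | _] =
      \bigcap_(i in [set: 'I_n]) ((@tnth n mR) ^~ i @^-1` A (lift ord0 i))).
    apply: fin_bigcap_measurable => // i _.
    by rewrite -[X in measurable X]setTI; exact: measurable_tnth.
  by apply/seteqP; split => t h i; [move=> _; exact: h | exact: h].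
rewrite big_ord_recl -(IH (A \o lift ord0)); last by move=> i; exact: mA.
transitivity ((@lebesgue_measure R \x lebesgue_tuple n)%E
    (A ord0 `*` [set t | forall i, A (lift ord0 i) (tnth t i)])).
  rewrite /= /lebesgue_cons /pushforward; congr product_measure1.
  apply/seteqP; split => -[x t] /=.
    move=> h; split; first exact: (h ord0).
    by move=> i; have := h (lift ord0 i); rewrite tnthS.
  by move=> [h0 h1] i; case: (unliftP ord0 i) => [k|] ->//; rewrite tnthS.
by rewrite product_measure1E.
Qed.

End lebesgue_tuple.

Section defs.
Context (R : realType) (m : nat).
Implicit Types (x y a h : 'rV[R]_m) (f : 'rV[R]_m -> R[i]).

Definition dotp x y : R := \sum_(i < m) x 0 i * y 0 i.

(* The library norm `|x| on 'rV[R]_m is the sup norm. *)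
Definition enorm x : R := Num.sqrt (dotp x x).

Definition rV_of_tuple (t : m.-tuple (measurableTypeR R)) : 'rV[R]_m :=
  \row_(i < m) tnth t i.

Definition lebesgue_int (F : 'rV[R]_m -> \bar R) : \bar R :=
  (\int[@lebesgue_tuple R m]_t F (rV_of_tuple t))%E.

Definition multi_monomial (k : {ffun 'I_m -> nat}) h : R :=
  \prod_(i < m) h 0 i ^+ k i.

(* Near x, f is the sum of an absolutely convergent power series in m
   variables; thanks to absolute convergence its sum is the limit of the
   partial sums over the multi-indices with all entries < N. *)
Definition real_analytic_at f x : Prop :=
  exists c : {ffun 'I_m -> nat} -> R[i], \forall h \near (0 : 'rV[R]_m),
    (\esum_(k in [set: {ffun 'I_m -> nat}])
       (normc (c k) * `|multi_monomial k h|)%:E < +oo)%E /\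
    (fun N : nat => \sum_(k : {ffun 'I_m -> 'I_N})
       c [ffun i => nat_of_ord (k i)] *
       (multi_monomial [ffun i => nat_of_ord (k i)] h)%:C%C : R[i]^o) @ \oo
    --> (f (x + h) : R[i]^o).

Definition real_analytic f : Prop := forall x, real_analytic_at f x.

Definition laplacian (u : 'rV[R]_m -> R) x : R :=
  \sum_(i < m) 'D_(delta_mx 0 i) ('D_(delta_mx 0 i) u) x.

Definition log_subharmonic f : Prop :=
  forall x, f x != 0 -> 0 <= laplacian (fun y => ln (normc (f y))) x.

Definition cst_pa (p alpha : R) : R := (alpha * p / (2 * pi)) `^ (m%:R / 2).

Definition norm_pa (p alpha : R) f : \bar R :=
  (((cst_pa p alpha)%:E *
    lebesgue_int (fun x =>
      (normc (f x) `^ p * expR (- (alpha / 2 * p * enorm x ^+ 2)))%:E))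
   `^ p^-1)%E.

Definition logsub_space (p alpha : R) : set ('rV[R]_m -> R[i]) :=
  [set f | [/\ real_analytic f, log_subharmonic f & (norm_pa p alpha f < +oo)%E]].

Definition exp_fa (alpha : R) a : 'rV[R]_m -> R[i] :=
  fun x => (expR (alpha * dotp a x - alpha / 2 * enorm a ^+ 2))%:C%C.

End defs.

(* Main.v *)
Require Import Defs.
From HB Require Import structures.
From mathcomp Require Import all_boot all_order all_algebra.
From mathcomp Require Import all_classical all_reals all_analysis.
From mathcomp Require Import measurable_realfun complex.
From mathcomp Require Import ring lra.

Set Implicit Arguments.
Unset Strict Implicit.
Unset Printing Implicit Defensive.

Import Order.TTheory GRing.Theory Num.Theory.
Import numFieldNormedType.Exports.
Import ComplexField.Normc.

Local Open Scope classical_set_scope.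
Local Open Scope ring_scope.

(** Let [X] and [Y] be independent standard Gaussian vectors.  Completing the weight into
    a Gaussian density, [norm_pa p alpha f ^ p] is the expectation of [|f (s_p X)| ^ p] with
    [s_p = (alpha p) ^ (-1/2)], so that [s_q = a s_p] for [a ^ 2 = p / q].  The inequality
    becomes [E exp (a ^ (-2) phi (a X)) <= (E exp (phi X)) ^ (a ^ (-2))] for
    [phi x = (p / 2) ln (|f (s_p x)| ^ 2 + eps)], in the limit [eps -> 0].

    For bounded Lipschitz [phi] and [a ^ 2 + b ^ 2 = 1], one has
    [E_X exp (a ^ (-2) E_Y phi (a X + b Y)) <= (E exp (phi X)) ^ (a ^ (-2))]: a two-point
    inequality and Hoelder's inequality give it for random walks, Lindeberg's replacement
    method for one Gaussian variable, and tensorization for Gaussian vectors; it extends to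
    continuous [phi] bounded below by inf-convolution.  It remains to see that
    [phi (a x) <= E phi (a x + b Y)].  Log-subharmonicity makes the Laplacian of [phi]
    nonnegative, also at the zeros of [f] thanks to [eps]; as [phi] is only known to be
    bounded below, this is done by integrating by parts against the compactly supported
    kernels [max 0 (w - |x| ^ 2) ^ k * exp (|x| ^ 2 / 2)] and letting [w = 2 k] tend to
    infinity. *)

(** * Two-point inequality and random walks *)

(** The inequality for averages is the limit of Nelson's hypercontractive estimate, applied to
    [exp (d * phi)] with exponents [1 / d] and about [a ^ (-2) / d], as [d] tends to 0. In this
    limit the offset by one in Nelson's condition on [(q - 1) / (p - 1)] disappears and only the
    ratio [q / p = a ^ (-2)] remains. This is why every [p > 0] is allowed, and why it is [ln |f|],
    not merely [|f|], that has to lie below its Gaussian averages. Linear [phi] give equality; they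
    correspond to the functions [f_a].

    The obstacle is that nothing but a finite norm limits the growth of [f], so derivatives of [phi]
    and boundary terms at infinity are not under control. The inequality is therefore proved first
    for functions where every mean is trivially finite, and the averages of [phi] are only ever
    compared with compactly supported kernels. Since [phi] is bounded below by a constant, both
    passages to the limit are monotone, and no dominating function is needed. *)

Section two_point.
Context {R : realType}.
Implicit Types (x y u v d mu : R).

Lemma ge0_derive_ge0 (f df : R -> R) :
  (forall x, is_derive x 1 f (df x)) -> (forall x, 0 <= x -> 0 <= df x) ->
  forall x, 0 <= x -> f 0 <= f x.
Proof.
move=> fdf df0 x; rewrite le_eqVlt => /predU1P[<-//|x0].
have [|c /[!in_itv]/= /andP[c0 _] e] := @MVT R f df 0 x x0 (fun y _ => fdf y).
  by apply: continuous_subspaceT => y; apply/differentiable_continuous/derivable1_diffP.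
by rewrite -subr_ge0 e subr0 mulr_ge0// ?df0// ltW.
Qed.

Let ch x := (expR x + expR (- x)) / 2.
Let sh x := (expR x - expR (- x)) / 2.

Let is_derive_ch x : is_derive x 1 ch (sh x).
Proof. by apply: is_derive_eq; rewrite /sh /GRing.scale/=; lra. Qed.

Let is_derive_sh x : is_derive x 1 sh (ch x).
Proof. by apply: is_derive_eq; rewrite /ch /GRing.scale/=; lra. Qed.

Let ch_gt0 x : 0 < ch x.
Proof. by rewrite divr_gt0// addr_gt0// expR_gt0. Qed.


Let ch2 x : ch x ^+ 2 - sh x ^+ 2 = 1.
Proof.
have e : expR x * expR (- x) = 1 by rewrite -expRD subrr expR0.
by rewrite -e /ch /sh; field.
Qed.

Let le_ch x y : 0 <= x -> x <= y -> ch x <= ch y.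
Proof.
move=> x0 xy.
have ex : 1 <= expR x by rewrite -expR0 ler_expR.
have exy : expR x <= expR y by rewrite ler_expR.
have e1 : expR (- x) = (expR x)^-1 by rewrite expRN.
have e2 : expR (- y) = (expR y)^-1 by rewrite expRN.
rewrite /ch ler_pM2r ?invr_gt0// e1 e2 -subr_ge0.
have -> : expR y + (expR y)^-1 - (expR x + (expR x)^-1) =
   (expR y - expR x) * (expR x * expR y - 1) / (expR x * expR y).
  by field; rewrite !gt_eqF ?expR_gt0.
rewrite divr_ge0 ?mulr_ge0 ?expR_ge0//; first by rewrite subr_ge0.
by rewrite subr_ge0 mulr_ege1// (le_trans ex).
Qed.

Let th x := sh x / ch x.

Let is_derive_th x : is_derive x 1 th (ch x ^- 2).
Proof.
have c0 : ch x != 0 by rewrite gt_eqF.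
have h : is_derive x 1 (fun y => (ch y)^-1) (- ch x ^- 2 *: sh x).
  exact: is_deriveV.
have := is_deriveM (is_derive_sh x) h.
move=> /is_derive_eq; apply.
by rewrite /GRing.scale/= -[X in _ = X]mul1r -(ch2 x); field.
Qed.

(** The derivative of the difference in [d] is [mu * (ch d ^- 2 - ch (mu * d) ^- 2)], nonnegative
    because [ch] increases on the half-line. *)
Let th_le mu d : 1 <= mu -> 0 <= d -> th (mu * d) <= mu * th d.
Proof.
move=> mu1 d0; rewrite -subr_ge0.
have mu0 : 0 <= mu by exact: le_trans mu1.
pose f x := mu * th x - th (mu * x).
have df x : is_derive x 1 f (mu * (ch x ^- 2 - ch (mu * x) ^- 2)).
  have h1 := is_derive_th x.
  have h2 : is_derive x 1 (fun y => th (mu * y)) (mu * ch (mu * x) ^- 2).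
    have := @is_derive1_comp R th ( *%R mu) x _ _ (is_derive_th (mu * x)) .
    move=> /(_ mu); rewrite mulrC; apply.
    by apply: is_derive_eq; rewrite /GRing.scale/= mulr1 ?add0r ?mul0r ?addr0.
  by apply: is_derive_eq; rewrite /GRing.scale/=; ring.
have -> : 0 = f 0 by rewrite /f mulr0 /th /sh oppr0 subrr mul0r mul0r mulr0 subr0.
apply: (ge0_derive_ge0 df) => // x x0.
rewrite mulr_ge0// subr_ge0 lef_pV2 ?posrE ?exprn_gt0//.
by apply: lerXn2r; rewrite ?nnegrE; [exact: ltW|exact: ltW|apply: le_ch; rewrite ?ler_peMl].
Qed.

(** Both sides vanish at 0, and the derivative of their difference is [mu] times the one in [th_le].
    They agree to second order at 0, so the exponent 2 cannot be lowered. *)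
Let ln_ch_le mu d : 1 <= mu -> 0 <= d -> ln (ch (mu * d)) <= mu ^+ 2 * ln (ch d).
Proof.
move=> mu1 d0; rewrite -subr_ge0.
have mu0 : 0 <= mu by exact: le_trans mu1.
pose f x := mu ^+ 2 * ln (ch x) - ln (ch (mu * x)).
have dl x : is_derive x 1 (fun y => ln (ch y)) (th x).
  have := @is_derive1_comp R (@ln R) ch x _ _ (is_derive1_ln (ch_gt0 x)) (is_derive_ch x).
  by rewrite /th mulrC.
have df x : is_derive x 1 f (mu * (mu * th x - th (mu * x))).
  have h1 := dl x.
  have h2 : is_derive x 1 (fun y => ln (ch (mu * y))) (mu * th (mu * x)).
    have := @is_derive1_comp R (fun y => ln (ch y)) ( *%R mu) x _ _ (dl (mu * x)) .
    move=> /(_ mu); rewrite mulrC; apply.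
    by apply: is_derive_eq; rewrite /GRing.scale/= mulr1 ?add0r ?mul0r ?addr0.
  by apply: is_derive_eq; rewrite /GRing.scale/=; ring.
have -> : 0 = f 0.
  by rewrite /f mulr0 /ch oppr0 expR0 -[1+1]/(2) divff// ln1 mulr0 subr0.
apply: (ge0_derive_ge0 df) => // x x0.
by rewrite mulr_ge0// subr_ge0 th_le.
Qed.

Let chN x : ch (- x) = ch x. Proof. by rewrite /ch opprK addrC. Qed.

Let ln_ch_le_real mu d : 1 <= mu -> ln (ch (mu * d)) <= mu ^+ 2 * ln (ch d).
Proof.
move=> mu1; have [|/ltW d0] := leP 0 d; first exact: ln_ch_le.
by rewrite -(chN d) -(chN (mu * d)) -mulrN ln_ch_le// oppr_ge0.
Qed.

(** In terms of the mean [c] and the half-difference [d] of [u] and [v], the factor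
    [expR (a ^- 2 * c)] cancels and [ln_ch_le_real] with [mu = a^-1] remains. *)
Lemma two_point (a u v : R) : 0 < a -> a <= 1 ->
  (expR (a ^- 2 * ((1 + a) / 2 * u + (1 - a) / 2 * v)) +
   expR (a ^- 2 * ((1 + a) / 2 * v + (1 - a) / 2 * u))) / 2
  <= expR (a ^- 2 * ln ((expR u + expR v) / 2)).
Proof.
move=> a0 a1; have an0 : a != 0 by rewrite gt_eqF.
pose c := (u + v) / 2; pose d := (u - v) / 2.
have -> : (expR u + expR v) / 2 = expR c * ch d.
  rewrite /ch mulrA mulrDr -!expRD /c /d; congr ((expR _ + expR _) / 2); lra.
rewrite lnM ?posrE ?expR_gt0// expRK.
have -> : (1 + a) / 2 * u + (1 - a) / 2 * v = c + a * d by rewrite /c /d; lra.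
have -> : (1 + a) / 2 * v + (1 - a) / 2 * u = c - a * d by rewrite /c /d; lra.
rewrite 2!mulrDr mulrDr mulrN.
have -> : a ^- 2 * (a * d) = a^-1 * d by field.
rewrite 3!expRD -mulrDr -mulrA ler_pM2l ?expR_gt0//.
rewrite -[leLHS]/(ch (a^-1 * d)) -[leLHS]lnK ?posrE// ler_expR.
by rewrite -exprVn ln_ch_le_real// invf_ge1.
Qed.

End two_point.

Section discrete.
Context {R : realType}.
Implicit Types (h z e a c : R) (phi psi : R -> R) (n : nat).

Definition avg h phi z : R := (phi (z + h) + phi (z - h)) / 2.

(** Expectation of [phi] at [z] plus [h] times a sum of [n] independent uniform signs. *)
Definition walk n h := iter n (avg h).

Lemma walkS n h phi z :
  walk n.+1 h phi z = (walk n h phi (z + h) + walk n h phi (z - h)) / 2.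
Proof. by []. Qed.

Lemma walk_shift n h phi c z : walk n h (fun x => phi (x + c)) z = walk n h phi (z + c).
Proof.
by elim: n z => [//|n IH] z; rewrite !walkS !IH; congr ((walk _ _ _ _ + walk _ _ _ _) / 2); ring.
Qed.

Lemma walk_lin n h phi psi c d z :
  walk n h (fun x => c * phi x + d * psi x) z = c * walk n h phi z + d * walk n h psi z.
Proof. by elim: n z => [//|n IH] z; rewrite !walkS !IH; field. Qed.

Lemma le_walk n h phi psi z : (forall x, phi x <= psi x) ->
  walk n h phi z <= walk n h psi z.
Proof.
by move=> l; elim: n z => [//|n IH] z; rewrite !walkS ler_pM2r ?invr_gt0// lerD.
Qed.

Lemma walk_cst n h c z : walk n h (fun=> c) z = c.
Proof. by elim: n z => [//|n IH] z; rewrite walkS !IH; field. Qed.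

Lemma walk_ge0 n h phi z : (forall x, 0 <= phi x) -> 0 <= walk n h phi z.
Proof. by move=> phi0; rewrite -(walk_cst n h 0 z); exact: le_walk. Qed.

Lemma walk_gt0 n h phi z : (forall x, 0 < phi x) -> 0 < walk n h phi z.
Proof.
by move=> l; elim: n z => [//|n IH] z; rewrite !walkS divr_gt0// addr_gt0.
Qed.


Lemma expR_tangent (s u : R) : expR s * (1 + (u - s)) <= expR u.
Proof. by rewrite -[in leRHS](subrKC s u) expRD ler_pM2l ?expR_gt0// expR_ge1Dx. Qed.

Lemma expR_convex (t u v : R) : 0 <= t -> t <= 1 ->
  expR (t * u + (1 - t) * v) <= t * expR u + (1 - t) * expR v.
Proof.
move=> t0 t1; set s := t * u + _.
have -> : expR s = t * (expR s * (1 + (u - s))) + (1 - t) * (expR s * (1 + (v - s))).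
  by rewrite /s; ring.
by rewrite lerD// ler_wpM2l ?expR_tangent// subr_ge0.
Qed.

(** Hoelder's inequality with exponents [1 / t] and [1 / (1 - t)]. Once the right side is divided
    out, both exponentials are normalised to have mean one, and pointwise convexity of [expR] is
    enough. *)
Lemma walk_hoelder n h (t : R) phi psi z : 0 <= t -> t <= 1 ->
  walk n h (fun x => expR (t * phi x + (1 - t) * psi x)) z <=
  expR (t * ln (walk n h (expR \o phi) z) + (1 - t) * ln (walk n h (expR \o psi) z)).
Proof.
move=> t0 t1.
set X := walk n h (expR \o phi) z; set Y := walk n h (expR \o psi) z.
have X0 : 0 < X by apply: walk_gt0 => x; exact: expR_gt0.
have Y0 : 0 < Y by apply: walk_gt0 => x; exact: expR_gt0.
set S := t * ln X + _.
have -> : walk n h (fun x => expR (t * phi x + (1 - t) * psi x)) z =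
  expR S * walk n h (fun x => expR (t * phi x + (1 - t) * psi x - S)) z.
  have := walk_lin n h (fun x => expR (t * phi x + (1 - t) * psi x - S)) (cst 0) (expR S) 0 z.
  rewrite mul0r addr0 => <-; congr (walk _ _ _ _); apply/funext => x.
  by rewrite mul0r addr0 -expRD; congr expR; ring.
rewrite ler_piMr ?expR_ge0//.
apply: (@le_trans _ _ (walk n h (fun x => t / X * (expR \o phi) x + (1 - t) / Y * (expR \o psi) x) z)).
  apply: le_walk => x.
  have -> : t * phi x + (1 - t) * psi x - S =
    t * (phi x - ln X) + (1 - t) * (psi x - ln Y) by rewrite /S; ring.
  apply: (le_trans (expR_convex _ _ t0 t1)).
  by rewrite !expRB !lnK ?posrE//= lerD// mulrA mulrAC.
rewrite walk_lin -/X -/Y !divfK ?gt_eqF//; by rewrite subrKC.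
Qed.

Section lower.
Variables (a h : R).
Hypotheses (a0 : 0 < a) (a1 : a <= 1).
Let lam := a ^- 2.

(** Average over a sign that has correlation [a] with the sign of [e]. *)
Definition tilt e phi z := (1 + a) / 2 * phi (z + e) + (1 - a) / 2 * phi (z - e).

(* Expectation of [expR (lam * E (phi (z + h * sum eta_j) | eps))] over uniform
   signs [eps_j], where [eta_j] equals [eps_j] with probability [(1 + a) / 2]. *)
Fixpoint cond_exp n phi z : R :=
  if n is n'.+1 then
    (cond_exp n' (tilt h phi) z + cond_exp n' (tilt (- h) phi) z) / 2
  else expR (lam * phi z).

(** Induction on the number of signs: by Hoelder's inequality the walk of a tilted function is
    controlled by the same tilt of the logarithms [ln X] and [ln Y] of the two shifted walks, and
    the average of the two tilts is then the left side of [two_point]. *)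
Lemma cond_exp_le n phi z :
  cond_exp n phi z <= expR (lam * ln (walk n h (expR \o phi) z)).
Proof.
elim: n phi => [|n IH] phi /=; first by rewrite expRK.
rewrite -[avg h _ z]/((_ + _) / 2).
set X := walk n h _ (z + h); set Y := walk n h _ (z - h).
have X0 : 0 < X by apply: walk_gt0 => x; exact: expR_gt0.
have Y0 : 0 < Y by apply: walk_gt0 => x; exact: expR_gt0.
have lam0 : 0 <= lam by rewrite /lam invr_ge0 exprn_ge0// ltW.
have t0 : 0 <= (1 + a) / 2 by rewrite divr_ge0// addr_ge0// ltW.
have t1 : (1 + a) / 2 <= 1 by rewrite ler_pdivrMr// mul1r [leRHS](_ : _ = 1 + 1)// lerD2l.
have te : 1 - (1 + a) / 2 = (1 - a) / 2 by field.
have key e : ln (walk n h (expR \o tilt e phi) z) <=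
   (1 + a) / 2 * ln (walk n h (expR \o phi) (z + e)) + (1 - a) / 2 * ln (walk n h (expR \o phi) (z - e)).
  rewrite -[leRHS]expRK ler_ln ?posrE ?expR_gt0//; last first.
    by apply: walk_gt0 => x; exact: expR_gt0.
  rewrite -(walk_shift n h (expR \o phi) e) -(walk_shift n h (expR \o phi) (- e)).
  by have := walk_hoelder n h (fun x => phi (x + e)) (fun x => phi (x - e)) z t0 t1; rewrite te.
have := @two_point R a (ln X) (ln Y) a0 a1.
rewrite !lnK ?posrE//; apply: le_trans.
rewrite ler_pM2r ?invr_gt0//; apply: lerD; apply: (le_trans (IH _)); rewrite ler_expR;
  apply: ler_wpM2l => //.
by have := key (- h); rewrite opprK -/X -/Y addrC.
Qed.

Lemma le_cond_exp n phi psi z : (forall x, phi x <= psi x) ->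
  cond_exp n phi z <= cond_exp n psi z.
Proof.
have lam0 : 0 <= lam by rewrite /lam invr_ge0 exprn_ge0// ltW.
have w0 : 0 <= (1 + a) / 2 by rewrite divr_ge0// addr_ge0// ltW.
have w1 : 0 <= (1 - a) / 2 by rewrite divr_ge0// subr_ge0.
elim: n phi psi => [|n IH] phi psi le /=; first by rewrite ler_expR ler_wpM2l.
by rewrite ler_pM2r ?invr_gt0// lerD// IH// => x; rewrite /tilt lerD// ler_wpM2l.
Qed.

Lemma cond_expD n phi c z :
  cond_exp n (fun x => phi x + c) z = expR (lam * c) * cond_exp n phi z.
Proof.
elim: n phi => [|n IH] phi /=; first by rewrite -expRD mulrDr addrC.
rewrite mulrA mulrDr -!IH; congr ((cond_exp n _ z + cond_exp n _ z) / 2);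
  by apply/funext => x; rewrite /tilt; field.
Qed.

Lemma cond_exp_shift n phi c z :
  cond_exp n (fun x => phi (x + c)) z = cond_exp n phi (z + c).
Proof.
elim: n phi => [//|n IH] phi /=.
rewrite -!IH; congr ((cond_exp n _ z + cond_exp n _ z) / 2);
  by apply/funext => x; rewrite /tilt; congr (_ * phi _ + _ * phi _); ring.
Qed.

End lower.

End discrete.

(** * Means of bounded functions and Gaussian measures *)

Section bounded_measurable.
Context d (T : measurableType d) {R : realType}.
Implicit Types f g : T -> R.

Definition bmeas f := measurable_fun setT f /\ exists B : R, forall x, `|f x| <= B.

Lemma bmeas_cst c : bmeas (fun=> c).
Proof. by split=> //; exists `|c|. Qed.

Lemma bmeasD f g : bmeas f -> bmeas g -> bmeas (fun x => f x + g x).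
Proof.
move=> [mf [B hB]] [mg [C hC]]; split; first exact: measurable_funD.
by exists (B + C) => x; rewrite (le_trans (ler_normD _ _))// lerD.
Qed.

Lemma bmeasM f g : bmeas f -> bmeas g -> bmeas (fun x => f x * g x).
Proof.
move=> [mf [B hB]] [mg [C hC]]; split; first exact: measurable_funM.
by exists (B * C) => x; rewrite normrM ler_pM.
Qed.

Lemma bmeasN f : bmeas f -> bmeas (fun x => - f x).
Proof.
move=> [mf [B hB]]; split; first exact: measurable_funN.
by exists B => x; rewrite normrN.
Qed.

Lemma bmeasB f g : bmeas f -> bmeas g -> bmeas (fun x => f x - g x).
Proof. by move=> bf /bmeasN bg; exact: bmeasD. Qed.

Lemma bmeas_expR f : bmeas f -> bmeas (expR \o f).
Proof.
move=> [mf [B hB]]; split; first exact: measurableT_comp.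
exists (expR B) => x; rewrite ger0_norm ?expR_ge0// ler_expR.
exact: le_trans (ler_norm _) (hB x).
Qed.

Variable P : probability T R.

Lemma bmeas_integrable f : bmeas f -> P.-integrable setT (EFin \o f).
Proof.
move=> [mf [B hB]]; apply: measurable_bounded_integrable => //.
  by rewrite (le_lt_trans (probability_le1 _ _))// ltry.
exists B; split; first exact: num_real.
by move=> M BM x _; apply: (le_trans (hB x)); exact: ltW.
Qed.

Lemma mean_cst c : (\int[P]_x c = c)%R.
Proof. by rewrite Rintegral_cst//= probability_setT mulr1. Qed.

Lemma meanD f g : bmeas f -> bmeas g ->
  \int[P]_x (f x + g x) = \int[P]_x f x + \int[P]_x g x.
Proof. by move=> *; apply: RintegralD => //; exact: bmeas_integrable. Qed.

Lemma meanB f g : bmeas f -> bmeas g ->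
  \int[P]_x (f x - g x) = \int[P]_x f x - \int[P]_x g x.
Proof. by move=> *; apply: RintegralB => //; exact: bmeas_integrable. Qed.

Lemma meanZ c f : bmeas f -> \int[P]_x (c * f x) = c * \int[P]_x f x.
Proof. by move=> *; apply: RintegralZl => //; exact: bmeas_integrable. Qed.

Lemma le_mean f g : bmeas f -> bmeas g -> (forall x, f x <= g x) ->
  \int[P]_x f x <= \int[P]_x g x.
Proof. by move=> *; apply: le_Rintegral => //; exact: bmeas_integrable. Qed.

Lemma EFin_mean f : bmeas f -> (\int[P]_x f x)%:E = (\int[P]_x (f x)%:E)%E.
Proof.
by move=> bf; rewrite fineK//; apply: integrable_fin_num => //; exact: bmeas_integrable.
Qed.

Lemma mean_le f (b : R) : bmeas f -> (forall x, f x <= b) -> \int[P]_x f x <= b.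
Proof. by move=> bf h; have := le_mean bf (bmeas_cst b) h; rewrite mean_cst. Qed.

Lemma mean_ge f (a : R) : bmeas f -> (forall x, a <= f x) -> a <= \int[P]_x f x.
Proof. by move=> bf h; have := le_mean (bmeas_cst a) bf h; rewrite mean_cst. Qed.

Lemma ler_norm_mean f (c B : R) : bmeas f -> (forall x, `|f x - c| <= B) ->
  `|\int[P]_x f x - c| <= B.
Proof.
move=> bf h; rewrite ler_norml lerBlDl lerBrDl.
by apply/andP; split; [apply: mean_ge => // x|apply: mean_le => // x];
  move: (h x); rewrite ler_norml lerBlDl lerBrDl => /andP[].
Qed.

Lemma mean_expR_gt0 f : bmeas f -> 0 < \int[P]_x expR (f x).
Proof.
move=> bf; have [mf [B hB]] := bf.
apply: lt_le_trans (expR_gt0 (- B)) _.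
apply: mean_ge; first exact: bmeas_expR.
by move=> x; rewrite ler_expR; have := hB x; rewrite ler_norml => /andP[].
Qed.

Lemma jensen_expR f : bmeas f -> expR (\int[P]_x f x) <= \int[P]_x expR (f x).
Proof.
move=> bf; set m := \int[P]_x f x.
have -> : expR m = \int[P]_x (expR m * (1 + (f x - m))).
  have b1 : bmeas (fun x => f x - m) by apply: bmeasB => //; exact: bmeas_cst.
  rewrite meanZ ?meanD ?meanB ?mean_cst ?subrr ?addr0 ?mulr1//; try exact: bmeas_cst.
  by apply: bmeasD => //; exact: bmeas_cst.
apply: le_mean; last by move=> x; exact: expR_tangent.
- apply: bmeasM; first exact: bmeas_cst.
  by apply: bmeasD; [exact: bmeas_cst|apply: bmeasB => //; exact: bmeas_cst].
- exact: bmeas_expR.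
Qed.

End bounded_measurable.

Section bounded_measurable_prod.
Context d1 d2 (T1 : measurableType d1) (T2 : measurableType d2) {R : realType}.
Variables (P : probability T1 R) (Q : probability T2 R).
Variable f : T1 * T2 -> R.
Hypothesis bf : bmeas f.

Lemma bmeas_pair1 x : bmeas (fun y => f (x, y)).
Proof.
have [mf [B hB]] := bf; split; last by exists B.
exact: (measurableT_comp mf).
Qed.

Lemma bmeas_pair2 y : bmeas (fun x => f (x, y)).
Proof.
have [mf [B hB]] := bf; split; last by exists B.
exact: (measurableT_comp mf).
Qed.

Let intf : (P \x Q)%E.-integrable setT (EFin \o f).
Proof.
have [mf [B hB]] := bf; apply: measurable_bounded_integrable => //.
  apply: (@le_lt_trans _ _ ((P \x Q)%E (setT `*` setT))); first by rewrite setXTT.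
  have -> : (P \x Q)%E (setT `*` setT) = (P setT * Q setT)%E by exact: product_measure1E.
  by rewrite !probability_setT mule1 ltry.
exists B; split; first exact: num_real.
by move=> M BM x _; apply: (le_trans (hB x)); exact: ltW.
Qed.

Lemma bmeas_mean1 : bmeas (fun x => \int[Q]_y f (x, y)).
Proof.
have [mf [B hB]] := bf; split; last first.
  exists B => x; rewrite -[X in `|X|]subr0; apply: ler_norm_mean; first exact: bmeas_pair1.
  by move=> y; rewrite subr0.
apply: measurableT_comp => //.
by have := measurable_fubini_F intf.
Qed.

Lemma bmeas_mean2 : bmeas (fun y => \int[P]_x f (x, y)).
Proof.
have [mf [B hB]] := bf; split; last first.
  exists B => x; rewrite -[X in `|X|]subr0; apply: ler_norm_mean; first exact: bmeas_pair2.
  by move=> y; rewrite subr0.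
apply: measurableT_comp => //.
by have := measurable_fubini_G intf.
Qed.

Lemma mean_Fubini : \int[P]_x \int[Q]_y f (x, y) = \int[Q]_y \int[P]_x f (x, y).
Proof.
rewrite /Rintegral; congr fine.
transitivity (\int[P]_x \int[Q]_y (f (x, y))%:E)%E.
  apply: eq_integral => x _; rewrite fineK//.
  by apply: integrable_fin_num => //; exact: bmeas_integrable (bmeas_pair1 x).
rewrite (Fubini intf); apply: eq_integral => y _; rewrite fineK//.
by apply: integrable_fin_num => //; exact: bmeas_integrable (bmeas_pair2 y).
Qed.

End bounded_measurable_prod.

(** * Densities and affine images of normal laws *)

Section normal.
Context {R : realType}.
Local Notation mR := (measurableTypeR R).
Local Notation mu := (@lebesgue_measure R).

(** The Radon-Nikodym derivative is almost everywhere the explicit density, since both have the same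
    integral over every measurable set. *)
Lemma ge0_integral_normal_prob (m s : R) (f : mR -> \bar R) :
  measurable_fun setT f -> (forall x, 0 <= f x)%E ->
  (\int[normal_prob m s]_x f x = \int[mu]_x (f x * (normal_pdf m s x)%:E))%E.
Proof.
move=> mf f0; have dom := @normal_prob_dominates R m s.
rewrite -(Radon_Nikodym_SigmaFinite.change_of_variables dom f0 measurableT mf).
set g := Radon_Nikodym_SigmaFinite.f _ _.
have ig : mu.-integrable setT g by exact: Radon_Nikodym_SigmaFinite.f_integrable.
have mg := measurable_int _ ig.
apply: ae_eq_integral => //.
- exact: emeasurable_funM.
- apply: emeasurable_funM => //; apply/measurable_EFinP; exact: measurable_normal_pdf.
- apply: ae_eqe_mul2l; apply: integral_ae_eq => //.
  + by apply/measurable_EFinP; exact: measurable_normal_pdf.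
  + by move=> E _ mE; rewrite -Radon_Nikodym_SigmaFinite.f_integral.
Qed.

(** By uniqueness of Lebesgue measure: its image under the affine map, scaled by [s], gives
    half-open intervals their length. *)
Lemma ge0_integral_affine (c s : R) (f : mR -> \bar R) : 0 < s ->
  measurable_fun setT f -> (forall x, 0 <= f x)%E ->
  (\int[mu]_x f x = s%:E * \int[mu]_x f (c + s * x)%R)%E.
Proof.
move=> s0 mf f0.
pose h (x : mR) : mR := c + s * x.
have mh : measurable_fun setT h.
  by apply: measurable_funD => //; exact: measurable_funM.
pose nu0 : {measure set mR -> \bar R} := mscale (NngNum (ltW s0)) (pushforward mu h).
pose nu := nu0 mh.
have e A : measurable A -> mu A = nu A.
  apply: lebesgue_measure_unique => _ [[a b]] _ <-.
  rewrite [RHS](_ : _ = s%:E * mu (h @^-1` `]a, b]%classic))%E//.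
  have -> : h @^-1` `]a, b]%classic = `](a - c) / s, (b - c) / s]%classic.
    apply/seteqP; split => x /=; rewrite !in_itv/= /h ltr_pdivrMr// ler_pdivlMr//;
    by rewrite ltrBlDl lerBrDl mulrC.
  rewrite !lebesgue_measure_itv/= !lte_fin ltr_pM2r ?invr_gt0// ltrBlDr subrK.
  case: ifP => _; last by rewrite mule0.
  by rewrite -!EFinD -EFinM; congr (_%:E); field; rewrite gt_eqF.
rewrite (eq_measure_integral nu); last by move=> A mA _; exact: e.
rewrite ge0_integral_mscale//=; congr (_ * _)%E.
by rewrite (ge0_integral_pushforward mh).
Qed.

Lemma normal_pdf_gt0E (m s x : R) : 0 < s ->
  normal_pdf m s x = (Num.sqrt (2 * pi))^-1 * s^-1 * expR (- (x - m) ^+ 2 / (2 * s ^+ 2)).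
Proof.
move=> s0; rewrite /normal_pdf gt_eqF// /normal_fun /normal_peak.
rewrite -mulr_natl [(s ^+ 2 *+ 2)%R](_ : _ = 2 * s ^+ 2); last by rewrite mulr_natl.
rewrite (_ : 2 * (s ^+ 2 * pi) = (2 * pi) * s ^+ 2); last by ring.
by rewrite sqrtrM ?mulr_ge0 ?pi_ge0// sqrtr_sqr gtr0_norm// invfM.
Qed.

Lemma ge0_normal_prob_affine (c s : R) (f : mR -> \bar R) : 0 < s ->
  measurable_fun setT f -> (forall x, 0 <= f x)%E ->
  (\int[normal_prob c s]_x f x = \int[normal_prob 0 1]_x f (c + s * x)%R)%E.
Proof.
move=> s0 mf f0.
have mh : measurable_fun setT (fun x : mR => c + s * x : mR).
  by apply: measurable_funD => //; exact: measurable_funM.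
have mfh := measurableT_comp mf mh.
rewrite [LHS](ge0_integral_normal_prob _ _ mf f0).
rewrite [RHS](ge0_integral_normal_prob _ _ mfh (fun x => f0 _)).
rewrite (@ge0_integral_affine c s)//; last 2 first.
- by apply: emeasurable_funM => //; apply/measurable_EFinP; exact: measurable_normal_pdf.
- by move=> x; rewrite mule_ge0// lee_fin normal_pdf_ge0.
rewrite -ge0_integralZl//; last 3 first.
- apply: emeasurable_funM; first exact: mfh.
  by apply/measurable_EFinP; exact: (measurableT_comp (measurable_normal_pdf _ _) mh).
- by move=> x _; rewrite mule_ge0// lee_fin normal_pdf_ge0.
- by rewrite lee_fin ltW.
apply: eq_integral => x _.
rewrite muleCA; congr (_ * _)%E; rewrite -EFinM; congr (_%:E).
rewrite !normal_pdf_gt0E// invr1 mulr1 mulrA mulrCA mulfV ?gt_eqF// mulr1.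
by congr (_ * expR _); field; rewrite gt_eqF.
Qed.

End normal.

Section gauss1.
Context {R : realType}.
Local Notation mR := (measurableTypeR R).
Local Notation mu := (@lebesgue_measure R).
Local Notation gamma := (@normal_prob R 0 1).

Lemma measurable_affine (c s : R) : measurable_fun setT (fun x : mR => c + s * x : mR).
Proof. by apply: measurable_funD => //; exact: measurable_funM. Qed.

(** With [v = x + s * y + t * z], the joint density of [y] and [v] is factored as the density of [v]
    times the conditional density of [y] given [v]; Tonelli integrates the latter to one. *)
Lemma ge0_gauss_semigroup (x s t : R) (f : mR -> \bar R) : 0 < s -> 0 < t ->
  measurable_fun setT f -> (forall x, 0 <= f x)%E ->
  (\int[gamma]_y \int[gamma]_z f (x + s * y + t * z)%R =
   \int[gamma]_w f (x + Num.sqrt (s ^+ 2 + t ^+ 2) * w)%R)%E.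
Proof.
move=> s0 t0 mf f0; set r := Num.sqrt _.
have r0 : 0 < r by rewrite sqrtr_gt0 addr_gt0// exprn_gt0.
have r2 : r ^+ 2 = s ^+ 2 + t ^+ 2 by rewrite sqr_sqrtr// addr_ge0// sqr_ge0.

(* Conditional mean of [y] given [v]; the conditional deviation is [t / r]. *)
pose m1 v := s * (v - x) / r ^+ 2.
have pdfE y v : normal_pdf 0 1 y * normal_pdf (x + s * y) t v =
    normal_pdf x r v * normal_pdf (m1 v) (t / r) y.
  rewrite !normal_pdf_gt0E ?divr_gt0//.
  rewrite invr1 mulr1 mulrACA [RHS]mulrACA -!expRD; congr (_ * expR _).
    by field; rewrite !gt_eqF// sqrtr_gt0 mulr_gt0 ?pi_gt0.
  rewrite /m1 subr0 expr_div_n r2.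
  by field; rewrite ?gt_eqF// addr_gt0// exprn_gt0.
have maff (c d : R) : measurable_fun setT (fun z : mR => f (c + d * z)).
  exact: measurableT_comp mf (measurable_affine _ _).
have mpdf : measurable_fun setT (fun yv : mR * mR =>
    (f yv.2 * (normal_pdf (x + s * yv.1) t yv.2 * normal_pdf 0 1 yv.1)%:E)%E).
  apply: emeasurable_funM; first exact: (measurableT_comp mf).
  apply/measurable_EFinP.
  rewrite (_ : (fun _ => _) = (fun yv : mR * mR =>
     normal_pdf 0 t (yv.2 + - (x + s * yv.1)) * normal_pdf 0 1 yv.1)); last first.
    apply/funext => yv; congr (_ * _); rewrite !normal_pdf_gt0E// subr0.
    by congr (_ * expR (- (_ ^+ 2) / _)).
  apply: measurable_funM.
    apply: (measurableT_comp (measurable_normal_pdf _ _)).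
    apply: measurable_funD => //; apply: measurable_funN.
    exact: (measurableT_comp (measurable_affine _ _)).
  exact: (measurableT_comp (measurable_normal_pdf _ _)).
have g0 y v : (0 <= f v * (normal_pdf (x + s * y) t v * normal_pdf 0 1 y)%:E)%E.
  by rewrite mule_ge0// lee_fin mulr_ge0// normal_pdf_ge0.
have innerE y : (\int[gamma]_z f (x + s * y + t * z)%R * (normal_pdf 0 1 y)%:E =
   \int[mu]_v (f v * (normal_pdf (x + s * y) t v * normal_pdf 0 1 y)%:E))%E.
  rewrite -ge0_normal_prob_affine// (ge0_integral_normal_prob _ _ mf f0).
  rewrite -ge0_integralZr//; last 3 first.
  - by apply: emeasurable_funM => //; apply/measurable_EFinP; exact: measurable_normal_pdf.
  - by move=> v _; rewrite mule_ge0// lee_fin normal_pdf_ge0.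
  - by rewrite lee_fin normal_pdf_ge0.
  by apply: eq_integral => v _; rewrite -muleA -EFinM.
rewrite [LHS]ge0_integral_normal_prob; last 2 first.
- have mq : measurable_fun setT (fun yz : mR * mR => f (x + s * yz.1 + t * yz.2)%R).
    apply: (measurableT_comp mf); apply: measurable_funD; last exact: measurable_funM.
    exact: (measurableT_comp (measurable_affine _ _)).
  exact: (measurable_fun_fubini_tonelli_F _ mq).
- by move=> y; exact: integral_ge0.
under eq_integral do rewrite innerE.
rewrite (fubini_tonelli _ mpdf)//=.
rewrite -ge0_normal_prob_affine// (ge0_integral_normal_prob _ _ mf f0).
apply: eq_integral => v _.
under eq_integral do rewrite mulrC pdfE EFinM muleA.
rewrite ge0_integralZl//.
- by rewrite integral_normal_pdf mule1.
- by apply/measurable_EFinP; exact: measurable_normal_pdf.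
- by move=> y _; rewrite lee_fin normal_pdf_ge0.
- by rewrite mule_ge0// lee_fin normal_pdf_ge0.
Qed.

End gauss1.

(** * Taylor bounds and Gaussian moments *)

Section exp_taylor.
Context {R : realType}.
Implicit Types u v : R.

Let expR_sub1 x : expR x - 1 <= x * expR x :> R.
Proof. by have := expR_tangent x (0 : R); rewrite expR0 sub0r; lra. Qed.

Let ge0_of_derive (f df : R -> R) (x : R) : (forall x : R, is_derive x 1 f (df x)) ->
  f 0 = 0 -> (forall x, 0 <= x -> 0 <= df x) -> 0 <= x -> 0 <= f x.
Proof. by move=> h f0 d x0; rewrite -f0; exact: ge0_derive_ge0 h d _ x0. Qed.

Lemma expR_taylor2_ge0 u : 0 <= u ->
  0 <= expR u - 1 - u - u ^+ 2 / 2 <= u ^+ 3 * expR u.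
Proof.
move=> u0; apply/andP; split.
  apply: (@ge0_of_derive (fun x => expR x - 1 - x - x ^+ 2 / 2) (fun x => expR x - 1 - x)) => //.
  - by move=> x; apply: is_derive_eq; rewrite /GRing.scale/=; lra.
  - by rewrite expR0; lra.
  - by move=> x x0; have := expR_ge1Dx x; lra.
rewrite -subr_ge0.
have h2 (x : R) : 0 <= x -> 0 <= x ^+ 2 * expR x - (expR x - 1 - x).
  apply: (@ge0_of_derive (fun x => x ^+ 2 * expR x - (expR x - 1 - x))
    (fun x => x * expR x + x ^+ 2 * expR x + (x * expR x - (expR x - 1)))).
  - by move=> {}x; apply: is_derive_eq; rewrite /GRing.scale/=; ring.
  - by rewrite expR0; ring.
  - move=> {}x x0; apply: addr_ge0; last by rewrite subr_ge0.
    by rewrite addr_ge0// mulr_ge0 ?expR_ge0 ?sqr_ge0.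
apply: (@ge0_of_derive (fun x => x ^+ 3 * expR x - (expR x - 1 - x - x ^+ 2 / 2))
  (fun x => 2 * x ^+ 2 * expR x + x ^+ 3 * expR x +
    (x ^+ 2 * expR x - (expR x - 1 - x)))) => //.
- by move=> x; apply: is_derive_eq; rewrite /GRing.scale/=; field.
- by rewrite expR0; ring.
- move=> x x0; apply: addr_ge0; last exact: h2.
  by rewrite addr_ge0// !mulr_ge0 ?expR_ge0 ?exprn_ge0.
Qed.

Lemma expR_taylor2_le0 v : 0 <= v ->
  0 <= 1 - v + v ^+ 2 / 2 - expR (- v) <= v ^+ 3.
Proof.
move=> v0; apply/andP; split.
  apply: (@ge0_of_derive (fun v => 1 - v + v ^+ 2 / 2 - expR (- v)) (fun x => expR (- x) - 1 + x)) => //.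
  - by move=> x; apply: is_derive_eq; rewrite /GRing.scale/=; lra.
  - by rewrite oppr0 expR0; lra.
  - by move=> x x0; have := expR_ge1Dx (- x); lra.
rewrite -subr_ge0.
have h2 (x : R) : 0 <= x -> 0 <= 3 * x ^+ 2 - (expR (- x) - 1 + x).
  apply: (@ge0_of_derive (fun x => 3 * x ^+ 2 - (expR (- x) - 1 + x)) (fun x => 6 * x + expR (- x) - 1)) => //.
  - by move=> {}x; apply: is_derive_eq; rewrite /GRing.scale/=; ring.
  - by rewrite oppr0 expR0; ring.
  - by move=> {}x x0; have := expR_ge1Dx (- x); lra.
apply: (@ge0_of_derive (fun v => v ^+ 3 - (1 - v + v ^+ 2 / 2 - expR (- v)))
  (fun x => 3 * x ^+ 2 - (expR (- x) - 1 + x))) => //.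
- by move=> x; apply: is_derive_eq; rewrite /GRing.scale/=; field.
- by rewrite oppr0 expR0; ring.
Qed.

Lemma expR_taylor2 u : `|expR u - 1 - u - u ^+ 2 / 2| <= `|u| ^+ 3 * expR `|u|.
Proof.
have [u0|/ltW u0] := leP 0 u.
  by have /andP[l r] := expR_taylor2_ge0 u0; rewrite ger0_norm// (ger0_norm u0).
have nu0 : 0 <= - u by rewrite oppr_ge0.
have /andP[] := expR_taylor2_le0 nu0; rewrite opprK sqrrN => l r.
rewrite -normrN ger0_norm; last by move: l; lra.
rewrite (ler0_norm u0).
have e1 : 1 <= expR (- u) by rewrite -expR0 ler_expR.
have : (- u) ^+ 3 <= (- u) ^+ 3 * expR (- u) by rewrite ler_peMr ?exprn_ge0.
by move: r; lra.
Qed.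

(* [expR (t * y - t ^+ 2 / 2)] is the generating function of the Hermite polynomials. *)
Lemma hermite_taylor (t y : R) : `|t| <= 1 ->
  `|expR (t * y - t ^+ 2 / 2) - 1 - t * y - t ^+ 2 / 2 * (y ^+ 2 - 1)| <=
  7 * `|t| ^+ 3 * expR (2 * (`|y| + 1)).
Proof.
move=> t1; set u := t * y - _; set w := `|y| + 1.
have w1 : 1 <= w by rewrite lerDr.
have t0 := normr_ge0 t; have y0 := normr_ge0 y.
have t2 : `|t| ^+ 2 <= `|t| by rewrite expr2 ler_piMl.
have hu : `|u| <= `|t| * w.
  rewrite /u /w (le_trans (ler_normB _ _))// normrM mulrDr mulr1 lerD2l.
  rewrite ger0_norm ?divr_ge0 ?sqr_ge0// -(real_normK (num_real t)).
  by move: t2 t0; set q := `|t| ^+ 2; lra.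
have hu' : `|u| <= w by rewrite (le_trans hu)// ler_piMl// (le_trans _ w1).
(* The constant 7 splits as 6 + 1: the remainder of [expR u] costs 6 through [w ^+ 3 <= 6 * expR w],
   and the part of [u ^+ 2 / 2] of order three and four in [t] costs 1 in [e2]. *)
have e1 : `|expR u - 1 - u - u ^+ 2 / 2| <= 6 * `|t| ^+ 3 * expR (2 * w).
  apply: (le_trans (expR_taylor2 u)).
  have w3 : w ^+ 3 <= 6 * expR w.
    have := @expR_ge1Dxn R w 2 (le_trans ler01 w1).
    rewrite !factS fact0 muln1; lra.
  have -> : expR (2 * w) = expR w * expR w by rewrite -expRD -mulr2n mulr_natl.
  rewrite mulrA ler_pM ?exprn_ge0 ?expR_ge0//; last by rewrite ler_expR.
  apply: (@le_trans _ _ ((`|t| * w) ^+ 3)); first by rewrite lerXn2r ?nnegrE// (le_trans _ hu).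
  rewrite exprMn (_ : 6 * _ * _ = `|t| ^+ 3 * (6 * expR w)); last by ring.
  by rewrite ler_wpM2l// exprn_ge0.
have e2 : `|- t ^+ 3 * y / 2 + t ^+ 4 / 8| <= `|t| ^+ 3 * expR (2 * w).
  apply: (@le_trans _ _ (`|t| ^+ 3 * w)); last first.
    rewrite ler_wpM2l ?exprn_ge0//; have := expR_ge1Dx (2 * w); move: w1; lra.
  apply: (le_trans (ler_normD _ _)).
  have -> : `|- t ^+ 3 * y / 2| = `|t| ^+ 3 * `|y| / 2.
    by rewrite normrM normrM normrN normrX (@gtr0_norm _ 2^-1).
  have -> : `|t ^+ 4 / 8| = `|t| ^+ 3 * `|t| / 8.
    by rewrite normrM normrX (@gtr0_norm _ 8^-1)// -exprSr.
  rewrite /w.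
  have t3 : 0 <= `|t| ^+ 3 by rewrite exprn_ge0.
  have : `|t| ^+ 3 * `|t| <= `|t| ^+ 3 by rewrite ler_piMr.
  have : 0 <= `|t| ^+ 3 * `|y| by rewrite mulr_ge0.
  rewrite mulrDr mulr1; set A := `|t| ^+ 3 * `|y|; set B := `|t| ^+ 3 * `|t|; lra.
have -> : expR u - 1 - t * y - t ^+ 2 / 2 * (y ^+ 2 - 1) =
   (expR u - 1 - u - u ^+ 2 / 2) + (- t ^+ 3 * y / 2 + t ^+ 4 / 8).
  by rewrite /u; field.
by rewrite (le_trans (ler_normD _ _))//; move: e1 e2; lra.
Qed.

End exp_taylor.

Section real_integrable.
Context d (T : measurableType d) {R : realType} (mu : {measure set T -> \bar R}).
Implicit Types f g : T -> R.

Lemma integrableRZ (k : R) f : mu.-integrable setT (EFin \o f) ->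
  mu.-integrable setT (EFin \o (fun x => k * f x)).
Proof. by move=> /(integrableZl measurableT k); apply: eq_integrable. Qed.

Lemma integrableRD f g : mu.-integrable setT (EFin \o f) ->
  mu.-integrable setT (EFin \o g) ->
  mu.-integrable setT (EFin \o (fun x => f x + g x)).
Proof. by move=> fi gi; have := integrableD measurableT fi gi; apply: eq_integrable. Qed.

End real_integrable.

Section gauss_moments.
Context {R : realType}.
Local Notation mR := (measurableTypeR R).
Local Notation mu := (@lebesgue_measure R).
Local Notation gamma := (@normal_prob R 0 1).

(** The integrand times the standard density is [s] times the density of deviation [s]. This Laplace
    transform of [y ^+ 2] yields the integrability of [expR (y ^+ 2 / 4)] at [s = Num.sqrt 2], and
    the variance from its behaviour as [s] tends to 1. *)
Lemma int_gauss_quadratic (s : R) : 0 < s ->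
  (\int[gamma]_y (expR (- ((s ^- 2 - 1) / 2) * y ^+ 2))%:E = s%:E)%E.
Proof.
move=> s0; rewrite ge0_integral_normal_prob; last 2 first.
- apply/measurable_EFinP; apply: measurableT_comp => //.
  by apply: measurable_funM => //; exact: measurable_funX.
- by move=> y; rewrite lee_fin expR_ge0.
transitivity (\int[mu]_y (s%:E * (normal_pdf 0 s y)%:E))%E.
  apply: eq_integral => y _; rewrite -!EFinM !normal_pdf_gt0E//; congr (_%:E).
  rewrite mulrCA invr1 mulr1 -expRD.
  rewrite [RHS]mulrA (mulrCA s) mulfV ?gt_eqF// mulr1; congr (_ * expR _).
  by field; rewrite gt_eqF.
rewrite integralZl ?integral_normal_pdf ?mule1//.
exact: integrable_normal_pdf.
Qed.

Let exp4 (y : R) := expR (y ^+ 2 / 4).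

Lemma integrable_exp4 : gamma.-integrable setT (EFin \o exp4).
Proof.
apply/integrableP; split.
  by apply/measurable_EFinP; apply: measurableT_comp => //; apply: measurable_funM => //; exact: measurable_funX.
have s2 : 0 < Num.sqrt 2 :> R by rewrite sqrtr_gt0.
have := int_gauss_quadratic s2.
under eq_integral do rewrite sqr_sqrtr//.
move=> e; under eq_integral.
  move=> y _; rewrite /= ger0_norm ?expR_ge0// /exp4.
  rewrite (_ : y ^+ 2 / 4 = - ((2^-1 - 1) / 2) * y ^+ 2); last by field.
  over.
by rewrite e ltry.
Qed.

Lemma integrable_le_exp4 (f : mR -> R) (C : R) : measurable_fun setT f ->
  (forall y, `|f y| <= C * exp4 y) -> gamma.-integrable setT (EFin \o f).
Proof.
move=> mf h.
have hC : gamma.-integrable setT (fun y => C%:E * (EFin \o exp4) y)%E.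
  by apply: integrableZl => //; exact: integrable_exp4.
apply: (le_integrable _ _ _ hC) => //; first exact/measurable_EFinP.
move=> y _ /=; rewrite lee_fin; apply: (le_trans (h y)).
exact: ler_norm.
Qed.


Let le_exp4 y : y ^+ 4 <= 32 * exp4 y.
Proof.
have := @expR_ge1Dxn R (y ^+ 2 / 4) 1 (divr_ge0 (sqr_ge0 _) (ler0n _ 4)).
rewrite -/(exp4 y) (_ : (y ^+ 2 / 4) ^+ 2 = y ^+ 4 / 16); last by field.
by rewrite !factS fact0 !muln1; lra.
Qed.

Let exp4_ge1 y : 1 <= exp4 y.
Proof. by rewrite -expR0 ler_expR divr_ge0// sqr_ge0. Qed.

Lemma expR_le_exp4 (y : R) : expR (2 * (`|y| + 1)) <= expR 6 * exp4 y.
Proof.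
rewrite -expRD ler_expR -(real_normK (num_real y)).
have := sqr_ge0 (`|y| / 2 - 2); rewrite sqrrB; set t := `|y|; rewrite !expr2; lra.
Qed.

Lemma gauss_integrableX (n : nat) : (n <= 4)%N ->
  gamma.-integrable setT (EFin \o (fun y : mR => `|y| ^+ n)).
Proof.
move=> n4; apply: (@integrable_le_exp4 _ 33).
  by apply: (@measurable_funX _ _ _ setT (fun y : mR => `|y|)); exact: normr_measurable.
move=> y; rewrite normrX normr_id.
apply: (@le_trans _ _ (1 + `|y| ^+ 4)); last first.
  by rewrite -normrX ger0_norm ?exprn_even_ge0//; have := exp4_ge1 y; have := le_exp4 y; lra.
have [y1|/ltW y1] := leP `|y| 1.
  by rewrite (@le_trans _ _ 1) ?exprn_ile1// lerDl exprn_ge0.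
by rewrite (@le_trans _ _ (`|y| ^+ 4)) ?ler_weXn2l// lerDr.
Qed.

Lemma gauss_integrable_sqr : gamma.-integrable setT (EFin \o (fun y : mR => y ^+ 2)).
Proof.
apply: eq_integrable (gauss_integrableX (isT : 2 <= 4)%N) => //.
by move=> y _ /=; rewrite real_normK ?num_real.
Qed.

(** Differentiates the Laplace transform at [s = 1] by hand. With [u = (s ^- 2 - 1) / 2], the bounds
    [1 - u y^2 <= q <= 1 - u y^2 + u^2 y^4] are integrated, where [q] has mean [s]; for [s = 1 - d]
    both [1 - s] and [u] are [d] to first order. *)
Lemma gauss_variance : \int[gamma]_y (y ^+ 2) = 1.
Proof.
set v := Rintegral _ _ _; set m4 := \int[gamma]_y (`|y| ^+ 4).
pose q (s y : R) := expR (- ((s ^- 2 - 1) / 2) * y ^+ 2).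
have q_ge0 s y : 0 <= q s y by exact: expR_ge0.
have bq s : 0 < s -> s < 1 -> bmeas (q s : mR -> R).
  move=> s0 s1; split.
    by apply: measurableT_comp => //; apply: measurable_funM => //; exact: measurable_funX.
  exists 1 => y; rewrite ger0_norm// -expR0 ler_expR mulNr oppr_le0 mulr_ge0 ?sqr_ge0//.
  by rewrite divr_ge0// subr_ge0 invf_ge1 ?exprn_gt0// exprn_ile1// ltW.
have Eq s : 0 < s -> s < 1 -> \int[gamma]_y q s y = s.
  by move=> s0 s1; rewrite /Rintegral int_gauss_quadratic.
have E1q s : 0 < s -> s < 1 -> \int[gamma]_y (1 - q s y) = 1 - s.
  by move=> s0 s1; rewrite meanB ?mean_cst ?Eq//; [exact: bmeas_cst|exact: bq].
have iq s : 0 < s -> s < 1 -> gamma.-integrable setT (EFin \o (fun y => 1 - q s y)).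
  by move=> s0 s1; apply: bmeas_integrable; apply: bmeasB; [exact: bmeas_cst|exact: bq].
have tau0 (s : R) : 0 < s -> s < 1 -> 0 < (s ^- 2 - 1) / 2.
  by move=> s0 s1; rewrite divr_gt0// subr_gt0 invf_gt1 ?exprn_gt0// exprn_ilt1// ltW.
have low s : 0 < s -> s < 1 -> 1 - s <= (s ^- 2 - 1) / 2 * v.
  move=> s0 s1; rewrite -E1q// -RintegralZl//; last exact: gauss_integrable_sqr.
  apply: le_Rintegral => //.
  - exact: iq.
  - by apply: integrableRZ; exact: gauss_integrable_sqr.
  - by move=> y _; have := expR_ge1Dx (- ((s ^- 2 - 1) / 2) * y ^+ 2); rewrite -/(q s y); lra.
have up s : 0 < s -> s < 1 -> (s ^- 2 - 1) / 2 * v <= 1 - s + ((s ^- 2 - 1) / 2) ^+ 2 * m4.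
  move=> s0 s1; rewrite -E1q// -!RintegralZl//; last 2 first.
  - exact: gauss_integrableX.
  - exact: gauss_integrable_sqr.
  rewrite -RintegralD//; last 2 first.
  - exact: iq.
  - by apply: integrableRZ; exact: gauss_integrableX.
  apply: le_Rintegral => //.
  - by apply: integrableRZ; exact: gauss_integrable_sqr.
  - apply: (integrableRD (iq s s0 s1)).
    by apply: integrableRZ; exact: gauss_integrableX.
  - move=> y _; set u := (s ^- 2 - 1) / 2.
    have u0 : 0 <= u * y ^+ 2 by rewrite mulr_ge0 ?sqr_ge0// ltW// tau0.
    have -> : `|y| ^+ 4 = (y ^+ 2) ^+ 2 by rewrite -normrX ger0_norm ?exprn_even_ge0// -exprM.
    have /andP[+ _] := expR_taylor2_le0 u0.
    rewrite (_ : q s y = expR (- (u * y ^+ 2))); last by rewrite /q mulNr.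
    by rewrite -exprMn; have := sqr_ge0 (u * y ^+ 2); lra.
have v0 : 0 <= v by apply: Rintegral_ge0 => y _; exact: sqr_ge0.
have m40 : 0 <= m4 by apply: Rintegral_ge0 => y _; rewrite exprn_ge0.
have uE (s : R) : 0 < s -> (s ^- 2 - 1) / 2 = (1 - s) * (1 + s) / (2 * s ^+ 2).
  by move=> s0; field; rewrite gt_eqF.
have low' d : 0 < d -> d < 1 / 2 -> 1 <= v + 2 * d.
  move=> d0 d1; have s0 : 0 < 1 - d by lra.
  have s1 : 1 - d < 1 by lra.
  have := low (1 - d) s0 s1; rewrite uE//.
  have -> : (1 - (1 - d)) * (1 + (1 - d)) / (2 * (1 - d) ^+ 2) * v =
    d * ((2 - d) * v) / (2 * (1 - d) ^+ 2) by field; rewrite gt_eqF.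
  rewrite ler_pdivlMr ?mulr_gt0 ?exprn_gt0// opprB addrCA subrr addr0 ler_pM2l//.
  have : 0 <= d * v by rewrite mulr_ge0// ltW.
  by have := sqr_ge0 d; nra.
(* The factor 16 is the square of the 4 in [u <= 4 * d], valid since [1 - d > 1 / 2]. *)
have up' d : 0 < d -> d < 1 / 2 -> v <= 1 + d * (16 * m4 + v / 2).
  move=> d0 d1; have s0 : 0 < 1 - d by lra.
  have s1 : 1 - d < 1 by lra.
  have := up (1 - d) s0 s1; rewrite uE//.
  have -> : (1 - (1 - d)) * (1 + (1 - d)) / (2 * (1 - d) ^+ 2) * v =
    d * ((2 - d) * v) / (2 * (1 - d) ^+ 2) by field; rewrite gt_eqF.
  rewrite ler_pdivrMr ?mulr_gt0 ?exprn_gt0// opprB addrCA subrr addr0.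
  set u := d * _ / _.
  have u0 : 0 <= u by rewrite /u divr_ge0// ?mulr_ge0 ?sqr_ge0//; lra.
  have u4 : u <= 4 * d.
    rewrite /u ler_pdivrMr ?mulr_gt0 ?exprn_gt0//; nra.
  have : u ^+ 2 * m4 <= 16 * d ^+ 2 * m4.
    by rewrite ler_wpM2r// (_ : 16 * d ^+ 2 = (4 * d) ^+ 2) ?lerXn2r ?nnegrE// ?mulr_ge0 ?(ltW d0)//; ring.
  set w := u ^+ 2 * m4 => w1 h.
  have w0 : 0 <= w by rewrite mulr_ge0// sqr_ge0.
  have h2 : d * ((2 - d) * v) <= d * (2 + 32 * d * m4).
    apply: (le_trans h); apply: (@le_trans _ _ ((d + w) * 2)); last by nra.
    by rewrite ler_wpM2l// ?addr_ge0// ?(ltW d0)//; nra.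
  by move: h2; rewrite ler_pM2l//; lra.
apply/eqP; rewrite eq_le; apply/andP; split; apply/ler_addgt0Pr => e e0.
  pose M := 16 * m4 + v / 2 + 1.
  have M1 : 1 <= M by rewrite /M lerDr; lra.
  have d0 : 0 < Num.min (1 / 4) (e / M).
    by rewrite lt_min !divr_gt0// (lt_le_trans ltr01).
  have d1 : Num.min (1 / 4) (e / M) < 1 / 2 by rewrite gt_min; apply/orP; left; lra.
  apply: (le_trans (up' _ d0 d1)); rewrite lerD2l.
  have : Num.min (1 / 4) (e / M) <= e / M by rewrite ge_min lexx orbT.
  rewrite ler_pdivlMr ?(lt_le_trans ltr01)//; rewrite /M mulrDr mulr1; move: d0; lra.
have d0 : 0 < Num.min (1 / 4) (e / 2) by rewrite lt_min !divr_gt0.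
have d1 : Num.min (1 / 4) (e / 2) < 1 / 2 by rewrite gt_min; apply/orP; left; lra.
apply: (le_trans (low' _ d0 d1)); rewrite lerD2l.
have : Num.min (1 / 4) (e / 2) <= e / 2 by rewrite ge_min lexx orbT.
lra.
Qed.

Lemma gauss_sym (f : mR -> R) : bmeas f ->
  \int[gamma]_y f (- y) = \int[gamma]_y f y.
Proof.
move=> [mf [B hB]].
have mN : measurable_fun setT (-%R : mR -> mR) by exact: oppr_measurable.
have main (g : mR -> \bar R) : measurable_fun setT g -> (forall x, 0 <= g x)%E ->
    (\int[gamma]_y g (- y)%R = \int[gamma]_y g y)%E.
  move=> mg g0.
  have mgN := measurableT_comp mg mN.
  rewrite [LHS](ge0_integral_normal_prob _ _ mgN (fun x => g0 _)).
  rewrite [RHS](ge0_integral_normal_prob _ _ mg g0).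
  pose F x := (g x * (normal_pdf 0 1 x)%:E)%E.
  have mF : measurable_fun setT F.
    by apply: emeasurable_funM => //; apply/measurable_EFinP; exact: measurable_normal_pdf.
  have F0 x : (0 <= F x)%E by rewrite mule_ge0// lee_fin normal_pdf_ge0.
  rewrite -/F.
  pose nu0 : {measure set mR -> \bar R} := pushforward mu (-%R : mR -> mR).
  pose nu := nu0 mN.
  have nuE A : measurable A -> A `<=` setT -> mu A = nu A.
    by move=> mA _; exact/esym/lebesgue_measureN.
  rewrite [RHS](eq_measure_integral nu nuE).
  have e := @ge0_integral_pushforward _ _ _ _ _ _ mN mu setT F measurableT mF (fun y _ => F0 y).
  rewrite [RHS]e preimage_setT.
  by apply: eq_integral => x _; rewrite /F /= !normal_pdf_gt0E// !subr0 sqrrN.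
have bf : bmeas f by split => //; exists B.
have bfN : bmeas (fun y : mR => f (- y)).
  by split; [exact: (measurableT_comp mf mN)|exists B].
have bB : bmeas (fun y : mR => B) by exact: bmeas_cst.
(* Adding the bound [B] makes the integrand nonnegative, so that the extended-real identity [main]
   applies; the same shift serves in [heat_comp], [gauss_shift] and [mean_gauss_tupleS]. *)
have e : \int[gamma]_y (f (- y) + B) = \int[gamma]_y (f y + B).
  rewrite /Rintegral; congr fine.
  apply: (main (fun y => (f y + B)%:E)).
    by apply/measurable_EFinP; exact: measurable_funD.
  by move=> y; rewrite lee_fin -lerBlDr sub0r; have := hB y; rewrite ler_norml => /andP[].
by apply: (addIr B); move: e; rewrite !meanD// !mean_cst.
Qed.

End gauss_moments.

(** * Hypercontractivity in one variable *)

Section bounded_lipschitz.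
Context {R : realType}.
Local Notation mR := (measurableTypeR R).
Local Notation gamma := (@normal_prob R 0 1).
Implicit Types f g : R -> R.

Definition blip f := (exists B : R, forall x, `|f x| <= B) /\
  (exists L : R, forall x y, `|f x - f y| <= L * `|x - y|).

Lemma blip_continuous f : blip f -> continuous f.
Proof.
move=> [_ [L hL]] x; apply/cvgrPdist_lt => e e0.
have L0 : 0 < `|L| + 1 by rewrite ltr_wpDl.
near=> y; apply: (le_lt_trans (hL x y)).
apply: (@le_lt_trans _ _ ((`|L| + 1) * `|x - y|)).
  by rewrite ler_wpM2r// (le_trans (ler_norm _))// lerDl.
rewrite -ltr_pdivlMl// mulrC.
near: y; apply: cvgr_dist_lt => //.
by rewrite divr_gt0.
Unshelve. all: end_near. Qed.

Lemma blip_bmeas f : blip f -> bmeas (f : mR -> R).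
Proof.
move=> bf; split; last by have [[B hB] _] := bf; exists B.
by apply: continuous_measurable_fun; exact: blip_continuous.
Qed.

Lemma blip_affine f (c s : R) : blip f -> blip (fun y => f (c + s * y)).
Proof.
move=> [[B hB] [L hL]]; split; first by exists B.
exists (L * `|s|) => x y; apply: (le_trans (hL _ _)).
by rewrite -mulrA -normrM [X in `|X|](_ : _ = s * (x - y))//; ring.
Qed.

Lemma blip_bmeas_affine f (c s : R) : blip f -> bmeas (fun y : mR => f (c + s * y)).
Proof. by move=> bf; exact/blip_bmeas/blip_affine. Qed.

Lemma blipZ (k : R) f : blip f -> blip (fun x => k * f x).
Proof.
move=> [[B hB] [L hL]]; split.
  by exists (`|k| * B) => x; rewrite normrM ler_wpM2l.
exists (`|k| * L) => x y; rewrite -mulrBr normrM -mulrA ler_wpM2l//.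
Qed.

Lemma blip_expR f : blip f -> blip (expR \o f).
Proof.
move=> [[B hB] [L hL]]; split.
  exists (expR B) => x; rewrite ger0_norm ?expR_ge0// ler_expR.
  exact: le_trans (ler_norm _) (hB x).
have h x y : expR (f x) - expR (f y) <= expR B * (L * `|x - y|).
  have := expR_tangent (f x) (f y).
  have e1 : expR (f x) <= expR B by rewrite ler_expR (le_trans (ler_norm _) (hB x)).
  have : expR (f x) * (f x - f y) <= expR B * (L * `|x - y|).
    apply: (@le_trans _ _ (expR (f x) * (L * `|x - y|))).
      by rewrite ler_wpM2l ?expR_ge0// (le_trans (ler_norm _)).
    by rewrite ler_wpM2r// (le_trans _ (hL x y)).
  lra.
exists (expR B * L) => x y; rewrite -mulrA ler_norml h andbT lerNl opprB distrC.
exact: h.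
Qed.

(* The heat semigroup at time [s ^+ 2 / 2]. *)
Definition heat (s : R) f (x : R) : R := \int[gamma]_y f (x + s * y).

Lemma blip_heat s f : blip f -> blip (heat s f).
Proof.
move=> bf; have [[B hB] [L hL]] := bf; split.
  exists B => x; rewrite -[X in `|X|]subr0; apply: ler_norm_mean => [|y].
    exact: blip_bmeas_affine.
  by rewrite subr0.
exists L => x y; rewrite /heat -meanB; try exact: blip_bmeas_affine.
rewrite -[X in `|X|]subr0; apply: ler_norm_mean => [|z].
  by apply: bmeasB; exact: blip_bmeas_affine.
by rewrite subr0 (le_trans (hL _ _))// opprD addrACA subrr addr0.
Qed.

Lemma heat0 f x : heat 0 f x = f x.
Proof.
rewrite /heat (_ : (fun y => _) = fun=> f x) ?mean_cst//.
by apply/funext => y; rewrite mul0r addr0.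
Qed.

Lemma heatD s f (c : R) x : blip f -> heat s (fun y => f y + c) x = heat s f x + c.
Proof.
move=> bf; rewrite /heat meanD ?mean_cst//; [exact: blip_bmeas_affine|exact: bmeas_cst].
Qed.

Lemma heat_dist s f g (d x : R) : blip f -> blip g -> (forall y, `|f y - g y| <= d) ->
  `|heat s f x - heat s g x| <= d.
Proof.
move=> bf bg h; rewrite /heat -meanB; try exact: blip_bmeas_affine.
rewrite -[X in `|X|]subr0; apply: ler_norm_mean => [|z].
  by apply: bmeasB; exact: blip_bmeas_affine.
by rewrite subr0.
Qed.

Lemma heat_comp s t f x : blip f -> 0 < s -> 0 <= t ->
  heat s (heat t f) x = heat (Num.sqrt (s ^+ 2 + t ^+ 2)) f x.
Proof.
move=> bf s0; rewrite le_eqVlt => /predU1P[<-|t0].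
  rewrite expr0n addr0 sqrtr_sqr gtr0_norm//; congr (heat s _ x).
  by apply/funext => y; exact: heat0.
have [[B hB] _] := bf.
suff : heat s (heat t (fun y => f y + B)) x = heat (Num.sqrt (s ^+ 2 + t ^+ 2)) (fun y => f y + B) x.
  have -> : heat t (fun y => f y + B) = (fun y => heat t f y + B).
    by apply/funext => y; rewrite heatD.
  by rewrite !heatD//; [move/addIr|exact: blip_heat].
have fB0 y : 0 <= f y + B.
  by rewrite -lerBlDr sub0r; have := hB y; rewrite ler_norml => /andP[].
have bfB : blip (fun y => f y + B).
  have [_ [L hL]] := bf; split; last by exists L => y z; rewrite opprD addrACA subrr addr0.
  by exists (B + B) => y; rewrite ger0_norm// lerD2r (le_trans (ler_norm _)).
rewrite /heat [RHS]/Rintegral.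
have mf : measurable_fun setT (fun y : mR => (f y + B)%:E).
  by apply/measurable_EFinP; have [] := blip_bmeas bfB.
rewrite -(ge0_gauss_semigroup x s0 t0 mf)//; rewrite [LHS]/Rintegral; congr fine.
apply: eq_integral => y _; rewrite EFin_mean//.
exact: (@blip_bmeas_affine (fun y => f y + B)).
Qed.

End bounded_lipschitz.

(** * Lindeberg's replacement of signs by Gaussians *)

Section lindeberg.
Context {R : realType}.
Local Notation mR := (measurableTypeR R).
Local Notation gamma := (@normal_prob R 0 1).
Implicit Types f g : R -> R.

(** The only smoothness that the replacement method uses. Stated as an expansion instead of with
    derivatives, it passes through [heat] with the same [M] by plain integration, see
    [taylor3_heat]. *)
Definition taylor3 (M : R) f := blip f /\ exists f1 f2 : R -> R, [/\ blip f1, blip f2 &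
  forall x t, `|f (x + t) - f x - t * f1 x - t ^+ 2 / 2 * f2 x| <= M * `|t| ^+ 3].

Lemma taylor3_heat M s f : taylor3 M f -> taylor3 M (heat s f).
Proof.
move=> [bf [f1 [f2 [b1 b2 h]]]]; split; first exact: blip_heat.
exists (heat s f1), (heat s f2); split; [exact: blip_heat|exact: blip_heat|].
move=> x t; pose bm := fun g (bg : blip g) c => @blip_bmeas_affine _ g c s bg.
have bmZ k g (bg : blip g) c : bmeas (fun y : mR => k * g (c + s * y)).
  by apply: bmeasM; [exact: bmeas_cst|exact: bm].
rewrite /heat -!meanZ; try exact: bm.
rewrite -!meanB; try by repeat first [exact: bm|exact: bmZ|apply: bmeasB].
rewrite -[X in `|X|]subr0; apply: ler_norm_mean.
  by repeat first [exact: bm|exact: bmZ|apply: bmeasB].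
by move=> y; rewrite subr0 [x + t + _]addrAC.
Qed.

Definition gauss_m3 : R := \int[gamma]_y (`|y| ^+ 3).

Lemma gauss_m3_ge0 : 0 <= gauss_m3.
Proof. by apply: Rintegral_ge0 => y _; rewrite exprn_ge0. Qed.

(** Averaging over [y] and [- y] removes the first-order term, unit variance produces the
    second-order one, and the third absolute moment bounds the rest. *)
Lemma heat_taylor M f f1 f2 (s c : R) : 0 <= s -> blip f ->
  (forall x t, `|f (x + t) - f x - t * f1 x - t ^+ 2 / 2 * f2 x| <= M * `|t| ^+ 3) ->
  `|heat s f c - f c - s ^+ 2 / 2 * f2 c| <= gauss_m3 * M * s ^+ 3.
Proof.
move=> s0 bf h.
have bp := @blip_bmeas_affine _ f c s bf.
have bm : bmeas (fun y : mR => f (c + s * - y)).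
  rewrite (_ : (fun y => _) = (fun y : mR => f (c + (- s) * y))).
    exact: blip_bmeas_affine.
  by apply/funext => y; rewrite mulrN mulNr.
pose gg y := (f (c + s * y) + f (c + s * - y)) / 2 - f c - s ^+ 2 / 2 * f2 c * y ^+ 2.
have bs : bmeas (fun y : mR => 2^-1 * (f (c + s * y) + f (c + s * - y)) + (- f c)).
  apply: bmeasD; last exact: bmeas_cst.
  by apply: bmeasM; [exact: bmeas_cst|exact: bmeasD].
have ggE : gg = (fun y => 2^-1 * (f (c + s * y) + f (c + s * - y)) + (- f c) +
    (- (s ^+ 2 / 2 * f2 c)) * y ^+ 2).
  by apply/funext => y; rewrite /gg; field.
have i2 : gamma.-integrable setT (EFin \o (fun y : mR => (- (s ^+ 2 / 2 * f2 c)) * y ^+ 2)).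
  by apply: integrableRZ; exact: gauss_integrable_sqr.
have ig : gamma.-integrable setT (EFin \o (gg : mR -> R)).
  by rewrite ggE; apply: integrableRD => //; exact: bmeas_integrable.
have -> : heat s f c - f c - s ^+ 2 / 2 * f2 c = \int[gamma]_y gg y.
  rewrite ggE RintegralD//; last exact: bmeas_integrable.
  rewrite meanD ?mean_cst//; last 2 first.
  - by apply: bmeasM; [exact: bmeas_cst|exact: bmeasD].
  - exact: bmeas_cst.
  rewrite meanZ ?meanD//; last exact: bmeasD.
  rewrite (@gauss_sym _ (fun y => f (c + s * y)))// RintegralZl//; last exact: gauss_integrable_sqr.
  by rewrite gauss_variance /heat; set I := Rintegral _ _ _; field.
apply: (le_trans (le_normr_Rintegral _ ig)) => //.
rewrite -mulrA mulrC -RintegralZl//; last exact: gauss_integrableX.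
apply: le_Rintegral => //.
- exact: integrable_norm.
- by apply: integrableRZ; exact: gauss_integrableX.
move=> y _; rewrite /gg.
have h1 := h c (s * y); have h2 := h c (s * - y).
move: h1 h2; rewrite !normrM normrN (ger0_norm s0) !exprMn sqrrN => h1 h2.
set A := f (c + s * y) in h1 *; set B := f (c + s * - y) in h2 *.
have -> : (A + B) / 2 - f c - s ^+ 2 / 2 * f2 c * y ^+ 2 =
  ((A - f c - s * y * f1 c - s ^+ 2 * y ^+ 2 / 2 * f2 c) +
   (B - f c - s * - y * f1 c - s ^+ 2 * y ^+ 2 / 2 * f2 c)) / 2 by field.
rewrite normrM (@gtr0_norm _ 2^-1)// ler_pdivrMr//.
by apply: (le_trans (ler_normD _ _)); move: h1 h2; rewrite -!mulrA; lra.
Qed.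

(** The first summand is the cubic error of a Gaussian step, the second, [2 ^+ 3], that of a sign
    step: seen from its mean, a tilted sign jumps by [(1 - a) * h] or [(1 + a) * h], at most
    [2 * h]. *)
Definition lindeberg_cst : R := gauss_m3 + 8.

(** The tilted sign step has mean [a * e] and variance [(1 - a ^+ 2) * e ^+ 2 = (b * h) ^+ 2], like
    the Gaussian step on the right. Expanding both about the common mean leaves only cubic
    errors. *)
Lemma tilt_heat M f (a b h e z : R) : 0 <= a -> a <= 1 -> 0 <= b -> a ^+ 2 + b ^+ 2 = 1 ->
  0 <= h -> `|e| = h -> taylor3 M f ->
  `|tilt a e f z - heat (b * h) f (z + a * e)| <= lindeberg_cst * M * h ^+ 3.
Proof.
move=> a0 a1 b0 ab h0 eh [bf [f1 [f2 [_ _ hT]]]].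
set c := z + a * e.
have M0 : 0 <= M by rewrite (le_trans _ (le_trans (hT 0 1) _))// normr1 (_ : 1 ^+ 3 = 1) ?mulr1// expr1n.
have b1 : b <= 1 by rewrite -(@ler_pXn2r _ 2)// ?nnegrE// expr1n; have := sqr_ge0 a; lra.
have h1 := heat_taylor c (mulr_ge0 b0 h0) bf hT.
have k1 : gauss_m3 * M * (b * h) ^+ 3 <= gauss_m3 * M * h ^+ 3.
  rewrite ler_wpM2l ?mulr_ge0 ?gauss_m3_ge0// lerXn2r ?nnegrE ?mulr_ge0//.
  by rewrite ler_piMl.
have hp := hT c ((1 - a) * e); have hm := hT c (- (1 + a) * e).
have zp : c + (1 - a) * e = z + e by rewrite /c; ring.
have zm : c + - (1 + a) * e = z - e by rewrite /c; ring.
rewrite zp in hp; rewrite zm in hm.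
have tri (u : R) : `|u| <= 2 -> M * `|u * e| ^+ 3 <= M * (8 * h ^+ 3).
  move=> u2; rewrite ler_wpM2l// normrM eh exprMn ler_wpM2r ?exprn_ge0//.
  by rewrite (_ : 8 = 2 ^+ 3) ?lerXn2r ?nnegrE//; ring.
have {}hp : `|f (z + e) - f c - (1 - a) * e * f1 c - ((1 - a) * e) ^+ 2 / 2 * f2 c| <= M * (8 * h ^+ 3).
  by apply: (le_trans hp); apply: tri; rewrite ler_norml; lra.
have {}hm : `|f (z - e) - f c - (- (1 + a) * e) * f1 c - (- (1 + a) * e) ^+ 2 / 2 * f2 c| <= M * (8 * h ^+ 3).
  by apply: (le_trans hm); apply: tri; rewrite ler_norml; lra.
have e2 : e ^+ 2 = h ^+ 2 by rewrite -eh real_normK ?num_real.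
have b2 : b ^+ 2 = 1 - a ^+ 2 by rewrite -ab addrAC subrr add0r.
have key : tilt a e f z - f c - (b * h) ^+ 2 / 2 * f2 c =
  (1 + a) / 2 * (f (z + e) - f c - (1 - a) * e * f1 c - ((1 - a) * e) ^+ 2 / 2 * f2 c) +
  (1 - a) / 2 * (f (z - e) - f c - (- (1 + a) * e) * f1 c - (- (1 + a) * e) ^+ 2 / 2 * f2 c).
  by rewrite /tilt [(b * h) ^+ 2]exprMn b2 -e2; field.
have k2 : `|tilt a e f z - f c - (b * h) ^+ 2 / 2 * f2 c| <= M * (8 * h ^+ 3).
  rewrite key; set A := f (z + e) - _ - _ - _ in hp *; set B := f (z - e) - _ - _ - _ in hm *.
  apply: (le_trans (ler_normD _ _)); rewrite !normrM.
  have -> : `|1 + a| = 1 + a by rewrite ger0_norm// addr_ge0.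
  have -> : `|1 - a| = 1 - a by rewrite ger0_norm// subr_ge0.
  have -> : `|2^-1| = 2^-1 :> R by rewrite gtr0_norm.
  set D := M * _ in hp hm *.
  by have := normr_ge0 A; have := normr_ge0 B; nra.
rewrite (_ : tilt a e f z - heat (b * h) f c =
  (tilt a e f z - f c - (b * h) ^+ 2 / 2 * f2 c) - (heat (b * h) f c - f c - (b * h) ^+ 2 / 2 * f2 c)).
  apply: (le_trans (ler_normB _ _)); rewrite /lindeberg_cst.
  by move: (le_trans h1 k1) k2; rewrite -!mulrA; lra.
by ring.
Qed.

Lemma avg_heat M f (h z : R) : 0 <= h -> taylor3 M f ->
  `|avg h f z - heat h f z| <= lindeberg_cst * M * h ^+ 3.
Proof.
move=> h0 Tf.
have ab : 0 ^+ 2 + 1 ^+ 2 = 1 :> R by ring.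
have := @tilt_heat M f 0 1 h h z (lexx _) ler01 ler01 ab h0 (ger0_norm h0) Tf.
rewrite mul1r mul0r addr0; congr (`|_ - _| <= _).
by rewrite /tilt /avg; field.
Qed.

(** Signs are exchanged for Gaussians one at a time; those already exchanged are absorbed in [heat],
    which keeps the constant [M]. With [h] of order [n ^ (-1/2)] the [n] cubic errors add up to
    [O(n ^ (-1/2))]. *)
Lemma walk_heat M f n (h z : R) : 0 < h -> taylor3 M f ->
  `|walk n h f z - heat (h * Num.sqrt n%:R) f z| <= n%:R * (lindeberg_cst * M * h ^+ 3).
Proof.
move=> h0 Tf; elim: n z => [|n IH] z.
  by rewrite sqrtr0 mulr0 heat0 subrr normr0 mul0r.
have bf : blip f by case: Tf.
set D := lindeberg_cst * _ * _ in IH *.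
set g := heat (h * Num.sqrt n%:R) f in IH.
have gE : heat (h * Num.sqrt n.+1%:R) f z = heat h g z.
  rewrite /g heat_comp ?mulr_ge0 ?sqrtr_ge0 ?(ltW h0)//; congr (heat _ f z).
  rewrite exprMn sqr_sqrtr ?ler0n// -[X in X + _]mulr1 -mulrDr -natr1 addrC.
  by rewrite sqrtrM ?sqr_ge0// sqrtr_sqr gtr0_norm// addrC natr1.
rewrite gE walkS.
have h1 := avg_heat z (ltW h0) (taylor3_heat (h * Num.sqrt n%:R) Tf).
rewrite -/g -/D in h1.
have h2 : `|(walk n h f (z + h) + walk n h f (z - h)) / 2 - avg h g z| <= n%:R * D.
  rewrite /avg -mulrBl opprD addrACA normrM (@gtr0_norm _ 2^-1)// ler_pdivrMr//.
  by rewrite (le_trans (ler_normD _ _))//; have := IH (z + h); have := IH (z - h); lra.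
apply: (le_trans (ler_distD (avg h g z) _ _)).
by rewrite -[in leRHS]natr1 [leRHS]mulrDl mul1r lerD.
Qed.


(** This growth is still integrable against [gamma] by [integrable_exp4], and it covers the Hermite
    polynomials and exponentials that appear as weights below. *)
Definition gauss_dominated (p : mR -> R) := measurable_fun setT p /\
  exists C : R, forall y, `|p y| <= C * expR (y ^+ 2 / 4).

Lemma gauss_dominated_int p : gauss_dominated p -> gamma.-integrable setT (EFin \o p).
Proof. by move=> [mp [C hC]]; exact: integrable_le_exp4 hC. Qed.

Lemma gauss_dominatedM (h : mR -> R) p : bmeas h -> gauss_dominated p ->
  gauss_dominated (fun y => h y * p y).
Proof.
move=> [mh [B hB]] [mp [C hC]]; split; first exact: measurable_funM.
exists (B * C) => y; rewrite normrM -mulrA ler_pM//.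
Qed.

Lemma gauss_dominatedD p q : gauss_dominated p -> gauss_dominated q ->
  gauss_dominated (fun y => p y + q y).
Proof.
move=> [mp [C hC]] [mq [D hD]]; split; first exact: measurable_funD.
by exists (C + D) => y; rewrite mulrDl (le_trans (ler_normD _ _))// lerD.
Qed.

Lemma gauss_dominatedZ k p : gauss_dominated p -> gauss_dominated (fun y => k * p y).
Proof. by apply: gauss_dominatedM; exact: bmeas_cst. Qed.

Lemma bmeas_gauss_dominated h : bmeas h -> gauss_dominated h.
Proof.
move=> [mh [B hB]]; split=> //; exists B => y; apply: (le_trans (hB y)).
have B0 : 0 <= B by exact: le_trans (hB y).
by rewrite ler_peMr// -expR0 ler_expR divr_ge0// sqr_ge0.
Qed.

Lemma gauss_dominatedX2 : gauss_dominated (fun y : mR => y ^+ 2).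
Proof.
split; first exact: measurable_funX.
exists 4 => y; rewrite ger0_norm ?sqr_ge0//.
by have := expR_ge1Dx (y ^+ 2 / 4); lra.
Qed.

Lemma gauss_dominated_id : gauss_dominated (fun y : mR => y).
Proof.
split => //; exists 4 => y; have := expR_ge1Dx (y ^+ 2 / 4).
rewrite -(real_normK (num_real y)); set e := expR _.
have h (t : R) : 1 + t ^+ 2 / 4 <= e -> t <= 4 * e.
  by have := sqr_ge0 (t - 1); nra.
exact: h.
Qed.

Lemma gauss_dominated_exp t : gauss_dominated (fun y : mR => expR (t * y - t ^+ 2 / 2)).
Proof.
split.
  by apply: measurableT_comp => //; apply: measurable_funB => //; exact: measurable_funM.
exists (expR (t ^+ 2 / 2)) => y; rewrite ger0_norm ?expR_ge0// -expRD ler_expR.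
have h (z : R) : t * z - t ^+ 2 / 2 <= t ^+ 2 / 2 + z ^+ 2 / 4.
  by have := sqr_ge0 (z / 2 - t); nra.
exact: h.
Qed.

Lemma gauss_dominated_bound h p (B : R) : bmeas h -> gauss_dominated p ->
  (forall y, `|h y| <= B) -> `|\int[gamma]_y (h y * p y)| <= B * \int[gamma]_y `|p y|.
Proof.
move=> bh dp hB; have dhp := gauss_dominatedM bh dp.
have ip : gamma.-integrable setT (EFin \o (fun y => `|p y|)).
  exact: integrable_norm (gauss_dominated_int dp).
apply: (le_trans (le_normr_Rintegral _ (gauss_dominated_int dhp))) => //.
rewrite -RintegralZl//; apply: le_Rintegral => //.
- exact: integrable_norm (gauss_dominated_int dhp).
- exact: integrableRZ.
- by move=> y _; rewrite normrM ler_wpM2r.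
Qed.

(** The Cameron-Martin formula in one variable: a translation of [h] becomes a smooth weight, which
    can be expanded in [t] although [h] cannot. *)
Lemma gauss_shift t h : bmeas h ->
  \int[gamma]_y h (t + 1 * y) = \int[gamma]_y (h y * expR (t * y - t ^+ 2 / 2)).
Proof.
move=> [mh [B hB]].
have main (g : mR -> \bar R) : measurable_fun setT g -> (forall x, 0 <= g x)%E ->
    (\int[gamma]_y g (t + 1 * y)%R = \int[gamma]_y (g y * (expR (t * y - t ^+ 2 / 2))%:E))%E.
  move=> mg g0; rewrite -[LHS](ge0_normal_prob_affine t ltr01 mg g0).
  have [me _] := gauss_dominated_exp t.
  have mge : measurable_fun setT (fun y : mR => g y * (expR (t * y - t ^+ 2 / 2))%:E)%E.
    by apply: emeasurable_funM => //; exact/measurable_EFinP.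
  have ge0 (y : mR) : (0 <= g y * (expR (t * y - t ^+ 2 / 2))%:E)%E.
    by rewrite mule_ge0// lee_fin expR_ge0.
  rewrite [RHS](ge0_integral_normal_prob _ _ mge ge0).
  rewrite [LHS](ge0_integral_normal_prob _ _ mg g0).
  apply: eq_integral => y _; rewrite -muleA -EFinM; congr (_ * _%:E)%E.
  by rewrite !normal_pdf_gt0E// [RHS]mulrCA -expRD; congr (_ * expR _); field.
have bh : bmeas h by split => //; exists B.
have bht : bmeas (fun y : mR => h (t + 1 * y)).
  by split; [exact: (measurableT_comp mh (measurable_affine _ _))|exists B].
have e1 : \int[gamma]_y (expR (t * y - t ^+ 2 / 2)) = 1.
  transitivity (\int[gamma]_y (cst 1 (t + 1 * y) : R)); last by rewrite /= mean_cst.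
  rewrite /Rintegral; congr fine.
  have /= -> := main (fun=> 1%E) (measurable_cst _) (fun=> lee01).
  by apply: eq_integral => y _; rewrite mul1e.
have := main (fun y => (h y + B)%:E).
have -> : (\int[gamma]_y ((h y + B)%:E * (expR (t * y - t ^+ 2 / 2))%:E))%E =
   (\int[gamma]_y (h y * expR (t * y - t ^+ 2 / 2)) + B)%:E.
  have i1 := gauss_dominated_int (gauss_dominatedM bh (gauss_dominated_exp t)).
  have i2 := gauss_dominated_int (gauss_dominatedZ B (gauss_dominated_exp t)).
  transitivity (\int[gamma]_y (h y * expR (t * y - t ^+ 2 / 2) + B * expR (t * y - t ^+ 2 / 2)))%:E.
    rewrite fineK; last by apply: integrable_fin_num => //; exact: integrableRD.
    by apply: eq_integral => y _; rewrite -EFinM mulrDl.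
  by rewrite RintegralD// RintegralZl ?e1 ?mulr1//; exact/gauss_dominated_int/gauss_dominated_exp.
have -> : (\int[gamma]_y (h (t + 1 * y) + B)%:E)%E = (\int[gamma]_y h (t + 1 * y) + B)%:E.
  have bB : bmeas (fun _ : mR => B) by exact: bmeas_cst.
  by rewrite -[in RHS](mean_cst gamma B) -(meanD gamma bht bB) EFin_mean//; exact: bmeasD.
move=> e; apply: (@addIr _ B); apply: EFin_inj; apply: e.
  by apply/measurable_EFinP; exact: measurable_funD.
by move=> y; rewrite lee_fin -lerBlDr sub0r; have := hB y; rewrite ler_norml => /andP[].
Qed.

Lemma blip_weighted s f p : blip f -> gauss_dominated p ->
  blip (fun x => \int[gamma]_y (f (x + s * y) * p y)).
Proof.
move=> bf dp; have [[B hB] [L hL]] := bf; split.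
  exists (B * \int[gamma]_y `|p y|) => x.
  by apply: gauss_dominated_bound => //; exact: blip_bmeas_affine.
exists (L * \int[gamma]_y `|p y|) => x x'.
have i z := gauss_dominated_int (gauss_dominatedM (blip_bmeas_affine z s bf) dp).
rewrite -RintegralB// mulrAC.
under eq_Rintegral do rewrite -mulrBl.
apply: (gauss_dominated_bound (h := fun y => f (x + s * y) - f (x' + s * y))) => //.
  by apply: bmeasB; exact: blip_bmeas_affine.
by move=> y; apply: (le_trans (hL _ _)); rewrite opprD addrACA subrr addr0.
Qed.

(** After [gauss_shift] the Taylor coefficients of [heat s f] are the averages of [f] against the
    Hermite polynomials [y] and [y ^+ 2 - 1], rescaled by powers of [s]. *)
Lemma heat_taylor3 (s : R) f : 0 < s -> blip f -> exists M, taylor3 M (heat s f).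
Proof.
move=> s0 bf; have [[B hB] _] := bf.
have B0 : 0 <= B by exact: le_trans (hB 0).
pose he2 (y : mR) : R := y ^+ 2 - 1.
have d1 := gauss_dominated_id.
have d2 : gauss_dominated he2.
  by apply: gauss_dominatedD; [exact: gauss_dominatedX2|exact/bmeas_gauss_dominated/bmeas_cst].
pose w (y : mR) : R := expR (2 * (`|y| + 1)).
have dw : gauss_dominated w.
  split.
    apply: measurableT_comp => //; apply: measurable_funM => //.
    by apply: measurable_funD => //; exact: normr_measurable.
  by exists (expR 6) => y; rewrite ger0_norm ?expR_ge0//; exact: expR_le_exp4.
pose K := 7 * \int[gamma]_y w y + 2 + \int[gamma]_y `|y| + \int[gamma]_y `|he2 y|.
pose F1 (x : R) : R := \int[gamma]_y (f (x + s * y) * y).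
pose F2 (x : R) : R := \int[gamma]_y (f (x + s * y) * he2 y).
have Iw : 0 <= \int[gamma]_y w y by apply: Rintegral_ge0 => y _; exact: expR_ge0.
have I1 : 0 <= \int[gamma]_y `|y| by exact: Rintegral_ge0.
have I2 : 0 <= \int[gamma]_y `|he2 y| by exact: Rintegral_ge0.
exists (s^-1 ^+ 3 * (B * K)); split; first exact: blip_heat.
exists (fun x => s^-1 * F1 x), (fun x => s^-1 ^+ 2 * F2 x); split.
- by apply: blipZ; exact: blip_weighted.
- by apply: blipZ; exact: blip_weighted.
move=> x t; pose u := t / s.
have tE : t = u * s by rewrite /u divfK// gt_eqF.
have -> : s^-1 ^+ 3 * (B * K) * `|t| ^+ 3 = B * K * `|u| ^+ 3.
  by rewrite {1}tE normrM (gtr0_norm s0); field; rewrite gt_eqF.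
have -> : t * (s^-1 * F1 x) = u * F1 x by rewrite /u; ring.
have -> : t ^+ 2 / 2 * (s^-1 ^+ 2 * F2 x) = u ^+ 2 / 2 * F2 x by rewrite /u; field; rewrite gt_eqF.
have bx := blip_bmeas_affine x s bf.
have [u1|u1] := leP `|u| 1; last first.
  have u13 : 1 <= `|u| ^+ 3 by rewrite exprn_ege1// ltW.
  have uu3 : `|u| <= `|u| ^+ 3 by rewrite -[leLHS]expr1 ler_weXn2l// ltW.
  have u23 : `|u| ^+ 2 <= `|u| ^+ 3 by rewrite ler_weXn2l// ltW.
  have h1 : `|heat s f (x + t)| <= B.
    by rewrite -[X in `|X|]subr0; apply: ler_norm_mean => [|y]; [exact: blip_bmeas_affine|rewrite subr0].
  have h2 : `|heat s f x| <= B.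
    by rewrite -[X in `|X|]subr0; apply: ler_norm_mean => [|y]; [exact: blip_bmeas_affine|rewrite subr0].
  have h3 : `|F1 x| <= B * \int[gamma]_y `|y| by exact: gauss_dominated_bound.
  have h4 : `|F2 x| <= B * \int[gamma]_y `|he2 y| by exact: gauss_dominated_bound.
  apply: (@le_trans _ _ (B + B + `|u| * (B * \int[gamma]_y `|y|) + `|u| ^+ 2 * (B * \int[gamma]_y `|he2 y|))).
    apply: (le_trans (ler_normB _ _)); apply: lerD; last first.
      rewrite normrM ler_pM// normrM (@gtr0_norm _ 2^-1)// normrX.
      by rewrite ler_piMr ?exprn_ge0// invf_le1 ?ler1n.
    apply: (le_trans (ler_normB _ _)); apply: lerD; last by rewrite normrM ler_wpM2l.
    by rewrite (le_trans (ler_normB _ _))// lerD.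
  rewrite /K; set c := `|u| ^+ 3 in u13 uu3 u23 *.
  have c1 : `|u| * (B * \int[gamma]_y `|y|) <= c * (B * \int[gamma]_y `|y|) by rewrite ler_wpM2r ?mulr_ge0.
  have c2 : `|u| ^+ 2 * (B * \int[gamma]_y `|he2 y|) <= c * (B * \int[gamma]_y `|he2 y|) by rewrite ler_wpM2r ?mulr_ge0.
  have c3 : B <= c * B by rewrite ler_peMl.
  have c4 : 0 <= c * (B * \int[gamma]_y w y) by rewrite !mulr_ge0// (le_trans ler01).
  rewrite [leRHS](_ : _ = c * B + c * B + c * (B * \int[gamma]_y `|y|) +
    c * (B * \int[gamma]_y `|he2 y|) + 7 * (c * (B * \int[gamma]_y w y))); last by ring.
  rewrite -[leLHS]addr0; apply: lerD; last by rewrite mulr_ge0.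
  by apply: lerD => //; apply: lerD => //; exact: lerD.
have -> : heat s f (x + t) = \int[gamma]_y (f (x + s * y) * expR (u * y - u ^+ 2 / 2)).
  rewrite -(gauss_shift u bx); apply: eq_Rintegral => y _.
  by rewrite tE; congr f; ring.
have ie := gauss_dominated_int (gauss_dominatedM bx (gauss_dominated_exp u)).
have ib := gauss_dominated_int (bmeas_gauss_dominated bx).
have i1 := gauss_dominated_int (gauss_dominatedM bx d1).
have i2 := gauss_dominated_int (gauss_dominatedM bx d2).
pose r (y : mR) := expR (u * y - u ^+ 2 / 2) + (- 1) + (- u) * y + (- (u ^+ 2 / 2)) * he2 y.
have dr : gauss_dominated r.
  apply: gauss_dominatedD; last exact: gauss_dominatedZ.
  apply: gauss_dominatedD; last exact: gauss_dominatedZ.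
  by apply: gauss_dominatedD; [exact: gauss_dominated_exp|exact/bmeas_gauss_dominated/bmeas_cst].
have -> : \int[gamma]_y (f (x + s * y) * expR (u * y - u ^+ 2 / 2)) - heat s f x - u * F1 x - u ^+ 2 / 2 * F2 x =
   \int[gamma]_y (f (x + s * y) * r y).
  transitivity (\int[gamma]_y (f (x + s * y) * expR (u * y - u ^+ 2 / 2) + (-1) * f (x + s * y) +
      (- u) * (f (x + s * y) * y) + (- (u ^+ 2 / 2)) * (f (x + s * y) * he2 y))); last first.
    by apply: eq_Rintegral => y _; rewrite /r; ring.
  have j1 := integrableRD ie (integrableRZ (-1) ib).
  have j2 := integrableRD j1 (integrableRZ (- u) i1).
  have j3 := integrableRZ (- (u ^+ 2 / 2)) i2.
  rewrite (RintegralD _ j2 j3)// (RintegralD _ j1 (integrableRZ (- u) i1))//.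
  rewrite (RintegralD _ ie (integrableRZ (-1) ib))//.
  by rewrite (RintegralZl _ _ ib)// (RintegralZl _ _ i1)// (RintegralZl _ _ i2)// /heat /F1 /F2; ring.
apply: (le_trans (gauss_dominated_bound bx dr (fun y => hB _))).
rewrite -mulrA ler_wpM2l//.
apply: (@le_trans _ _ (\int[gamma]_y (7 * `|u| ^+ 3 * w y))).
  apply: le_Rintegral => //.
  - exact: integrable_norm (gauss_dominated_int dr).
  - exact: integrableRZ (gauss_dominated_int dw).
  - move=> y _; have := hermite_taylor y u1; congr (`|_| <= _).
    by rewrite /r /he2; ring.
rewrite RintegralZl//; last exact: gauss_dominated_int.
have := exprn_ge0 3 (normr_ge0 u); rewrite /K; set c := `|u| ^+ 3 => c0.
rewrite -mulrA mulrCA -subr_ge0.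
have -> : (7 * \int[gamma]_y w y + 2 + \int[gamma]_y `|y| + \int[gamma]_y `|he2 y|) * c -
  c * (7 * \int[gamma]_y w y) = (2 + \int[gamma]_y `|y| + \int[gamma]_y `|he2 y|) * c by ring.
by rewrite mulr_ge0// !addr_ge0.
Qed.

(** Averaging over displacements [s * y] moves a Lipschitz function by at most [L * s] times the
    mean of [|y|], which dictates [s]. *)
Lemma blip_approx f (d : R) : blip f -> 0 < d ->
  exists M g, taylor3 M g /\ forall x, `|f x - g x| <= d.
Proof.
move=> bf d0; have [_ [L hL]] := bf.
pose m1 := \int[gamma]_y `|y|.
have m10 : 0 <= m1 by exact: Rintegral_ge0.
have k0 : 0 < (`|L| + 1) * (m1 + 1) by rewrite mulr_gt0// ltr_wpDl.
pose s := d / ((`|L| + 1) * (m1 + 1)).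
have s0 : 0 < s by rewrite divr_gt0.
have [M TM] := heat_taylor3 s0 bf.
exists M, (heat s f); split => // x.
have bx := blip_bmeas_affine x s bf.
have bd : bmeas (fun y : mR => f (x + s * y) - f x) by apply: bmeasB => //; exact: bmeas_cst.
have bc : bmeas (fun _ : mR => f x) by exact: bmeas_cst.
rewrite distrC -[X in _ - X](mean_cst gamma) -(meanB gamma bx bc).
apply: (le_trans (le_normr_Rintegral _ (bmeas_integrable _ bd))) => //.
have i1 := gauss_integrableX (isT : 1 <= 4)%N.
apply: (@le_trans _ _ (\int[gamma]_y (`|L| * s * `|y| ^+ 1))).
  apply: le_Rintegral => //; first exact: integrable_norm (bmeas_integrable _ bd).
    exact: integrableRZ.
  move=> y _; apply: (le_trans (hL _ _)).
  rewrite addrAC subrr add0r normrM (gtr0_norm s0) mulrA expr1.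
  by rewrite ler_wpM2r// ler_wpM2r ?(ltW s0)// ler_norm.
rewrite RintegralZl// -/m1 /s mulrAC mulrCA ger_pMr//.
rewrite -[leLHS]/(`|L| * m1 / _) ler_pdivrMr// mul1r.
by apply: ler_pM => //; rewrite lerDl.
Qed.

Let sqrtS n : R := Num.sqrt n.+1%:R.
Let sqrtS_gt0 n : 0 < sqrtS n. Proof. by rewrite sqrtr_gt0 ltr0n. Qed.

Lemma cvg_sqrtSV : (fun n => (Num.sqrt n.+1%:R)^-1) @ \oo --> (0 : R).
Proof.
apply/cvgrPdist_le => e e0; near=> n.
rewrite sub0r normrN gtr0_norm ?invr_gt0 ?sqrtS_gt0//.
rewrite -[leRHS]invrK lef_pV2 ?posrE ?invr_gt0 ?sqrtS_gt0//.
rewrite -[leLHS]gtr0_norm ?invr_gt0// -sqrtr_sqr ler_sqrt ?ler0n//.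
apply: (@le_trans _ _ n%:R); last by rewrite ler_nat.
near: n; exact: nbhs_infty_ger.
Unshelve. all: end_near. Qed.

Lemma walk_cvg f (s z : R) : blip f -> 0 < s ->
  (fun n => walk n.+1 (s / Num.sqrt n.+1%:R) f z) @ \oo --> heat s f z.
Proof.
move=> bf s0; apply/cvgrPdist_le => e e0.
have e3 : 0 < e / 3 by rewrite divr_gt0.
have [M [g [Tg fg]]] := blip_approx bf e3.
have bg : blip g by case: Tg.
near=> n; rewrite distrC.
set h := s / Num.sqrt n.+1%:R.
have h0 : 0 < h by rewrite divr_gt0// sqrtS_gt0.
have hs : h * Num.sqrt n.+1%:R = s by rewrite /h divfK// gt_eqF// sqrtS_gt0.
have k1 : `|walk n.+1 h f z - walk n.+1 h g z| <= e / 3.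
  rewrite ler_norml -[X in X <= _ <= _](walk_cst n.+1 h (- (e / 3)) z) -[X in _ <= _ <= X](walk_cst n.+1 h (e / 3) z).
  have -> : walk n.+1 h f z - walk n.+1 h g z = walk n.+1 h (fun x => 1 * f x + (-1) * g x) z.
    by rewrite walk_lin mul1r mulN1r.
  by apply/andP; split; apply: le_walk => x; have := fg x; rewrite mul1r mulN1r ler_norml => /andP[].
have k2 : `|walk n.+1 h g z - heat s g z| <= e / 3.
  have := walk_heat n.+1 z h0 Tg; rewrite hs; move/le_trans; apply.
  have -> : n.+1%:R * (lindeberg_cst * M * h ^+ 3) = (lindeberg_cst * M * s ^+ 3) * (Num.sqrt n.+1%:R)^-1.
    rewrite -[X in X * _](@sqr_sqrtr _ n.+1%:R) ?ler0n// /h.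
    by field; rewrite gt_eqF// sqrtS_gt0.
  apply: (le_trans (ler_norm _)); rewrite -[X in `|X|]subr0.
  near: n; apply: cvgr_distC_le => //.
  rewrite -[X in _ --> X](mulr0 (lindeberg_cst * M * s ^+ 3)).
  by apply: cvgM; [exact: cvg_cst|exact: cvg_sqrtSV].
have k3 : `|heat s g z - heat s f z| <= e / 3.
  by apply: heat_dist => // x; rewrite distrC.
apply: (le_trans (ler_distD (walk n.+1 h g z) _ _)).
apply: (@le_trans _ _ (e / 3 + (e / 3 + e / 3))); last by lra.
by rewrite lerD// (le_trans (ler_distD (heat s g z) _ _))// lerD.
Unshelve. all: end_near. Qed.

(** Only the conditional noise is replaced by Gaussians, of deviation [b * h]; the conditioning
    signs survive as a walk with steps [a * h]. Each replacement changes the function inside the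
    exponential by at most [D], hence the multiplicative loss. *)
Lemma cond_exp_ge M f n (a b h z : R) : 0 < a -> a <= 1 -> 0 < b -> a ^+ 2 + b ^+ 2 = 1 ->
  0 < h -> taylor3 M f ->
  expR (- (a ^- 2 * (n%:R * (lindeberg_cst * M * h ^+ 3)))) *
    walk n (a * h) (fun x => expR (a ^- 2 * heat (b * h * Num.sqrt n%:R) f x)) z
  <= cond_exp a h n f z.
Proof.
move=> a0 a1 b0 ab h0; set D := lindeberg_cst * _ * _; set lam := a ^- 2.
have lam0 : 0 <= lam by rewrite invr_ge0 sqr_ge0.
elim: n f z => [|n IH] f z Tf.
  rewrite mul0r mulr0 oppr0 expR0 mul1r sqrtr0 mulr0/= heat0 //.
have bf : blip f by case: Tf.
have bh0 : 0 < b * h by rewrite mulr_gt0.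
have gE : heat (b * h * Num.sqrt n.+1%:R) f = heat (b * h * Num.sqrt n%:R) (heat (b * h) f).
  apply/funext => x; case: n {IH} => [|n].
    by rewrite sqrtr1 mulr1 sqrtr0 mulr0 heat0.
  rewrite heat_comp ?mulr_gt0 ?sqrtr_gt0 ?ltr0n ?(ltW bh0)//; congr (heat _ f x).
  rewrite exprMn sqr_sqrtr ?ler0n// -[X in _ + X]mulr1 -mulrDr.
  by rewrite sqrtrM ?sqr_ge0// sqrtr_sqr gtr0_norm// natr1.
rewrite gE /= -[avg _ _ _]/((_ + _) / 2).
set g := heat (b * h) f; set psi := fun x => expR _.
have step e : `|e| = h -> expR (- (lam * (n.+1%:R * D))) * walk n (a * h) psi (z + a * e)
   <= cond_exp a h n (tilt a e f) z.
  move=> eh.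
  apply: (@le_trans _ _ (cond_exp a h n (fun x => g (x + a * e) + (- D)) z)); last first.
    apply: le_cond_exp => // x; rewrite lerBlDr -lerBlDl.
    have := tilt_heat x (ltW a0) a1 (ltW b0) ab (ltW h0) eh Tf.
    by rewrite -/g -/D distrC => /(le_trans (ler_norm _)).
  rewrite cond_expD cond_exp_shift.
  apply: (@le_trans _ _ (expR (a ^- 2 * - D) *
     (expR (- (lam * (n%:R * D))) * walk n (a * h) psi (z + a * e)))); last first.
    by rewrite ler_wpM2l ?expR_ge0// IH//; exact: taylor3_heat.
  rewrite mulrA -expRD -/lam -[in leLHS]natr1 ler_wpM2r ?walk_ge0//.
    by move=> x; exact: expR_ge0.
  by rewrite ler_expR; lra.
rewrite mulrA mulrDr ler_pM2r ?invr_gt0// lerD//; first exact: step (gtr0_norm h0).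
by have := step (- h); rewrite mulrN; apply; rewrite normrN gtr0_norm.
Qed.

Section hyper1.
Variables (a b : R).
Hypotheses (a0 : 0 < a) (b0 : 0 < b) (ab : a ^+ 2 + b ^+ 2 = 1).

Let a1 : a <= 1.
Proof.
by rewrite -(@ler_pXn2r _ 2)// ?nnegrE ?(ltW a0)// expr1n -ab lerDl sqr_ge0.
Qed.

Let hyper_taylor3 M f : taylor3 M f ->
  heat a (fun x => expR (a ^- 2 * heat b f x)) 0 <= expR (a ^- 2 * ln (heat 1 (expR \o f) 0)).
Proof.
move=> Tf; have bf : blip f by case: Tf.
have bpsi : blip (fun x => expR (a ^- 2 * heat b f x)).
  by apply: (@blip_expR _ (fun x => a ^- 2 * heat b f x)); apply: blipZ; exact: blip_heat.
pose h n : R := 1 / Num.sqrt n.+1%:R.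
have h0 n : 0 < h n by rewrite divr_gt0// sqrtS_gt0.
have hs n : h n * Num.sqrt n.+1%:R = 1 by rewrite /h divfK// gt_eqF// sqrtS_gt0.
pose err n := - (a ^- 2 * (n.+1%:R * (lindeberg_cst * M * h n ^+ 3))).
have errE n : err n = (- (a ^- 2 * lindeberg_cst * M)) * (Num.sqrt n.+1%:R)^-1.
  rewrite /err -[X in X * (_ * h n ^+ 3)](@sqr_sqrtr _ n.+1%:R) ?ler0n// /h.
  by field; rewrite !gt_eqF// sqrtS_gt0.
have e0 : (fun n => expR (err n)) @ \oo --> (1 : R).
  rewrite -[X in _ --> X](@expR0 R).
  apply: continuous_cvg; first exact: continuous_expR.
  rewrite (_ : err = fun n => (- (a ^- 2 * lindeberg_cst * M)) * (Num.sqrt n.+1%:R)^-1); last exact/funext.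
  rewrite -[X in _ --> X](mulr0 (- (a ^- 2 * lindeberg_cst * M))).
  by apply: cvgM; [exact: cvg_cst|exact: cvg_sqrtSV].
have L := cvgM e0 (@walk_cvg _ a 0 bpsi a0).
rewrite mul1r in L.
have bef : blip (expR \o f) by exact: blip_expR.
have X0 : 0 < heat 1 (expR \o f) 0.
  exact: (mean_expR_gt0 _ (blip_bmeas_affine 0 1 bf)).
have R1 : (fun n => expR (a ^- 2 * ln (walk n.+1 (1 / Num.sqrt n.+1%:R) (expR \o f) 0))) @ \oo -->
   expR (a ^- 2 * ln (heat 1 (expR \o f) 0)).
  apply: continuous_cvg; first exact: continuous_expR.
  apply: cvgM; first exact: cvg_cst.
  apply: continuous_cvg; first exact: continuous_ln.
  exact: walk_cvg.
(* At [h n = (n + 1) ^ (-1/2)] the quantity [cond_exp] is squeezed between two sequences whose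
   limits are the two sides of the claim. *)
apply: (ler_cvg_to (L _) R1); near=> n => /=.
apply: le_trans (cond_exp_le (h n) a0 a1 n.+1 f 0).
have := cond_exp_ge n.+1 0 a0 a1 b0 ab (h0 n) Tf.
have -> : b * h n * Num.sqrt n.+1%:R = b by rewrite -mulrA hs mulr1.
by have -> : a * h n = a / Num.sqrt n.+1%:R by rewrite /h mul1r.
Unshelve. all: end_near. Qed.

Lemma gauss_hyper1 f : blip f ->
  \int[gamma]_x expR (a ^- 2 * \int[gamma]_y f (a * x + b * y)) <=
  expR (a ^- 2 * ln (\int[gamma]_x expR (f x))).
Proof.
move=> bf.
suff : heat a (fun x => expR (a ^- 2 * heat b f x)) 0 <= expR (a ^- 2 * ln (heat 1 (expR \o f) 0)).
  have -> : heat a (fun x => expR (a ^- 2 * heat b f x)) 0 =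
     \int[gamma]_x expR (a ^- 2 * \int[gamma]_y f (a * x + b * y)).
    by apply: eq_Rintegral => x _; rewrite add0r.
  have -> : heat 1 (expR \o f) 0 = \int[gamma]_x expR (f x); last by [].
  by apply: eq_Rintegral => x _; rewrite add0r mul1r.
set lam := a ^- 2.
have lam0 : 0 <= lam by rewrite invr_ge0 sqr_ge0.
have X0 g : blip g -> 0 < heat 1 (expR \o g) 0.
  by move=> bg; exact: (mean_expR_gt0 _ (blip_bmeas_affine 0 1 bg)).
have bpsi g : blip g -> blip (fun x => expR (lam * heat b g x)).
  by move=> bg; apply: (@blip_expR _ (fun x => lam * heat b g x)); apply: blipZ; exact: blip_heat.
set LHS := heat a _ 0; set RHS := expR _.
have LHS0 : 0 <= LHS by apply: Rintegral_ge0 => x _; exact: expR_ge0.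
(* Passing from [f] to a Taylor-regular [g] within distance [d], and back, costs a factor
   [expR (lam * d)] each time. *)
suff main d : 0 < d -> LHS <= expR (2 * lam * d) * RHS.
  have cv : (fun n => expR (2 * lam * (Num.sqrt n.+1%:R)^-1) * RHS) @ \oo --> RHS.
    rewrite -[X in _ --> X](mul1r RHS).
    apply: cvgM; last exact: cvg_cst.
    rewrite -[X in _ --> X](@expR0 R).
    apply: continuous_cvg; first exact: continuous_expR.
    rewrite -[X in _ --> X](mulr0 (2 * lam)).
    by apply: cvgM; [exact: cvg_cst|exact: cvg_sqrtSV].
  apply: (ler_cvg_to (cvg_cst LHS) cv); near=> n => /=.
  by apply: main; rewrite invr_gt0 sqrtS_gt0.
move=> d0; have [M [g [Tg fg]]] := blip_approx bf d0.
have bg : blip g by case: Tg.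
have h1 : LHS <= expR (lam * d) * heat a (fun x => expR (lam * heat b g x)) 0.
  rewrite /LHS /heat -meanZ; last exact: (blip_bmeas_affine 0 a (bpsi g bg)).
  apply: le_mean.
  - exact: (blip_bmeas_affine 0 a (bpsi f bf)).
  - by apply: bmeasM; [exact: bmeas_cst|exact: (blip_bmeas_affine 0 a (bpsi g bg))].
  - move=> x; rewrite -expRD ler_expR -mulrDr ler_wpM2l//.
    have := heat_dist b (0 + a * x) bf bg fg; rewrite ler_norml => /andP[_].
    by rewrite /heat lerBlDr.
apply: (le_trans h1); rewrite (_ : 2 * lam * d = lam * d + lam * d); last by ring.
rewrite expRD -mulrA ler_wpM2l ?expR_ge0//.
apply: (le_trans (hyper_taylor3 Tg)).
rewrite /RHS -expRD ler_expR -/lam -mulrDr ler_wpM2l//.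
rewrite -[X in X + _]expRK -lnM ?posrE ?expR_gt0 ?X0// ler_ln ?posrE ?mulr_gt0 ?expR_gt0 ?X0//.
rewrite /heat -meanZ; last exact: (blip_bmeas_affine 0 1 (blip_expR bf)).
apply: le_mean.
- exact: (blip_bmeas_affine 0 1 (blip_expR bg)).
- by apply: bmeasM; [exact: bmeas_cst|exact: (blip_bmeas_affine 0 1 (blip_expR bf))].
- move=> x /=; rewrite -expRD ler_expR -lerBlDr.
  by have := fg (0 + 1 * x); rewrite distrC => /(le_trans (ler_norm _)).
Unshelve. all: end_near. Qed.

End hyper1.

End lindeberg.

(** * Gaussian vectors *)

Section tuple_functions.
Context {R : realType}.
Local Notation mR := (measurableTypeR R).

Definition tcont n (phi : n.-tuple R -> R) := forall t (e : R), 0 < e ->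
  exists2 d : R, 0 < d & forall t', (forall i, `|tnth t i - tnth t' i| < d) ->
    `|phi t - phi t'| < e.

Definition tround n (k : nat) (t : n.-tuple R) : n.-tuple int :=
  [tuple Num.floor (tnth t i * k.+1%:R) | i < n].

Definition tunround n (k : nat) (z : n.-tuple int) : n.-tuple R :=
  [tuple (tnth z i)%:~R / k.+1%:R | i < n].

Lemma measurable_tround_fiber n k (z : n.-tuple int) :
  measurable [set t : n.-tuple mR | tround k t = z].
Proof.
rewrite (_ : [set _ | _] = \bigcap_(i in [set: 'I_n])
    ((@tnth n mR) ^~ i @^-1` `[(tnth z i)%:~R / k.+1%:R, (tnth z i + 1)%:~R / k.+1%:R[%classic)).
  apply: fin_bigcap_measurable => // i _.
  by rewrite -[X in measurable X]setTI; apply: measurable_tnth.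
have k0 : 0 < k.+1%:R :> R by rewrite ltr0n.
apply/seteqP; split => t /=.
  move=> <- i _ /=; rewrite in_itv/= tnth_mktuple ler_pdivrMr// ltr_pdivlMr//.
  by rewrite floor_le floorD1_gt.
move=> h; apply: eq_from_tnth => i; rewrite tnth_mktuple.
have := h i Logic.I; rewrite /= in_itv/= ler_pdivrMr// ltr_pdivlMr// => /andP[h1 h2].
by apply: floor_def; rewrite h1 h2.
Qed.

(** [phi] is the pointwise limit of its values at points rounded to a grid of mesh [1 / (k + 1)];
    these approximations are constant on countably many measurable boxes. *)
Lemma tcont_measurable n (phi : n.-tuple R -> R) : tcont phi ->
  measurable_fun setT (phi : n.-tuple mR -> R).
Proof.
move=> cphi.
apply: (@measurable_fun_cvg _ _ _ _ (fun k t => phi (tunround k (tround k t)))).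
  move=> k _ B mB; rewrite setTI.
  rewrite (_ : _ @^-1` B = \bigcup_(z : n.-tuple int)
     ([set t : n.-tuple mR | tround k t = z] `&` [set t | phi (tunround k z) \in B])).
    apply: countable_bigcupT_measurable => [|z]; first exact: countableP.
    apply: measurableI; first exact: measurable_tround_fiber.
    have [Bz|Bz] := boolP (phi (tunround k z) \in B).
      by rewrite (_ : [set _ | _] = setT)//; apply/seteqP; split.
    by rewrite (_ : [set _ | _] = set0)//; apply/seteqP; split => // t /=.
  apply/seteqP; split => t /=.
    by move=> Bt; exists (tround k t) => //; split => //=; rewrite inE.
  by move=> [z _ [/= <-]]; rewrite inE.
move=> t _; apply/cvgrPdist_lt => e e0.
have [d d0 hd] := cphi t e e0.
near=> k; apply: hd => i.
rewrite !tnth_mktuple.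
have k0 : 0 < k.+1%:R :> R by rewrite ltr0n.
have /andP[f1 f2] := floor_itv (tnth t i * k.+1%:R).
have -> : tnth t i - (Num.floor (tnth t i * k.+1%:R))%:~R / k.+1%:R =
  (tnth t i * k.+1%:R - (Num.floor (tnth t i * k.+1%:R))%:~R) / k.+1%:R.
  by rewrite mulrBl mulfK// gt_eqF.
rewrite ger0_norm; last by rewrite divr_ge0 ?(ltW k0)// subr_ge0.
apply: (@lt_trans _ _ (1 / k.+1%:R)).
  by rewrite ltr_pM2r ?invr_gt0// ltrBlDl -(intrD _ _ 1).
rewrite ltr_pdivrMr// -ltr_pdivrMl// mulr1.
apply: (@le_lt_trans _ _ k%:R); last by rewrite ltr_nat.
near: k; exact: nbhs_infty_ger.
Unshelve. all: end_near. Qed.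

Definition comb n (a b : R) (x y : n.-tuple R) : n.-tuple R :=
  [tuple a * tnth x i + b * tnth y i | i < n].

Lemma measurable_comb n a b (x : n.-tuple R) :
  measurable_fun setT (comb a b x : n.-tuple mR -> n.-tuple mR).
Proof.
apply/measurable_fun_tnthP => i.
rewrite (_ : _ \o _ = fun y : n.-tuple mR => a * tnth x i + b * tnth y i); last first.
  by apply/funext => y /=; rewrite tnth_mktuple.
by apply: measurable_funD => //; apply: measurable_funM => //; exact: measurable_tnth.
Qed.

Definition tdist n (x y : n.-tuple R) : R := \sum_(i < n) `|tnth x i - tnth y i|.

Lemma tdist_ge0 n (x y : n.-tuple R) : 0 <= tdist x y.
Proof. exact: sumr_ge0. Qed.

Lemma tdist_comb n a b (x x' y y' : n.-tuple R) :
  tdist (comb a b x y) (comb a b x' y') <= `|a| * tdist x x' + `|b| * tdist y y'.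
Proof.
rewrite /tdist !mulr_sumr -big_split/=; apply: ler_sum => i _.
rewrite !tnth_mktuple opprD addrACA -!mulrBr (le_trans (ler_normD _ _))//.
by rewrite !normrM.
Qed.

(** The constants are kept explicit because averaging a family, as in [tlip_mean], requires
    constants common to all its members. *)
Definition tlip n B L (phi : n.-tuple R -> R) := (forall t, `|phi t| <= B) /\
  forall t t', `|phi t - phi t'| <= L * tdist t t'.

Definition tblip n (phi : n.-tuple R -> R) := exists B L : R, 0 <= L /\ tlip B L phi.

Lemma tblip_tcont n (phi : n.-tuple R -> R) : tblip phi -> tcont phi.
Proof.
move=> [B [L [L0 [_ hL]]]] t e e0.
have k0 : 0 < L * n%:R + 1 by rewrite ltr_wpDl// mulr_ge0// ler0n.
exists (e / (L * n%:R + 1)); first by rewrite divr_gt0.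
move=> t' h; apply: (le_lt_trans (hL t t')).
apply: (@le_lt_trans _ _ (L * (\sum_(i < n) e / (L * n%:R + 1)))).
  by rewrite ler_wpM2l//; apply: ler_sum => i _; exact/ltW/h.
rewrite sumr_const card_ord -[_ *+ n]mulr_natr.
have -> : L * (e / (L * n%:R + 1) * n%:R) = e * (L * n%:R / (L * n%:R + 1)) by ring.
by rewrite gtr_pMr// ltr_pdivrMr// mul1r ltrDl.
Qed.

Lemma tblip_bmeas n (phi : n.-tuple R -> R) : tblip phi -> bmeas (phi : n.-tuple mR -> R).
Proof.
move=> tphi; split; first by apply: tcont_measurable; exact: tblip_tcont.
by have [B [L [_ [hB _]]]] := tphi; exists B.
Qed.

Lemma measurable_bmeas d1 (T1 : measurableType d1) d2 (T2 : measurableType d2)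
    (f : T2 -> R) (g : T1 -> T2) :
  measurable_fun setT g -> bmeas f -> bmeas (f \o g).
Proof.
move=> mg [mf [B hB]]; split; first exact: measurableT_comp.
by exists B => x; exact: hB.
Qed.

Lemma tblip_expR n (phi : n.-tuple R -> R) (k : R) : tblip phi ->
  tblip (fun x => expR (k * phi x)).
Proof.
move=> [B [L [L0 [hB hL]]]].
exists (expR (`|k| * B)), (expR (`|k| * B) * (`|k| * L)); split; first by rewrite !mulr_ge0 ?expR_ge0.
have eB x : expR (k * phi x) <= expR (`|k| * B).
  by rewrite ler_expR (le_trans (ler_norm _))// normrM ler_wpM2l.
split=> [x|]; first by rewrite ger0_norm ?expR_ge0.
have h x y : expR (k * phi x) - expR (k * phi y) <= expR (`|k| * B) * (`|k| * L) * tdist x y.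
  have := expR_tangent (k * phi x) (k * phi y).
  have : expR (k * phi x) * (k * phi x - k * phi y) <= expR (`|k| * B) * (`|k| * L) * tdist x y.
    rewrite -mulrA; apply: (@le_trans _ _ (expR (k * phi x) * (`|k| * L * tdist x y))).
      rewrite ler_wpM2l ?expR_ge0// (le_trans (ler_norm _))// -mulrBr normrM -mulrA.
      by rewrite ler_wpM2l.
    by rewrite ler_wpM2r// mulr_ge0 ?tdist_ge0// mulr_ge0.
  lra.
move=> x y; rewrite ler_norml h andbT lerNl opprB.
by apply: (le_trans (h y x)); rewrite /tdist; under eq_bigr do rewrite distrC.
Qed.

Lemma tlip_mean d (T : measurableType d) (P : probability T R) n B L
    (F : n.-tuple R -> T -> R) :
  (forall x, measurable_fun setT (F x)) -> (forall y, tlip B L (F ^~ y)) ->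
  tlip B L (fun x => \int[P]_y F x y).
Proof.
move=> mF hF.
have bF x : bmeas (F x) by split => //; exists B => y; have [+ _] := hF y; exact.
split=> [x|x x'].
  rewrite -[X in `|X|]subr0; apply: ler_norm_mean => // y.
  by rewrite subr0; have [+ _] := hF y; exact.
rewrite -meanB// -[X in `|X|]subr0; apply: ler_norm_mean; first exact: bmeasB.
by move=> y; rewrite subr0; have [_ +] := hF y; exact.
Qed.

(** In the tensorization this shows that the logarithm of a partial exponential mean is again
    bounded Lipschitz, so that the induction hypothesis applies to it. *)
Lemma ln_mean_expR_dist d (T : measurableType d) (P : probability T R) (f g : T -> R) (c : R) :
  bmeas f -> bmeas g -> (forall x, `|f x - g x| <= c) ->
  `|ln (\int[P]_x expR (f x)) - ln (\int[P]_x expR (g x))| <= c.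
Proof.
move=> bf bg h.
have key (u v : T -> R) : bmeas u -> bmeas v -> (forall x, u x - v x <= c) ->
    ln (\int[P]_x expR (u x)) - ln (\int[P]_x expR (v x)) <= c.
  move=> bu bv huv; rewrite lerBlDr -[X in X + _]expRK.
  rewrite -lnM ?posrE ?expR_gt0 ?mean_expR_gt0// ler_ln ?posrE ?mulr_gt0 ?expR_gt0 ?mean_expR_gt0//.
  rewrite -meanZ; last exact: bmeas_expR.
  apply: le_mean; first exact: bmeas_expR.
    by apply: bmeasM; [exact: bmeas_cst|exact: bmeas_expR].
  by move=> x; rewrite -expRD ler_expR -lerBlDr.
have kfg := key _ _ bf bg (fun x => le_trans (ler_norm _) (h x)).
rewrite ler_norml kfg andbT lerNl opprB; apply: key => // x.
by rewrite (le_trans (ler_norm _))// distrC.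
Qed.

End tuple_functions.

Section gauss_tuple.
Context {R : realType}.
Local Notation mR := (measurableTypeR R).
Local Notation gamma := (@normal_prob R 0 1).

Section step.
Context (n : nat) (mu : probability (n.-tuple mR) R).

Definition gauss_cons : set (n.+1.-tuple mR) -> \bar R :=
  pushforward (gamma \x mu)%E (@tuple_cons R n).

Let mpre (A : set (n.+1.-tuple mR)) : measurable A -> measurable (@tuple_cons R n @^-1` A).
Proof. by move=> mA; rewrite -[X in measurable X]setTI; exact: measurable_tuple_cons. Qed.

Let gauss_cons0 : gauss_cons set0 = 0%E.
Proof. by rewrite /gauss_cons /pushforward preimage_set0 measure0. Qed.

Let gauss_cons_ge0 A : (0 <= gauss_cons A)%E.
Proof. by rewrite /gauss_cons /pushforward; exact: measure_ge0. Qed.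

Let gauss_cons_sigma_additive : semi_sigma_additive gauss_cons.
Proof.
move=> F mF tF mUF; rewrite /gauss_cons /pushforward preimage_bigcup.
apply: measure_semi_sigma_additive => [k||]; first exact: mpre.
- apply/trivIsetP => /= i j _ _ ij; rewrite -preimage_setI.
  by move/trivIsetP : tF => /(_ _ _ _ _ ij) ->//; rewrite preimage_set0.
- by rewrite -preimage_bigcup; exact: mpre.
Qed.

HB.instance Definition _ := isMeasure.Build _ _ _ gauss_cons
  gauss_cons0 gauss_cons_ge0 gauss_cons_sigma_additive.

Let gauss_consT : gauss_cons setT = 1%E.
Proof.
rewrite /gauss_cons /pushforward preimage_setT -setXTT.
have -> : (gamma \x mu)%E (setT `*` setT) = (gamma setT * mu setT)%E by exact: product_measure1E.
by rewrite !probability_setT mule1.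
Qed.

HB.instance Definition _ := Measure_isProbability.Build _ _ _ gauss_cons gauss_consT.

End step.

Fixpoint gauss_tuple n : probability (n.-tuple mR) R :=
  match n with
  | 0 => dirac ([tuple] : 0.-tuple mR)
  | n'.+1 => gauss_cons (gauss_tuple n')
  end.

Lemma ge0_gauss_tupleS n (f : n.+1.-tuple mR -> \bar R) :
  measurable_fun setT f -> (forall x, 0 <= f x)%E ->
  (\int[gauss_tuple n.+1]_t f t = \int[gamma]_x \int[gauss_tuple n]_t f (tuple_cons (x, t)))%E.
Proof.
move=> mf f0.
rewrite [LHS](ge0_integral_pushforward (@measurable_tuple_cons R n) _ measurableT mf (fun y _ => f0 y)).
rewrite preimage_setT.
exact: (fubini_tonelli1 _ (measurableT_comp mf (@measurable_tuple_cons R n)) (fun x => f0 _)).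
Qed.

Lemma mean_gauss_tupleS n (f : n.+1.-tuple mR -> R) : bmeas f ->
  \int[gauss_tuple n.+1]_t f t = \int[gamma]_x \int[gauss_tuple n]_t f (tuple_cons (x, t)).
Proof.
move=> bf; have [mf [B hB]] := bf.
have bfc : bmeas (f \o @tuple_cons R n) by exact: measurable_bmeas (@measurable_tuple_cons R n) bf.
have bfx x : bmeas (fun t => f (tuple_cons (x, t))) by exact: (bmeas_pair1 bfc x).
have bB d (T : measurableType d) : bmeas (fun _ : T => B) by exact: bmeas_cst.
have bm : bmeas (fun x : mR => \int[gauss_tuple n]_t f (tuple_cons (x, t))).
  exact: (bmeas_mean1 gamma (gauss_tuple n) bfc).
apply: (@addIr _ B).
rewrite -[X in _ + X = _](mean_cst (gauss_tuple n.+1)) -meanD//.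
rewrite -[X in _ = _ + X](mean_cst gamma) -meanD//.
rewrite [LHS]/Rintegral ge0_gauss_tupleS.
- rewrite [RHS]/Rintegral; congr fine; apply: eq_integral => x _.
  by rewrite -[in RHS](mean_cst (gauss_tuple n) B) -meanD// EFin_mean//; exact: bmeasD.
- by apply/measurable_EFinP; exact: measurable_funD.
- by move=> x; rewrite lee_fin -lerBlDr sub0r; have := hB x; rewrite ler_norml => /andP[].
Qed.

Lemma comb_tuple_cons n a b (z w : mR * n.-tuple mR) :
  comb a b (tuple_cons z) (tuple_cons w) = tuple_cons (a * z.1 + b * w.1, comb a b z.2 w.2).
Proof.
apply: eq_from_tnth => i; rewrite tnth_mktuple.
by case: (unliftP ord0 i) => [k|] -> //; rewrite !tnthS tnth_mktuple.
Qed.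

Lemma tdist_tuple_cons n (z w : mR * n.-tuple mR) :
  tdist (tuple_cons z) (tuple_cons w) = `|z.1 - w.1| + tdist z.2 w.2.
Proof.
rewrite /tdist big_ord_recl/=; congr (_ + _); apply: eq_bigr => i _.
by rewrite !tnthS.
Qed.

Lemma tdistxx n (x : n.-tuple R) : tdist x x = 0.
Proof. by rewrite /tdist big1// => i _; rewrite subrr normr0. Qed.

Section hyper.
Variables (a b : R).
Hypotheses (a0 : 0 < a) (b0 : 0 < b) (ab : a ^+ 2 + b ^+ 2 = 1).

Let tlip_comb n B L (phi : n.-tuple R -> R) y : 0 <= L -> tlip B L phi ->
  tlip B (L * `|a|) (fun x => phi (comb a b x y)).
Proof.
move=> L0 [hB hL]; split => // x x'; apply: (le_trans (hL _ _)).
rewrite -mulrA ler_wpM2l// (le_trans (tdist_comb _ _ _ _ _ _))//.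
by rewrite tdistxx mulr0 addr0.
Qed.

Let bmeas_comb n (phi : n.-tuple R -> R) t : tblip phi ->
  bmeas (fun s : n.-tuple mR => phi (comb a b t s)).
Proof.
by move=> tphi; apply: (measurable_bmeas (measurable_comb a b t)); exact: tblip_bmeas.
Qed.

(* Tensorization: the one-variable inequality is applied in the head variable, and the
   concavity of [phi |-> - ln (\int expR phi)] moves the average over the tail variables
   inside the logarithm. *)
Lemma gauss_hyper n (phi : n.-tuple R -> R) : tblip phi ->
  \int[gauss_tuple n]_x expR (a ^- 2 * \int[gauss_tuple n]_y phi (comb a b x y)) <=
  expR (a ^- 2 * ln (\int[gauss_tuple n]_x expR (phi x))).
Proof.
set lam := a ^- 2.
have lam0 : 0 <= lam by rewrite invr_ge0 sqr_ge0.
elim: n phi => [|n IH] phi tphi.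
  have e t : phi t = phi [tuple] by rewrite (tuple0 t).
  under eq_Rintegral do under eq_Rintegral do rewrite e.
  under [in leRHS]eq_Rintegral do rewrite e.
  by rewrite !mean_cst expRK.
have [B [L [L0 hphi]]] := tphi; have [hB hL] := hphi.
have bphi := tblip_bmeas tphi.
(* [K] averages over the tail noise with the head left free; [Lf] takes the logarithmic exponential
   mean over the head with the tail left free. The proof exchanges these two operations. *)
pose K t z := \int[gauss_tuple n]_s phi (tuple_cons (z, comb a b t s)).
pose Lf w := ln (\int[gamma]_z expR (phi (tuple_cons (z, w)))).
have mpair t : measurable_fun setT (fun zs : mR * n.-tuple mR => tuple_cons (zs.1, comb a b t zs.2)).
  apply: (measurableT_comp (@measurable_tuple_cons R n)).
  apply/measurable_fun_pair => //=.
  exact: (measurableT_comp (measurable_comb a b t)).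
have bpair t : bmeas (fun zs : mR * n.-tuple mR => phi (tuple_cons (zs.1, comb a b t zs.2))).
  exact: measurable_bmeas (mpair t) bphi.
have bz w : bmeas (fun z : mR => phi (tuple_cons (z, w))).
  apply: (measurable_bmeas (g := fun z : mR => tuple_cons (z, w))) => //.
  exact: (measurableT_comp (@measurable_tuple_cons R n)).
have tLf : tblip Lf.
  exists B, L; split => //; split => [w|w w'].
    rewrite -[X in `|X|]subr0 -[X in _ - X]ln1.
    have -> : 1 = \int[gamma]_z expR 0 :> R by rewrite expR0 mean_cst.
    apply: ln_mean_expR_dist => [||z]; [exact: bz|exact: bmeas_cst|by rewrite subr0].
  apply: ln_mean_expR_dist => [||z]; [exact: bz|exact: bz|].
  by apply: (le_trans (hL _ _)); rewrite tdist_tuple_cons/= subrr normr0 add0r.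
have bK t : blip (K t).
  split; [exists B => z|exists L => z z'].
    rewrite -[X in `|X|]subr0; apply: ler_norm_mean => [|s]; last by rewrite subr0.
    exact: (bmeas_pair1 (bpair t)).
  rewrite /K -meanB; try exact: (bmeas_pair1 (bpair t)).
  rewrite -[X in `|X|]subr0; apply: ler_norm_mean.
    by apply: bmeasB; exact: (bmeas_pair1 (bpair t)).
  move=> s; rewrite subr0; apply: (le_trans (hL _ _)).
  by rewrite tdist_tuple_cons/= tdistxx addr0.
have tPhi : tblip (fun X => \int[gauss_tuple n.+1]_Y phi (comb a b X Y)).
  exists B, (L * `|a|); split; first by rewrite mulr_ge0.
  apply: tlip_mean => [X|Y]; last exact: tlip_comb.
  by have [] := bmeas_comb X tphi.
have bPhi := tblip_bmeas (tblip_expR lam tPhi).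
rewrite (mean_gauss_tupleS bPhi).
rewrite (mean_Fubini gamma (gauss_tuple n) (measurable_bmeas (@measurable_tuple_cons R n) bPhi)).
have inner t : \int[gamma]_x expR (lam * \int[gauss_tuple n.+1]_Y phi (comb a b (tuple_cons (x, t)) Y))
    <= expR (lam * ln (\int[gamma]_z expR (K t z))).
  apply: le_trans (gauss_hyper1 a0 b0 ab (bK t)).
  rewrite le_eqVlt; apply/orP; left; apply/eqP; apply: eq_Rintegral => x _; congr (expR (_ * _)).
  rewrite mean_gauss_tupleS; last exact: bmeas_comb.
  by apply: eq_Rintegral => y _; apply: eq_Rintegral => s _; rewrite comb_tuple_cons.
(* [D] is [phi] normalised so that, for each tail, its exponential has mean one over the head.
   Jensen's inequality over the tail followed by Fubini gives [expR (K t z - m)] a mean of at most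
   one. *)
have holder t : ln (\int[gamma]_z expR (K t z)) <= \int[gauss_tuple n]_s Lf (comb a b t s).
  set m := \int[gauss_tuple n]_s _.
  have bLt : bmeas (fun s : n.-tuple mR => Lf (comb a b t s)) by exact: bmeas_comb.
  pose D (zs : mR * n.-tuple mR) := phi (tuple_cons (zs.1, comb a b t zs.2)) - Lf (comb a b t zs.2).
  have bD : bmeas D.
    apply: bmeasB; first exact: bpair.
    by apply: (measurable_bmeas (g := snd) (f := fun s : n.-tuple mR => Lf (comb a b t s))).
  have beD : bmeas (expR \o D) by exact: bmeas_expR.
  have bKm : bmeas (fun z : mR => expR (K t z)) by apply: bmeas_expR; exact/blip_bmeas/bK.
  rewrite -[leRHS]expRK ler_ln ?posrE ?expR_gt0 ?mean_expR_gt0//; last exact/blip_bmeas/bK.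
  have -> : \int[gamma]_z expR (K t z) = expR m * \int[gamma]_z expR (K t z - m).
    rewrite -meanZ; last first.
      by apply: bmeas_expR; apply: bmeasB; [exact/blip_bmeas/bK|exact: bmeas_cst].
    by apply: eq_Rintegral => z _; rewrite -expRD subrKC.
  rewrite ger_pMr ?expR_gt0//.
  apply: (@le_trans _ _ (\int[gamma]_z \int[gauss_tuple n]_s expR (D (z, s)))).
    apply: le_mean.
    - by apply: bmeas_expR; apply: bmeasB; [exact/blip_bmeas/bK|exact: bmeas_cst].
    - exact: (bmeas_mean1 gamma (gauss_tuple n) beD).
    - move=> z; rewrite /K /m -meanB//; last exact: (bmeas_pair1 (bpair t)).
      by apply: jensen_expR; exact: (bmeas_pair1 bD).
  rewrite (mean_Fubini gamma (gauss_tuple n) beD).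
  rewrite -[leRHS](mean_cst (gauss_tuple n)) le_eqVlt; apply/orP; left; apply/eqP.
  apply: eq_Rintegral => s _; rewrite /D/=.
  under eq_Rintegral do rewrite expRD mulrC.
  rewrite meanZ; last exact/bmeas_expR/bz.
  by rewrite expRN lnK ?mulVf// ?posrE ?gt_eqF// mean_expR_gt0.
have tLm : tblip (fun t => \int[gauss_tuple n]_s Lf (comb a b t s)).
  have [B' [L' [L0' hLf]]] := tLf.
  exists B', (L' * `|a|); split; first by rewrite mulr_ge0.
  apply: tlip_mean => [X|Y]; last exact: tlip_comb.
  by have [] := bmeas_comb X tLf.
apply: (@le_trans _ _ (\int[gauss_tuple n]_t expR (lam * \int[gauss_tuple n]_s Lf (comb a b t s)))).
  apply: le_mean.
  - exact: (bmeas_mean2 gamma (gauss_tuple n) (measurable_bmeas (@measurable_tuple_cons R n) bPhi)).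
  - exact/tblip_bmeas/tblip_expR.
  - by move=> t; apply: (le_trans (inner t)); rewrite ler_expR ler_wpM2l.
apply: (le_trans (IH _ tLf)); rewrite ler_expR ler_wpM2l//.
rewrite le_eqVlt; apply/orP; left; apply/eqP; congr ln.
have bephi : bmeas (fun x : n.+1.-tuple mR => expR (phi x)) by exact: bmeas_expR.
rewrite (mean_gauss_tupleS bephi).
rewrite (mean_Fubini gamma (gauss_tuple n) (measurable_bmeas (@measurable_tuple_cons R n) bephi)).
by apply: eq_Rintegral => w _; rewrite lnK// posrE mean_expR_gt0.
Qed.

End hyper.

End gauss_tuple.

Lemma ge0_integral_sup_le d (T : measurableType d) {R : realType}
    (mu : {measure set T -> \bar R}) (f : T -> R) (g : nat -> T -> R) (C : \bar R) :
  measurable_fun setT f -> (forall x, 0 <= f x) ->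
  (forall k, measurable_fun setT (g k)) -> (forall k x, 0 <= g k x) ->
  (forall k x, g k x <= g k.+1 x) ->
  (forall x e, 0 < e -> exists k, f x - e <= g k x) ->
  (forall k, \int[mu]_x (g k x)%:E <= C)%E ->
  (\int[mu]_x (f x)%:E <= C)%E.
Proof.
move=> mf f0 mg g0 ndg supg gC.
have nd x : {homo (fun k => (g k x)%:E) : n m / (n <= m)%N >-> (n <= m)%E}.
  move=> n m /subnK <-; elim: (m - n)%N => [|j IH]; first by rewrite add0n.
  by rewrite (le_trans IH)// addSn lee_fin.
have cg x : cvgn (fun k => (g k x)%:E) := ereal_nondecreasing_is_cvgn (@nd x).
have flim x : ((f x)%:E <= limn (fun k => (g k x)%:E))%E.
  apply/lee_addgt0Pr => e e0; rewrite -leeBlDr// -EFinB.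
  have [k hk] := supg x e e0.
  apply: lime_ge => //; near=> n.
  apply: (@le_trans _ _ (g k x)%:E); first by rewrite lee_fin.
  by apply: nd; near: n; exact: nbhs_infty_ge.
have meg k : measurable_fun setT (EFin \o g k) by apply/measurable_EFinP.
apply: (@le_trans _ _ (\int[mu]_x limn (fun k => (g k x)%:E))%E).
  apply: ge0_le_integral => //.
  - by move=> x _; rewrite lee_fin.
  - by apply/measurable_EFinP.
  - apply: (emeasurable_fun_cvg (fun k => EFin \o g k)) => // x _.
    exact: cg.
have g0' n x : setT x -> (0 <= (EFin \o g n) x)%E by move=> _; rewrite lee_fin.
have nd' x : setT x -> {homo (fun k => (EFin \o g k) x) : n m / (n <= m)%N >-> (n <= m)%E} by move=> _; exact: nd.
rewrite (monotone_convergence mu measurableT meg g0' nd').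
apply: lime_le; last by apply: nearW => n; exact: gC.
apply: ereal_nondecreasing_is_cvgn => n m nm; apply: ge0_le_integral => // x _.
  exact: g0'.
exact: nd'.
Unshelve. all: end_near. Qed.

(** * Lipschitz approximation from below *)

Section inf_convolution.
Context {R : realType} (n : nat).
Variables (phi : n.-tuple R -> R) (c : R).
Hypotheses (cphi : tcont phi) (phi_ge : forall x, c <= phi x).

Let S (k : nat) x := [set phi y + k%:R * tdist x y | y in setT].
Let infconv k x := inf (S k x).

Let S_lb k x : has_lbound (S k x).
Proof.
by exists c => _ [y _ <-]; rewrite -[c]addr0 lerD// mulr_ge0// ?ler0n// tdist_ge0.
Qed.

Let S_neq0 k x : S k x !=set0.
Proof. by exists (phi x + k%:R * tdist x x), x. Qed.

Let infconv_le k x y : infconv k x <= phi y + k%:R * tdist x y.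
Proof. by apply: ge_inf => //; exists y. Qed.

Let infconv_ge k x m : (forall y, m <= phi y + k%:R * tdist x y) -> m <= infconv k x.
Proof. by move=> h; apply: lb_le_inf => // _ [y _ <-]. Qed.

Lemma tdistC (x y : n.-tuple R) : tdist x y = tdist y x.
Proof. by apply: eq_bigr => i _; rewrite distrC. Qed.

Lemma tdist_triangle (x y z : n.-tuple R) : tdist x z <= tdist x y + tdist y z.
Proof. by rewrite /tdist -big_split/=; apply: ler_sum => i _; exact: ler_distD. Qed.

(** The inf-convolution is Lipschitz but may be unbounded, hence the ceiling. Slope and ceiling both
    grow with [k], which keeps the sequence monotone. *)
Definition lip_trunc k x := Num.min (infconv k x) (c + k%:R).

Let infconv_lip k x y : infconv k x - infconv k y <= k%:R * tdist x y.
Proof.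
rewrite lerBlDl -lerBlDr; apply: infconv_ge => z.
rewrite lerBlDr (le_trans (infconv_le k x z))// -addrA lerD2l -mulrDr ler_wpM2l ?ler0n//.
by rewrite addrC tdist_triangle.
Qed.

Lemma lip_trunc_ge k x : c <= lip_trunc k x.
Proof.
rewrite le_min lerDl ler0n andbT; apply: infconv_ge => y.
by rewrite -[c]addr0 lerD// mulr_ge0// ?ler0n// tdist_ge0.
Qed.

Lemma lip_trunc_le k x : lip_trunc k x <= phi x.
Proof.
rewrite ge_min; apply/orP; left.
by have := infconv_le k x x; rewrite tdistxx mulr0 addr0.
Qed.

Lemma tblip_lip_trunc k : tblip (lip_trunc k).
Proof.
exists (`|c| + k%:R), k%:R; split; first exact: ler0n.
split=> [x|x y].
  have h1 := lip_trunc_ge k x.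
  have h2 : lip_trunc k x <= c + k%:R by rewrite ge_min lexx orbT.
  rewrite ler_norml; have := ler_norm c; have := ler_norm (- c); rewrite normrN => c1 c2.
  by apply/andP; split; have := ler0n R k; lra.
have key u v : lip_trunc k u - lip_trunc k v <= k%:R * tdist u v.
  rewrite /lip_trunc; have h := infconv_lip k u v.
  have h0 : 0 <= k%:R * tdist u v by rewrite mulr_ge0 ?ler0n ?tdist_ge0.
  have [e|e] : Num.min (infconv k v) (c + k%:R) = infconv k v \/
      Num.min (infconv k v) (c + k%:R) = c + k%:R.
  - by rewrite /Order.min; case: ifP; [left|right].
  - by rewrite e (le_trans _ h)// lerD2r ge_min lexx.
  - by rewrite e (le_trans _ h0)// subr_le0 ge_min lexx orbT.
by rewrite ler_norml key andbT lerNl opprB tdistC.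
Qed.

Lemma lip_trunc_nd k x : lip_trunc k x <= lip_trunc k.+1 x.
Proof.
rewrite /lip_trunc le_min; apply/andP; split.
  rewrite ge_min; apply/orP; left; apply: infconv_ge => y.
  rewrite (le_trans (infconv_le k x y))// lerD2l ler_wpM2r ?tdist_ge0// ler_nat//.
by rewrite ge_min; apply/orP; right; rewrite lerD2l ler_nat.
Qed.

Lemma lip_trunc_sup x e : 0 < e -> exists k, phi x - e <= lip_trunc k x.
Proof.
move=> e0; have [d d0 hd] := cphi x e0.
(* The second summand puts the ceiling above [phi x]. The first makes the penalty [k * d] exceed
   [phi x - c], so that points at distance at least [d] cannot lower the infimum below [phi x];
   nearer points are handled by continuity. *)
pose k := Num.bound ((phi x - c) / d + (phi x - c)).
have f0 : 0 <= phi x - c by rewrite subr_ge0.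
have hk : (phi x - c) / d + (phi x - c) < k%:R.
  by rewrite archi_boundP// addr_ge0// divr_ge0// ltW.
exists k; rewrite le_min; apply/andP; split; last first.
  have : 0 <= (phi x - c) / d by rewrite divr_ge0// ltW.
  by move: hk; lra.
apply: infconv_ge => y.
have kt : 0 <= k%:R * tdist x y by rewrite mulr_ge0 ?ler0n ?tdist_ge0.
have [yd|yd] := ltP (tdist x y) d.
  have : `|phi x - phi y| < e.
    apply: hd => i; apply: le_lt_trans yd.
    by rewrite /tdist (bigD1 i)//= lerDl sumr_ge0.
  by rewrite ltr_norml => /andP[_]; lra.
have : phi x - c <= k%:R * tdist x y.
  apply: (@le_trans _ _ (k%:R * d)); last by rewrite ler_wpM2l ?ler0n.
  rewrite -ler_pdivrMr//; lra.
by have := phi_ge y; lra.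
Qed.

End inf_convolution.

Section strong_hyper.
Context {R : realType}.
Local Notation mR := (measurableTypeR R).
Variables (a b : R).
Hypotheses (a0 : 0 < a) (b0 : 0 < b) (ab : a ^+ 2 + b ^+ 2 = 1).

Definition tscale n (s : R) (x : n.-tuple R) : n.-tuple R := [tuple s * tnth x i | i < n].

Lemma measurable_tscale n s : measurable_fun setT (tscale s : n.-tuple mR -> n.-tuple mR).
Proof.
apply/measurable_fun_tnthP => i.
rewrite (_ : _ \o _ = fun y : n.-tuple mR => s * tnth y i); last first.
  by apply/funext => y /=; rewrite tnth_mktuple.
by apply: measurable_funM => //; exact: measurable_tnth.
Qed.

(* If [phi] is below its Gaussian averages, hypercontractivity for the averages
   becomes hypercontractivity for the dilation of [phi] itself. *)
Lemma gauss_strong_hyper n (phi : n.-tuple R -> R) (c I : R) : tcont phi ->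
  (forall x, c <= phi x) ->
  (forall x, (phi (tscale a x) - c)%:E <=
    \int[gauss_tuple n]_y (phi (comb a b x y) - c)%:E)%E ->
  (\int[gauss_tuple n]_x (expR (phi x))%:E = I%:E)%E ->
  (\int[gauss_tuple n]_x (expR (a ^- 2 * phi (tscale a x)))%:E <=
    (expR (a ^- 2 * ln I))%:E)%E.
Proof.
move=> cphi phic sub intI.
set lam := a ^- 2.
have lam0 : 0 < lam by rewrite invr_gt0 exprn_gt0.
have mphi := tcont_measurable cphi.
pose u k := lip_trunc phi c k.
have tu k : tblip (u k) by exact: tblip_lip_trunc.
have bu k x : bmeas (fun y : n.-tuple mR => u k (comb a b x y)).
  by apply: (measurable_bmeas (measurable_comb a b x)); exact: tblip_bmeas.
pose g k x := expR (lam * \int[gauss_tuple n]_y u k (comb a b x y)).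
have tg k : tblip (fun x => \int[gauss_tuple n]_y u k (comb a b x y)).
  have [B [L [L0 hL]]] := tu k.
  exists B, (L * `|a|); split; first by rewrite mulr_ge0.
  apply: tlip_mean => [X|Y]; first by have [] := bu k X.
  have [hB hl] := hL; split => // x x'; apply: (le_trans (hl _ _)).
  by rewrite -mulrA ler_wpM2l// (le_trans (tdist_comb _ _ _ _ _ _))// tdistxx mulr0 addr0.
apply: (@ge0_integral_sup_le _ _ R (gauss_tuple n) (fun x => expR (lam * phi (tscale a x))) g).
- apply: measurableT_comp => //; apply: measurable_funM => //.
  exact: (measurableT_comp mphi (measurable_tscale a)).
- by move=> x; exact: expR_ge0.
- by move=> k; have [] := tblip_bmeas (tblip_expR lam (tg k)).
- by move=> k x; exact: expR_ge0.
- move=> k x; rewrite ler_expR ler_wpM2l ?(ltW lam0)//; apply: le_mean => // y.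
  exact: lip_trunc_nd.
- move=> x e e0; set F := phi (tscale a x).
  (* Chosen so that the tangent to [expR] at [lam * F] loses exactly [e] at [lam * (F - e')]. *)
  pose e' := e / (lam * expR (lam * F)).
  have e'0 : 0 < e' by rewrite divr_gt0// mulr_gt0// expR_gt0.
  (* Otherwise all averages of the [u k] stay below [F - e'], and by monotone convergence so does
     the average of [phi], against [sub]. *)
  have [k hk] : exists k, F - e' <= \int[gauss_tuple n]_y u k (comb a b x y).
    apply: contrapT => /forallNP hn.
    have : (\int[gauss_tuple n]_y (phi (comb a b x y) - c)%:E <= (F - e' - c)%:E)%E.
      apply: (@ge0_integral_sup_le _ _ R (gauss_tuple n) (fun y => phi (comb a b x y) - c)
        (fun k y => u k (comb a b x y) - c)).
      - by apply: measurable_funB => //; exact: (measurableT_comp mphi (measurable_comb a b x)).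
      - by move=> y; rewrite subr_ge0.
      - by move=> k; have [mu _] := bu k x; exact: measurable_funB.
      - by move=> k y; rewrite subr_ge0; exact: lip_trunc_ge.
      - by move=> k y; rewrite lerD2r; exact: lip_trunc_nd.
      - move=> y d d0; have [k hk] := lip_trunc_sup cphi phic (comb a b x y) d0.
        by exists k; rewrite addrAC lerD2r.
      - move=> k; have bk := bu k x.
        have bc : bmeas (fun _ : n.-tuple mR => c) by exact: bmeas_cst.
        rewrite -EFin_mean; last exact: bmeasB.
        rewrite lee_fin meanB// mean_cst lerD2r.
        by have /negP := hn k; rewrite -ltNge => /ltW.
    move=> /(le_trans (sub x)); rewrite lee_fin -/F lerD2r.
    by rewrite lerBrDl -lerBrDr subrr leNgt e'0.
  exists k; apply: (@le_trans _ _ (expR (lam * (F - e')))); last first.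
    by rewrite ler_expR ler_wpM2l ?(ltW lam0).
  have := expR_tangent (lam * F) (lam * (F - e')).
  have -> : lam * (F - e') - lam * F = - (lam * e') by ring.
  have -> : expR (lam * F) * (1 - lam * e') = expR (lam * F) - e.
    by rewrite /e'; field; rewrite !gt_eqF// expR_gt0.
  by [].
- move=> k; rewrite -EFin_mean; last exact: tblip_bmeas (tblip_expR lam (tg k)).
  rewrite lee_fin; apply: (le_trans (gauss_hyper a0 b0 ab (tu k))).
  have bek : bmeas (fun x : n.-tuple mR => expR (u k x)) by apply: bmeas_expR; exact: tblip_bmeas.
  have leI : \int[gauss_tuple n]_x expR (u k x) <= I.
    rewrite -lee_fin EFin_mean// -intI; apply: ge0_le_integral => //.
    + by apply/measurable_EFinP; have [] := bek.
    + by apply/measurable_EFinP; exact: measurableT_comp.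
    + by move=> x _; rewrite lee_fin ler_expR; exact: lip_trunc_le.
  have pos : 0 < \int[gauss_tuple n]_x expR (u k x).
    by apply: mean_expR_gt0; exact: tblip_bmeas.
  by rewrite ler_expR ler_wpM2l ?(ltW lam0)// ler_ln ?posrE// (lt_le_trans pos).
Qed.

End strong_hyper.

(** * Submean property of Gaussian averages *)

Section slices.
Context {R : realType}.
Local Notation mR := (measurableTypeR R).
Local Notation gamma := (@normal_prob R 0 1).

Definition tupd n (t : n.-tuple R) (i : 'I_n) (s : R) : n.-tuple R :=
  [tuple if j == i then s else tnth t j | j < n].

Lemma tnth_tupd n (t : n.-tuple R) i s j :
  tnth (tupd t i s) j = if j == i then s else tnth t j.
Proof. by rewrite tnth_mktuple. Qed.

Lemma tupd_head n (x s : R) (t : n.-tuple R) :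
  tupd (tuple_cons (x, t)) ord0 s = tuple_cons (s, t).
Proof.
apply: eq_from_tnth => j; rewrite tnth_tupd.
case: (unliftP ord0 j) => [k|] -> //.
by rewrite eq_sym (negbTE (neq_lift _ _)) !tnthS.
Qed.

Lemma tupd_tail n (x s : R) (t : n.-tuple R) (i : 'I_n) :
  tupd (tuple_cons (x, t)) (lift ord0 i) s = tuple_cons (x, tupd t i s).
Proof.
apply: eq_from_tnth => j; rewrite tnth_tupd.
case: (unliftP ord0 j) => [k|] -> //.
by rewrite !tnthS tnth_tupd (inj_eq (@lift_inj _ _)).
Qed.

Lemma mean_slice0 n (g : n.-tuple mR -> R) (i : 'I_n) : bmeas g ->
  (forall t, \int[gamma]_s g (tupd t i s) = 0) -> \int[gauss_tuple n]_t g t = 0.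
Proof.
elim: n g i => [|n IH] g i bg h; first by case: i h.
have bgc : bmeas (g \o @tuple_cons R n) by exact: measurable_bmeas (@measurable_tuple_cons R n) bg.
rewrite mean_gauss_tupleS//.
case: (unliftP ord0 i) h => [j|] -> h.
  transitivity (\int[gamma]_x (0 : R)); last by rewrite mean_cst.
  apply: eq_Rintegral => x _.
  apply: (IH (fun t => g (tuple_cons (x, t))) j); first exact: (bmeas_pair1 bgc x).
  by move=> t; rewrite -[RHS](h (tuple_cons (x, t))); apply: eq_Rintegral => s _; rewrite tupd_tail.
rewrite (mean_Fubini gamma (gauss_tuple n) bgc).
transitivity (\int[gauss_tuple n]_x (0 : R)); last by rewrite mean_cst.
apply: eq_Rintegral => t _ /=.
by rewrite -[RHS](h (tuple_cons (0, t))); apply: eq_Rintegral => s _; rewrite tupd_head.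
Qed.

(* [expR (s ^+ 2 / 2)] turns the Gaussian measure into a multiple of Lebesgue measure. *)
Lemma mean_gauss_derive0 (F f : R -> R) (L : R) : 0 < L ->
  (forall s : R, is_derive s 1 F (f s)) -> continuous f ->
  (forall s : R, L <= `|s| -> F s = 0 /\ f s = 0) ->
  \int[gamma]_s (f s * expR (s ^+ 2 / 2)) = 0.
Proof.
move=> L0 dF cf supp.
have LL : - L < L by rewrite (lt_trans _ L0)// oppr_lt0.
have cF : continuous F.
  by move=> s; apply/differentiable_continuous/derivable1_diffP.
have [FL _] := supp L (ler_norm L).
have [FmL _] := supp (- L) ltac:(by rewrite normrN ler_norm).
pose c : R := (Num.sqrt (2 * pi))^-1.
have c0 : 0 <= c by rewrite invr_ge0 sqrtr_ge0.
have intf0 : (\int[lebesgue_measure]_(s in `[(- L)%R, L%R]) (c * f s)%:E = 0)%E.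
  rewrite (@continuous_FTC2 _ (fun s => c * f s) (fun s => c * F s))//.
  - by rewrite FL FmL subee.
  - apply: continuous_subspaceT => s; apply: cvgM; [exact: cvg_cst|exact: cf].
  - have cF1 : continuous (fun s => c * F s).
      by move=> s; apply: cvgM; [exact: cvg_cst|exact: cF].
    split => //; [apply: cvg_at_right_filter; exact: cF1|apply: cvg_at_left_filter; exact: cF1].
  - by move=> s _; rewrite derive1E derive_val.
have mf : measurable_fun setT (f : mR -> R) by apply: continuous_measurable_fun.
have mh : measurable_fun setT (fun s : mR => (f s * expR (s ^+ 2 / 2))%:E).
  apply/measurable_EFinP/measurable_funM => //; apply: measurableT_comp => //.
  by apply: measurable_funM => //; exact: exprn_measurable.
have hmax (v s : R) : Num.max (v * expR (s ^+ 2 / 2)) 0 * normal_pdf 0 1 s = Num.max (c * v) 0.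
  have p0 : 0 <= expR (s ^+ 2 / 2) * normal_pdf 0 1 s by rewrite mulr_ge0 ?expR_ge0 ?normal_pdf_ge0.
  have pe : expR (s ^+ 2 / 2) * normal_pdf 0 1 s = c.
    rewrite normal_pdf_gt0E// invr1 mulr1 mulrCA -expRD subr0 expr1n mulr1 mulNr subrr expR0 mulr1 //.
  by rewrite maxr_pMl ?normal_pdf_ge0// mul0r -mulrA pe mulrC.
rewrite /Rintegral -[RHS]/(fine 0%E); congr fine.
rewrite -intf0 [RHS]integral_mkcond.
have -> : ((fun s => (c * f s)%:E) \_ `[- L, L] = fun s => (c * f s)%:E)%classic.
  apply/funext => s; rewrite patchE; case: ifPn => //; rewrite notin_setE/= in_itv/= => /negP.
  rewrite -ler_norml -ltNge => /ltW sL.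
  by have [_ ->] := supp s sL; rewrite mulr0.
rewrite [LHS]integralE [RHS]integralE; congr (_ - _)%E.
- rewrite [LHS](ge0_integral_normal_prob _ _ (measurable_funepos mh) (funepos_ge0 _)).
  apply: eq_integral => s _; rewrite !funeposE -!EFin_max -EFinM; congr (_%:E).
  exact: hmax.
- rewrite [LHS](ge0_integral_normal_prob _ _ (measurable_funeneg mh) (funeneg_ge0 _)).
  apply: eq_integral => s _; rewrite !funenegE -!EFin_max -EFinM; congr (_%:E).
  by rewrite -mulNr -mulrN; apply: hmax.
Qed.


Definition tuple_of_rV n (v : 'rV[R]_n) : n.-tuple R := [tuple v 0 i | i < n].

Lemma tcontP n (phi : n.-tuple R -> R) :
  tcont phi <-> continuous (fun v : 'rV[R]_n => phi (tuple_of_rV v)).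
Proof.
split=> [h v|h t e e0].
  have FF : Filter (nbhs (v : 'rV[R]_n)) by exact: nbhs_filter.
  apply/(@cvgrPdist_lt _ _ _ _ FF) => e e0; have [d d0 hd] := h (tuple_of_rV v) e e0.
  apply/nbhs_ballP; exists d => //= w vw; apply: hd => i.
  by rewrite !tnth_mktuple; exact: (vw.2 ord0 i).
have := h (\row_i tnth t i); move/(@cvgrPdist_lt _ _ _ _ (nbhs_filter _)) => /(_ e e0)/nbhs_ballP[d /= d0 hd].
have tE (t' : n.-tuple R) : tuple_of_rV (\row_i tnth t' i) = t'.
  by apply: eq_from_tnth => i; rewrite tnth_mktuple mxE.
exists d => // t' tt'; have := hd (\row_i tnth t' i); rewrite !tE; apply; split=> // i j.
by rewrite !mxE; exact: tt'.
Qed.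

Lemma tcont_comp n (f : R -> R) (phi : n.-tuple R -> R) :
  continuous f -> tcont phi -> tcont (fun t => f (phi t)).
Proof.
by move=> cf /tcontP cphi; apply/tcontP => v; have FF : Filter (nbhs (v : 'rV[R]_n)) := nbhs_filter v; apply: continuous_comp; [exact: cphi|exact: cf].
Qed.

Lemma tcont_cst n (c : R) : tcont (fun _ : n.-tuple R => c).
Proof. by apply/tcontP => v; have FF : Filter (nbhs (v : 'rV[R]_n)) := nbhs_filter v; exact: cvg_cst. Qed.

Lemma tcont_tnth n (i : 'I_n) : tcont (fun t : n.-tuple R => tnth t i).
Proof. by move=> t e e0; exists e => // t'; exact. Qed.

Lemma tcontD n (f g : n.-tuple R -> R) : tcont f -> tcont g -> tcont (fun t => f t + g t).
Proof.
by move=> /tcontP cf /tcontP cg; apply/tcontP => v; have FF : Filter (nbhs (v : 'rV[R]_n)) := nbhs_filter v; apply: cvgD; [exact: cf|exact: cg].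
Qed.

Lemma tcontM n (f g : n.-tuple R -> R) : tcont f -> tcont g -> tcont (fun t => f t * g t).
Proof.
by move=> /tcontP cf /tcontP cg; apply/tcontP => v; have FF : Filter (nbhs (v : 'rV[R]_n)) := nbhs_filter v; apply: cvgM; [exact: cf|exact: cg].
Qed.

Lemma tcontN n (f : n.-tuple R -> R) : tcont f -> tcont (fun t => - f t).
Proof. by move=> /tcontP cf; apply/tcontP => v; have FF : Filter (nbhs (v : 'rV[R]_n)) := nbhs_filter v; apply: cvgN; exact: cf. Qed.

Lemma tcont_sum n (I : Type) (r : seq I) (f : I -> n.-tuple R -> R) :
  (forall i, tcont (f i)) -> tcont (fun t => \sum_(i <- r) f i t).
Proof.
move=> cf; elim: r => [|i r IH].
  by under [X in tcont X]funext do rewrite big_nil; exact: tcont_cst.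
by under [X in tcont X]funext do rewrite big_cons; exact: tcontD.
Qed.

Lemma tcont_tupd n (g : n.-tuple R -> R) t i : tcont g -> continuous (fun s : R => g (tupd t i s)).
Proof.
move=> cg s; apply/cvgrPdist_lt => e e0; have [d d0 hd] := cg (tupd t i s) e e0.
apply/nbhs_ballP; exists d => //= s' ss'; apply: hd => j; rewrite !tnth_tupd.
by case: ifP => // _; rewrite subrr normr0.
Qed.

Lemma tcont_box_bounded n (f : n.-tuple R -> R) (r : R) : tcont f ->
  exists M, forall t, (forall i, `|tnth t i| <= r) -> `|f t| <= M.
Proof.
move=> /tcontP cf.
pose K : set 'rV[R]_n := [set v : 'rV[R]_n | forall i, `[- r, r]%classic (v ord0 i)].
pose g (v : 'rV[R]_n) : R := f (tuple_of_rV v).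
have /(@compact_bounded _ _ _) [M0 [_ hM0]] : compact (g @` K).
  apply: continuous_compact; first exact: continuous_subspaceT.
  by apply: (@rV_compact _ n (fun _ => `[- r, r]%classic)) => i; exact: segment_compact.
exists (`|M0| + 1) => t ht; apply: (hM0 (`|M0| + 1)); first by rewrite ltr_pwDr// ler_norm.
exists (\row_i tnth t i).
  by move=> i; rewrite /= mxE in_itv/= -ler_norml.
by rewrite /g; congr f; apply: eq_from_tnth => i; rewrite tnth_mktuple mxE.
Qed.

Lemma tcont_supp_bmeas n (f : n.-tuple R -> R) (r : R) : tcont f ->
  (forall t i, r < `|tnth t i| -> f t = 0) -> bmeas (f : n.-tuple mR -> R).
Proof.
move=> cf supp; split; first exact: tcont_measurable.
have [M hM] := tcont_box_bounded r cf.
exists `|M| => t; have [/hM h|] := pselect (forall i, `|tnth t i| <= r).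
  exact: (le_trans h (ler_norm _)).
by move=> /existsNP[i /negP]; rewrite -ltNge => /supp ->; rewrite normr0.
Qed.

(** Used where differentiation rules do not reach: at the kink of [Num.max 0], and for power series,
    whose remainder is estimated term by term. *)
Lemma is_derive_taylor1 (f : R -> R) (x l C d : R) : 0 < d ->
  (forall h, `|h| <= d -> `|f (x + h) - f x - l * h| <= C * h ^+ 2) -> is_derive x 1 f l.
Proof.
move=> d0 H.
have C0 : 0 <= C.
  have := H d; rewrite gtr0_norm// lexx => /(_ isT) h.
  by rewrite -(pmulr_lge0 C (exprn_gt0 2 d0)); exact: le_trans (normr_ge0 _) h.
have cv : h^-1 *: ((f \o shift x) (h *: (1 : R)) - f x) @[h --> (0 : R)^'] --> (l : R).
  apply/cvgrPdist_le => e e0; near=> h.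
  have h0 : h != 0 by near: h; exact: nbhs_dnbhs_neq.
  have hs : `|h| <= Num.min d (e / (C + 1)).
    near: h; apply: dnbhs0_le; rewrite lt_min d0/= divr_gt0// ltr_wpDl//.
  move: hs; rewrite le_min => /andP[h1 he].
  have {}H := H h h1.
  have n0 : 0 < `|h| by rewrite normr_gt0.
  rewrite /= /shift [h *: 1]mulr1 [h + x]addrC /GRing.scale/=.
  rewrite -(ler_pM2r n0) -normrM mulrBl -mulrAC mulVf// mul1r distrC (le_trans H)//.
  rewrite -real_normK ?num_real// expr2 mulrA ler_pM2r//.
  rewrite (@le_trans _ _ (C * (e / (C + 1))))// ?ler_wpM2l//.
  by rewrite mulrCA ger_pMr// ler_pdivrMr ?mul1r ?lerDl// ltr_wpDl.
apply: DeriveDef; first by apply/cvg_ex; exists l.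
by apply: cvg_lim cv.
Unshelve. all: end_near. Qed.

(** The square is the first power differentiable at the kink; each higher one is [s] times its
    predecessor. *)
Lemma is_derive_max0X k (x : R) : is_derive x 1 (fun s : R => Num.max 0 s ^+ k.+2)
  (k.+2%:R * Num.max 0 x ^+ k.+1).
Proof.
elim: k => [|k IH].
  apply: (@is_derive_taylor1 _ _ _ 1 1) => // h _; rewrite expr1 mul1r ler_norml.
  by have [x0|x0] := leP 0 x; have [y0|y0] := leP 0 (x + h); apply/andP; split; nra.
have E : (fun s : R => Num.max 0 s ^+ k.+3) = (fun s : R => s * Num.max 0 s ^+ k.+2).
  apply/funext => s; rewrite exprS; have [//|_] := leP 0 s.
  by rewrite exprS !mul0r mulr0.
rewrite E; apply: is_derive_eq; rewrite /GRing.scale/=.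
rewrite mulr1 mulrCA (_ : x * Num.max 0 x ^+ k.+1 = Num.max 0 x ^+ k.+2); last first.
  by rewrite [RHS]exprS; have [//|_] := leP 0 x; rewrite exprS !mul0r mulr0.
by rewrite -[k.+3%:R]natr1; ring.
Qed.


Definition sqn n (t : n.-tuple R) : R := \sum_(i < n) tnth t i ^+ 2.

Definition kap n (w : R) (k : nat) (t : n.-tuple R) : R := Num.max 0 (w - sqn t) ^+ k.

Lemma tcont_sqn n : tcont (@sqn n).
Proof.
apply: tcont_sum => i; apply: (@tcont_comp _ (fun x => x ^+ 2)); last exact: tcont_tnth.
exact: exprn_continuous.
Qed.

Lemma continuous_max0X k : continuous (fun x : R => Num.max 0 x ^+ k).
Proof.
move=> x; apply: (@continuous_comp _ _ _ (fun y : R => Num.max 0 y) (fun y : R => y ^+ k));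
  last exact: exprn_continuous.
by apply: continuous_max; [exact: cvg_cst|exact: cvg_id].
Qed.

Lemma tcont_kap n (w : R) k : tcont (@kap n w k).
Proof.
apply: (@tcont_comp _ _ (fun t => w - sqn t) (@continuous_max0X k)).
by apply: tcontD; [exact: tcont_cst|apply/tcontN/tcont_sqn].
Qed.

(** Cancels the Gaussian density up to a constant, so that integration by parts can take place
    against Lebesgue measure. *)
Definition gweight n (t : n.-tuple R) : R := expR (sqn t / 2).

Lemma tcont_gweight n : tcont (@gweight n).
Proof.
apply: (@tcont_comp _ _ _ (@continuous_expR R)).
by apply: tcontM; [exact: tcont_sqn|exact: tcont_cst].
Qed.

Lemma sqn_ge0 n (t : n.-tuple R) : 0 <= sqn t.
Proof. by apply: sumr_ge0 => i _; exact: sqr_ge0. Qed.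

Lemma sqn_ge n (t : n.-tuple R) i : tnth t i ^+ 2 <= sqn t.
Proof. by rewrite /sqn (bigD1 i)//= lerDl sumr_ge0// => j _; exact: sqr_ge0. Qed.

Lemma kap_ge0 n (w : R) k (t : n.-tuple R) : 0 <= kap w k t.
Proof. by rewrite exprn_ge0// le_max lexx. Qed.

Lemma kap_eq0 n (w : R) k (t : n.-tuple R) : w <= sqn t -> kap w k.+1 t = 0.
Proof. by move=> h; rewrite /kap max_l ?expr0n// subr_le0. Qed.

(** Trades a factor [|x| ^ 2] for a shift of the index, which closes the recursion among the
    kernels. A positive exponent is needed for the kernel to vanish outside the ball. *)
Lemma sqn_kap n (w : R) k (t : n.-tuple R) : sqn t * kap w k.+1 t = w * kap w k.+1 t - kap w k.+2 t.
Proof.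
rewrite /kap; have [h|h] := leP 0 (w - sqn t); first by rewrite (exprS _ k.+1); ring.
by rewrite !expr0n/= !mulr0 subr0.
Qed.

Lemma sqn_tupd n (t : n.-tuple R) i s :
  sqn (tupd t i s) = s ^+ 2 + (\sum_(j < n | j != i) tnth t j ^+ 2).
Proof.
rewrite /sqn (bigD1 i)//= tnth_tupd eqxx; congr (_ + _).
by apply: eq_bigr => j /negbTE ji; rewrite tnth_tupd ji.
Qed.

Lemma is_derive_kap n (w : R) k (t : n.-tuple R) i (s : R) :
  is_derive s 1 (fun s : R => kap w k.+2 (tupd t i s))
    (- (2 * k.+2%:R) * s * kap w k.+1 (tupd t i s)).
Proof.
set c := \sum_(j < n | j != i) tnth t j ^+ 2.
have -> : (fun s : R => kap w k.+2 (tupd t i s)) =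
    (fun y : R => Num.max 0 y ^+ k.+2) \o (fun s : R => w - (s ^+ 2 + c)).
  by apply/funext => y /=; rewrite /kap sqn_tupd.
have d1 := is_derive_max0X k (w - (s ^+ 2 + c)).
apply: is_derive_eq; rewrite /GRing.scale/= /kap sqn_tupd -/c.
ring.
Qed.

Lemma mean_sum d (T : measurableType d) (P : probability T R) (I : Type) (r : seq I)
    (g : I -> T -> R) : (forall i, bmeas (g i)) ->
  bmeas (fun t => \sum_(i <- r) g i t) /\
  \int[P]_t (\sum_(i <- r) g i t) = \sum_(i <- r) \int[P]_t g i t.
Proof.
move=> bg; elim: r => [|i r [IH1 IH2]].
  rewrite big_nil; under [X in bmeas X]funext do rewrite big_nil.
  split; first exact: bmeas_cst.
  by under eq_Rintegral do rewrite big_nil; rewrite mean_cst.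
rewrite big_cons -IH2 -meanD//; under [X in bmeas X]funext do rewrite big_cons.
split; first exact: bmeasD.
by apply: eq_Rintegral => t _; rewrite big_cons.
Qed.

(** * Integration by parts against the kernels *)

Section kernel.
Context {n : nat}.
Variables (u : n.-tuple R -> R) (A B : 'I_n -> n.-tuple R -> R).
Hypotheses (cu : tcont u) (cB : forall i, tcont (B i)).
Hypotheses
  (dA : forall i t (s : R), is_derive s 1 (fun s : R => u (tupd t i s)) (A i (tupd t i s)))
  (dB : forall i t (s : R), is_derive s 1 (fun s : R => A i (tupd t i s)) (B i (tupd t i s))).

Lemma bmeas_kernel (f : n.-tuple R -> R) (w : R) k : tcont f ->
  bmeas (fun t : n.-tuple mR => f t * kap w k.+1 t * gweight t).
Proof.
move=> cf; apply: (@tcont_supp_bmeas _ _ (`|w| + 1)).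
  by do 2 (apply: tcontM; last by [exact: tcont_gweight|exact: tcont_kap]).
move=> t i h; rewrite kap_eq0 ?mulr0 ?mul0r//.
apply: le_trans (sqn_ge t i); rewrite -real_normK ?num_real//.
have := ler_norm w; have := normr_ge0 w; move: (`|w|) (`|tnth t i|) h => a b; nra.
Qed.

(* Along each axis [u * H'' - u'' * H], with [H := kap w k.+3], is the derivative of the
   compactly supported [u * H' - u' * H], hence has integral zero. *)
Lemma kernel_identity (w : R) k :
  2 * k.+2%:R * w * (\int[gauss_tuple n]_t (u t * kap w k.+1 t * gweight t)) -
  (n%:R + 2 * k.+2%:R) * (\int[gauss_tuple n]_t (u t * kap w k.+2 t * gweight t)) =
  (2 * k.+3%:R)^-1 * \int[gauss_tuple n]_t ((\sum_(i < n) B i t) * kap w k.+3 t * gweight t).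
Proof.
pose N : R := k.+3%:R.
(* The parenthesis is the second derivative of [kap w k.+3] along axis [i]. *)
pose f i (t : n.-tuple R) : R := u t * (- (2 * N) * kap w k.+2 t +
  (4 * N * k.+2%:R) * (tnth t i ^+ 2 * kap w k.+1 t)) - B i t * kap w k.+3 t.
have cf i : tcont (f i).
  apply: tcontD; last by apply/tcontN/tcontM => //; exact: tcont_kap.
  apply: tcontM => //; apply: tcontD; first by apply: tcontM; [exact: tcont_cst|exact: tcont_kap].
  apply: tcontM; first exact: tcont_cst.
  apply: tcontM; last exact: tcont_kap.
  by apply: (@tcont_comp _ (fun x => x ^+ 2)); [exact: exprn_continuous|exact: tcont_tnth].
have f0 i t : w <= sqn t -> f i t = 0.
  by move=> h; rewrite /f !kap_eq0//; ring.
have wL (s : R) : `|w| + 1 <= `|s| -> w <= s ^+ 2.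
  rewrite -[s ^+ 2]real_normK ?num_real// => h.
  by have := ler_norm w; have := normr_ge0 w; move: (`|w|) (`|s|) h => a b; nra.
have zero i : \int[gauss_tuple n]_t (f i t * gweight t) = 0.
  apply: (mean_slice0 (i := i)).
    apply: (@tcont_supp_bmeas _ _ (`|w| + 1)); first by apply: tcontM => //; exact: tcont_gweight.
    move=> t j /ltW/wL h; rewrite f0 ?mul0r//; exact: le_trans (sqn_ge t j).
  move=> t.
  pose c := \sum_(j < n | j != i) tnth t j ^+ 2.
  pose C := expR (c / 2).
  have c0 : 0 <= c by apply: sumr_ge0 => j _; exact: sqr_ge0.
  have wc (s : R) : `|w| + 1 <= `|s| -> w <= sqn (tupd t i s).
    by move=> /wL h; rewrite sqn_tupd -/c; apply: (le_trans h); rewrite lerDl.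
  rewrite -[RHS](@mean_gauss_derive0 (fun s => C *
      (u (tupd t i s) * (- (2 * N) * s * kap w k.+2 (tupd t i s)) -
       A i (tupd t i s) * kap w k.+3 (tupd t i s))) (fun s => C * f i (tupd t i s)) (`|w| + 1)).
  - apply: eq_Rintegral => s _; rewrite [gweight _](_ : _ = C * expR (s ^+ 2 / 2)); last first.
      by rewrite /gweight sqn_tupd -/c mulrDl expRD mulrC.
    by rewrite mulrCA mulrA.
  - by rewrite ltr_pwDr.
  - move=> s.
    have d1 := dA i t s; have d2 := dB i t s.
    have d3 := is_derive_kap w k t i s; have d4 := is_derive_kap w k.+1 t i s.
    apply: is_derive_eq; rewrite /GRing.scale/= /f tnth_tupd eqxx -/N.
    ring.
  - move=> s; apply: cvgM; [exact: cvg_cst|exact: (tcont_tupd (cf i))].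
  - by move=> s /wc h; rewrite f0// !kap_eq0// !mulr0 subrr mulr0.
have bS : tcont (fun t => \sum_(i < n) B i t) by exact: tcont_sum.
have b1 := bmeas_kernel w k cu; have b2 := bmeas_kernel w k.+1 cu; have b3 := bmeas_kernel w k.+2 bS.
have bf i : bmeas (fun t : n.-tuple mR => f i t * gweight t).
  apply: (@tcont_supp_bmeas _ _ (`|w| + 1)); first by apply: tcontM => //; exact: tcont_gweight.
  move=> t j /ltW/wL h; rewrite f0 ?mul0r//; exact: le_trans (sqn_ge t j).
have [_] := mean_sum (gauss_tuple n) (index_enum 'I_n) bf.
rewrite [X in _ = X]big1//.
set c1 := 2 * k.+2%:R * w; set c2 := n%:R + 2 * k.+2%:R.
(* Summed over [i], and with [sqn_kap] removing [|x| ^ 2], the Laplacian of [kap w k.+3] is [2 * N]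
   times [c1' * kap w k.+1 - c2 * kap w k.+2], where [c1' = c1]. *)
have -> : (fun t : n.-tuple mR => \sum_(i < n) f i t * gweight t) = fun t =>
   ((2 * N * c1) * (u t * kap w k.+1 t * gweight t) - (2 * N * c2) * (u t * kap w k.+2 t * gweight t)) -
   (\sum_(i < n) B i t) * kap w k.+3 t * gweight t.
  apply/funext => t; rewrite -mulr_suml /f big_split/= -mulr_sumr big_split/= sumr_const card_ord.
  rewrite sumrN -mulr_suml -mulr_sumr -mulr_suml -/(sqn t) sqn_kap -mulr_natl /c1 /c2.
  by ring.
have bz (c : R) (f' : n.-tuple mR -> R) : bmeas f' -> bmeas (fun t : n.-tuple mR => c * f' t).
  by move=> bf'; apply: bmeasM => //; exact: bmeas_cst.
rewrite meanB//; last by apply: bmeasB; exact: bz.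
rewrite meanB//; [|exact: bz|exact: bz].
rewrite !meanZ// => /eqP; rewrite subr_eq0 => /eqP <-.
have N0 : N != 0 by rewrite pnatr_eq0.
by field.
Qed.
End kernel.

Definition kmean n (u : n.-tuple R -> R) w k : R :=
  \int[gauss_tuple n]_t (u t * kap w k.+1 t * gweight t).

Lemma kmean1S n w k : (n%:R + 2 * k.+2%:R) * @kmean n (fun _ => 1) w k.+1 =
  2 * k.+2%:R * w * @kmean n (fun _ => 1) w k.
Proof.
have d0 (s : R) : is_derive s 1 (fun _ : R => 0 : R) 0 by exact: is_derive_cst.
have d1 (s : R) : is_derive s 1 (fun _ : R => 1 : R) 0 by exact: is_derive_cst.
have := @kernel_identity n (fun _ => 1) (fun _ _ => 0) (fun _ _ => 0) (tcont_cst _)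
  (fun _ => tcont_cst _) (fun _ _ => d1) (fun _ _ => d0) w k.
rewrite (_ : (fun t : n.-tuple mR => _ * kap w k.+3 t * _) = fun _ => 0); last first.
  by apply/funext => t; rewrite big1// !mul0r.
by rewrite mean_cst mulr0 => /eqP; rewrite subr_eq0 => /eqP.
Qed.

Lemma kmean1_ge0 n w k : 0 <= @kmean n (fun _ => 1) w k.
Proof.
apply: mean_ge => [|t]; first exact/bmeas_kernel/tcont_cst.
by rewrite mul1r mulr_ge0 ?kap_ge0 ?expR_ge0.
Qed.

Lemma bernoulli_ineq (x : R) k : 0 <= x <= 1 -> 1 - k%:R * x <= (1 - x) ^+ k.
Proof.
move=> /andP[x0 x1]; elim: k => [|k IH]; first by rewrite mul0r subr0 expr0.
rewrite exprS (@le_trans _ _ ((1 - x) * (1 - k%:R * x)))//; last first.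
  by rewrite ler_wpM2l// subr_ge0.
rewrite -natr1; have : 0 <= k%:R :> R by exact: ler0n.
by move: (k%:R) => y y0; nra.
Qed.

Definition bump n k (t : n.-tuple R) : R :=
  kap (2 * k.+1%:R) k.+1 t * gweight t / (2 * k.+1%:R) ^+ k.+1.

(** This form explains the choice [w = 2 * k.+1]: each factor is at most 1 and at least
    [1 - y ^+ 2], with no linear term in [y], so that the product tends to 1 pointwise. Bernoulli's
    inequality makes this explicit in [bump_ge]. *)
Lemma bumpE n k (t : n.-tuple R) (y := sqn t / (2 * k.+1%:R)) :
  bump k t = (Num.max 0 (1 - y) * expR y) ^+ k.+1.
Proof.
have K0 : 0 < k.+1%:R :> R by rewrite ltr0n.
have w0 : 0 < 2 * k.+1%:R :> R by rewrite mulr_gt0.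
rewrite /bump /kap [RHS]exprMn -[in RHS]expRM_natl mulrAC -exprVn -exprMn; congr (_ ^+ _ * expR _);
  last by rewrite /y; field; rewrite gt_eqF.
rewrite maxr_pMl ?invr_ge0 ?(ltW w0)// mul0r; congr Num.max.
by rewrite mulrBl mulfV ?gt_eqF.
Qed.

Lemma bump_ge0 n k (t : n.-tuple R) : 0 <= bump k t.
Proof. by rewrite bumpE exprn_ge0// mulr_ge0 ?expR_ge0// le_max lexx. Qed.

Lemma bump_le1 n k (t : n.-tuple R) : bump k t <= 1.
Proof.
rewrite bumpE; set y := _ / _; rewrite exprn_ile1// ?mulr_ge0 ?expR_ge0 ?le_max ?lexx//.
have [h|h] := leP 0 (1 - y); last by rewrite mul0r.
rewrite -ler_pdivlMr ?expR_gt0// div1r -expRN.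
by have := expR_ge1Dx (- y).
Qed.

Lemma bump_ge n k (t : n.-tuple R) :
  Num.max 0 (1 - sqn t ^+ 2 / (4 * k.+1%:R)) <= bump k t.
Proof.
have K0 : 0 < k.+1%:R :> R by rewrite ltr0n.
rewrite ge_max bump_ge0/=.
have K1 : 1 <= k.+1%:R :> R by rewrite ler1n.
rewrite bumpE; set y := sqn t / (2 * _).
have y0 : 0 <= y by rewrite divr_ge0 ?sqn_ge0// mulr_ge0// ltW.
have -> : sqn t ^+ 2 / (4 * k.+1%:R) = k.+1%:R * y ^+ 2.
  by rewrite /y; field; rewrite gt_eqF.
have [h|h] := leP 0 (1 - y); last first.
  by rewrite mul0r expr0n/=; move: (k.+1%:R) K1 h y0 => K; nra.
have yy : 0 <= y ^+ 2 <= 1 by rewrite sqr_ge0/= expr_le1//; lra.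
apply: (le_trans (bernoulli_ineq k.+1 yy)).
have y2 : 0 <= 1 - y ^+ 2 by rewrite subr_ge0; case/andP: yy.
rewrite lerXn2r ?nnegrE ?mulr_ge0 ?expR_ge0//.
rewrite (_ : 1 - y ^+ 2 = (1 - y) * (1 + y)); last by ring.
by rewrite ler_wpM2l// expR_ge1Dx.
Qed.

Section submean.
Context {n : nat}.
Variables (u : n.-tuple R -> R) (A B : 'I_n -> n.-tuple R -> R).
Hypotheses (cu : tcont u) (cB : forall i, tcont (B i)).
Hypotheses
  (dA : forall i t (s : R), is_derive s 1 (fun s : R => u (tupd t i s)) (A i (tupd t i s)))
  (dB : forall i t (s : R), is_derive s 1 (fun s : R => A i (tupd t i s)) (B i (tupd t i s))).
Hypotheses (u0 : forall t, 0 <= u t) (sub : forall t, 0 <= \sum_(i < n) B i t).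

Lemma kmeanS_le w k : (n%:R + 2 * k.+2%:R) * kmean u w k.+1 <= 2 * k.+2%:R * w * kmean u w k.
Proof.
rewrite -subr_ge0 kernel_identity// mulr_ge0 ?invr_ge0 ?mulr_ge0 ?ler0n//.
apply: mean_ge => [|t]; first by apply: bmeas_kernel; exact: tcont_sum.
by apply: mulr_ge0; rewrite ?expR_ge0// mulr_ge0 ?kap_ge0.
Qed.

(* [kmeanS_le] is an equality for [u = 1], so a lower bound on [kmean u w K] relative to
   that of the constant function passes to all smaller indices. *)
Lemma kmean_descend c w k K : 0 < w -> (k <= K)%N ->
  c * @kmean n (fun _ => 1) w K <= kmean u w K -> c * @kmean n (fun _ => 1) w k <= kmean u w k.
Proof.
move=> w0; elim: K => [|K IH]; first by rewrite leqn0 => /eqP ->.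
rewrite leq_eqVlt => /orP[/eqP ->//|kK] h; apply: IH => //.
have p0 : 0 < 2 * K.+2%:R * w :> R by rewrite !mulr_gt0// ltr0n.
rewrite -(ler_pM2l p0) mulrCA -kmean1S (le_trans _ (kmeanS_le w K))//.
by rewrite mulrCA ler_wpM2l// addr_ge0// mulr_ge0.
Qed.

Let tz : n.-tuple R := [tuple 0 | i < n].

(* By continuity [u] is above a downward paraboloid with apex near [u tz]; the mass of
   [kap w k.+1] concentrates at the origin as [k] grows. *)
Lemma kmean_chebyshev w e : 0 < w -> 0 < e ->
  exists k0, forall k, (k0 <= k)%N -> (u tz - e) * @kmean n (fun _ => 1) w k <= kmean u w k.
Proof.
move=> w0 e0; have e20 : 0 < e / 2 by rewrite divr_gt0.
have [d d0 hd] := cu tz e20.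
(* Steep enough that the paraboloid is negative outside the box of half-width [d], where only
   [u >= 0] is known. *)
pose Q := u tz / d ^+ 2.
have Q0 : 0 <= Q by rewrite divr_ge0 ?sqr_ge0.
have low t : u tz - e / 2 - Q * sqn t <= u t.
  have [ht|] := pselect (forall i, `|tnth t i| < d).
    have /hd : forall i, `|tnth tz i - tnth t i| < d.
      by move=> i; rewrite tnth_mktuple sub0r normrN.
    rewrite ltr_distlC => /andP[h _]; have := mulr_ge0 Q0 (sqn_ge0 t); lra.
  move=> /existsNP[i /negP]; rewrite -leNgt => hi.
  have : Q * d ^+ 2 <= Q * sqn t.
    apply: ler_wpM2l => //; apply: le_trans (sqn_ge t i).
    by rewrite -[leRHS]real_normK ?num_real// ler_pXn2r// nnegrE ltW.
  rewrite /Q divfK ?gt_eqF ?exprn_gt0// => h; have := u0 t; lra.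
exists (Num.bound (Q * w * n%:R / e)) => k hk.
have bk := bmeas_kernel w k (tcont_cst 1 : tcont (fun _ : n.-tuple R => 1)).
have bk1 := bmeas_kernel w k.+1 (tcont_cst 1 : tcont (fun _ : n.-tuple R => 1)).
set J := @kmean n (fun _ => 1).
have step : (u tz - e / 2) * J w k - Q * (w * J w k - J w k.+1) <= kmean u w k.
  have bz (c : R) (f' : n.-tuple mR -> R) : bmeas f' -> bmeas (fun t : n.-tuple mR => c * f' t).
    by move=> bf'; apply: bmeasM => //; exact: bmeas_cst.
  have b1 := bz w _ bk; have b2 := bmeasB b1 bk1.
  have b3 := bz (u tz - e / 2) _ bk; have b4 := bz Q _ b2.
  rewrite /J /kmean -(meanZ _ w bk) -(meanB _ b1 bk1) -(meanZ _ Q b2) -(meanZ _ (u tz - e / 2) bk).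
  rewrite -(meanB _ b3 b4); apply: le_mean.
  - exact: bmeasB.
  - exact: bmeas_kernel.
  - move=> t; rewrite !mul1r [leLHS](_ : _ =
      (u tz - e / 2 - Q * sqn t) * kap w k.+1 t * gweight t).
      by rewrite -mulrA -[leRHS]mulrA ler_wpM2r// mulr_ge0 ?kap_ge0 ?expR_ge0.
    have := sqn_kap w k t; rewrite !mulrBl => h.
    rewrite -(mulrA Q) h; ring.
apply: le_trans step.
have J0 : 0 <= J w k := kmean1_ge0 n w k.
have := kmean1S n w k; rewrite -/J => JE.
have N0 : 0 < n%:R + 2 * k.+2%:R :> R by rewrite ltr_wpDl// mulr_gt0// ltr0n.
(* The left side is the second moment of the kernel; relative to the mass it is of order [1 / k]. *)
have -> : w * J w k - J w k.+1 = w * J w k * n%:R / (n%:R + 2 * k.+2%:R).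
  apply/(canRL (mulfK (lt0r_neq0 N0))).
  by rewrite mulrBl [J w k.+1 * _]mulrC JE; ring.
have hQ : Q * w * n%:R <= e / 2 * (n%:R + 2 * k.+2%:R).
  have b0 : 0 <= Q * w * n%:R / e by exact: divr_ge0 (mulr_ge0 (mulr_ge0 Q0 (ltW w0)) (ler0n _ _)) (ltW e0).
  have := archi_boundP b0; rewrite ltr_pdivrMr// => /ltW h1; apply: (le_trans h1).
  have hk' : (Num.bound (Q * w * n%:R / e))%:R <= k.+2%:R :> R by rewrite ler_nat (leq_trans hk)// ltnW.
  have n0 : 0 <= n%:R :> R := ler0n _ _.
  have := ler_wpM2r (ltW e0) hk'; have := mulr_ge0 (ltW e0) n0.
  move=> h2 h3; apply: (le_trans h3).
  rewrite [leRHS](_ : _ = e * n%:R / 2 + k.+2%:R * e); last by field.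
  by rewrite lerDr divr_ge0.
rewrite -subr_ge0.
have -> : (u tz - e / 2) * J w k - Q * (w * J w k * n%:R / (n%:R + 2 * k.+2%:R)) - (u tz - e) * J w k
  = (e / 2 - Q * w * n%:R / (n%:R + 2 * k.+2%:R)) * J w k.
  by field; rewrite gt_eqF.
by rewrite mulr_ge0// subr_ge0 ler_pdivrMr.
Qed.

(** The bound with an error holds at some index beyond [k]; descending to [k] does not enlarge the
    error, which can therefore be sent to 0 with [k] fixed. *)
Lemma kmean_submean w k : 0 < w -> u tz * @kmean n (fun _ => 1) w k <= kmean u w k.
Proof.
move=> w0; have J0 := kmean1_ge0 n w k; set J := kmean _ w k in J0 *.
apply/ler_addgt0Pr => e e0.
have e1 : 0 < e / (J + 1) by rewrite divr_gt0// ltr_wpDl.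
have [k0 hk] := kmean_chebyshev w0 e1.
have := kmean_descend w0 (leq_maxl k k0) (hk _ (leq_maxr k k0)).
rewrite -/J mulrBl lerBlDr => h; apply: (le_trans h); rewrite lerD2l.
have J1 : 0 < J + 1 by rewrite ltr_wpDl.
by rewrite mulrAC ler_pdivrMr// (ler_pM2l e0) lerDl.
Qed.

(** As [bump] is a multiple of a kernel and at most 1, [kmean_submean] bounds the mean of
    [u tz * bump k] by that of [u]. Its explicit minorant [g k] increases with [k], so monotone
    convergence concludes. *)
Lemma gauss_submean : ((u tz)%:E <= \int[gauss_tuple n]_t (u t)%:E)%E.
Proof.
have muu : measurable_fun setT (u : n.-tuple mR -> R) by exact: tcont_measurable.
pose g k (t : n.-tuple mR) : R := u tz * Num.max 0 (1 - sqn t ^+ 2 / (4 * k.+1%:R)).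
have cg k : tcont (g k).
  apply: tcontM; first exact: tcont_cst.
  apply: (@tcont_comp _ (fun x => Num.max 0 (1 - x / (4 * k.+1%:R))) (fun t => sqn t ^+ 2)).
    move=> x; apply: (@continuous_comp _ _ _ (fun x : R => 1 - x / (4 * k.+1%:R))
      (fun y : R => Num.max 0 y)); last exact: (@continuous_max0X 1).
    by apply: cvgB; [exact: cvg_cst|apply: cvgMl; exact: cvg_id].
  by apply: (@tcont_comp _ (fun x => x ^+ 2)); [exact: exprn_continuous|exact: tcont_sqn].
have g0 k t : 0 <= g k t by rewrite mulr_ge0// le_max lexx.
have bc : bmeas (fun _ : n.-tuple mR => u tz) by exact: bmeas_cst.
rewrite -(mean_cst (gauss_tuple n) (u tz)) (EFin_mean _ bc).
apply: (@ge0_integral_sup_le _ _ R (gauss_tuple n) (fun _ => u tz) g) => //.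
- by move=> k; exact: tcont_measurable.
- move=> k t; rewrite ler_wpM2l// ge_max le_max lexx/=.
  rewrite le_max; apply/orP; right; rewrite lerB// ler_wpM2l ?sqr_ge0//.
  by rewrite lef_pV2 ?posrE ?mulr_gt0 ?ltr0n// ler_pM2l// ler_nat.
- move=> t e e0.
  pose k := Num.bound (u tz * sqn t ^+ 2 / e); exists k.
  have : u tz * (1 - sqn t ^+ 2 / (4 * k.+1%:R)) <= g k t.
    by rewrite /g ler_wpM2l// le_max lexx orbT.
  apply: le_trans; rewrite mulrBr mulr1 lerD2l lerN2 mulrA ler_pdivrMr ?mulr_gt0 ?ltr0n//.
  have b0 : 0 <= u tz * sqn t ^+ 2 / e.
    by apply: divr_ge0; [apply: mulr_ge0 => //; exact: sqr_ge0|exact: ltW].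
  have := archi_boundP b0; rewrite -/k ltr_pdivrMr// => /ltW h; apply: (le_trans h).
  by rewrite mulrC ler_pM2l// -natrM ler_nat (leq_trans (leqnSn k))// leq_pmull.
- move=> k.
  have w0 : 0 < 2 * k.+1%:R :> R by rewrite mulr_gt0 ?ltr0n.
  have wX : 0 < ((2 * k.+1%:R) ^+ k.+1)^-1 :> R by rewrite invr_gt0 exprn_gt0.
  have cb : tcont (@bump n k).
    apply: tcontM; last exact: tcont_cst.
    by apply: tcontM; [exact: tcont_kap|exact: tcont_gweight].
  have bk := bmeas_kernel (2 * k.+1%:R) k (tcont_cst 1 : tcont (fun _ : n.-tuple R => 1)).
  have bku := bmeas_kernel (2 * k.+1%:R) k cu.
  have bb : bmeas (@bump n k : n.-tuple mR -> R).
    split; first exact: tcont_measurable.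
    by exists 1 => t; rewrite ger0_norm ?bump_ge0// bump_le1.
  have bub : bmeas (fun t : n.-tuple mR => u t * bump k t).
    rewrite (_ : (fun _ => _) = fun t : n.-tuple mR => ((2 * k.+1%:R) ^+ k.+1)^-1 *
      (u t * kap (2 * k.+1%:R) k.+1 t * gweight t)); last first.
      by apply/funext => t; rewrite /bump; ring.
    by apply: bmeasM => //; exact: bmeas_cst.
  have bcb : bmeas (fun t : n.-tuple mR => u tz * bump k t).
    by apply: bmeasM => //; exact: bmeas_cst.
  have bg : bmeas (g k).
    split; first exact: tcont_measurable.
    exists (u tz) => t; rewrite ger0_norm// -[leRHS]mulr1 ler_wpM2l//.
    exact: le_trans (bump_ge k t) (bump_le1 k t).
  apply: (@le_trans _ _ (\int[gauss_tuple n]_t (u tz * bump k t))%:E).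
    rewrite -EFin_mean// lee_fin; apply: le_mean => // t.
    by rewrite ler_wpM2l// bump_ge.
  apply: (@le_trans _ _ (\int[gauss_tuple n]_t (u t * bump k t))%:E).
    have := kmean_submean k w0; rewrite -(ler_pM2l wX) mulrCA.
    rewrite /kmean -(meanZ _ _ bk) -(meanZ _ _ bku) lee_fin (meanZ _ _ bb) => h.
    apply: le_trans (le_trans h _); rewrite le_eqVlt; apply/orP; left; apply/eqP.
      by congr (_ * _); apply: eq_Rintegral => t _; rewrite /bump; ring.
    by apply: eq_Rintegral => t _; rewrite /bump; ring.
  rewrite EFin_mean//; apply: ge0_le_integral => //.
  - by move=> t _; rewrite lee_fin mulr_ge0// bump_ge0.
  - by apply/measurable_EFinP; case: bub.
  - exact/measurable_EFinP.
  - by move=> t _; rewrite lee_fin ler_piMr// bump_le1.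
Qed.

End submean.

Lemma tcont_comb n (g : n.-tuple R -> R) (a b : R) (x : n.-tuple R) :
  tcont g -> tcont (fun y => g (comb a b x y)).
Proof.
move=> cg t e e0; have [d d0 hd] := cg (comb a b x t) e e0.
have b1 : 0 < `|b| + 1 by rewrite ltr_wpDl.
exists (d / (`|b| + 1)); first by rewrite divr_gt0.
move=> t' h; apply: hd => i; rewrite !tnth_mktuple opprD addrACA subrr add0r -mulrBr normrM.
apply: (@le_lt_trans _ _ ((`|b| + 1) * `|tnth t i - tnth t' i|)); first by rewrite ler_wpM2r// lerDl.
by rewrite mulrC -ltr_pdivlMr.
Qed.

Lemma comb_tupd n (a b : R) (x t : n.-tuple R) i s :
  comb a b x (tupd t i s) = tupd (comb a b x t) i (a * tnth x i + b * s).
Proof.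
apply: eq_from_tnth => j; rewrite !(tnth_mktuple, tnth_tupd).
by case: eqP => // ->.
Qed.

Lemma gauss_submean_comb n (u : n.-tuple R -> R) (A B : 'I_n -> n.-tuple R -> R) (a b c : R) :
  tcont u -> (forall i, tcont (B i)) ->
  (forall i t (s : R), is_derive s 1 (fun s : R => u (tupd t i s)) (A i (tupd t i s))) ->
  (forall i t (s : R), is_derive s 1 (fun s : R => A i (tupd t i s)) (B i (tupd t i s))) ->
  (forall t, c <= u t) -> (forall t, 0 <= \sum_(i < n) B i t) ->
  forall x, ((u (tscale a x) - c)%:E <= \int[gauss_tuple n]_y (u (comb a b x y) - c)%:E)%E.
Proof.
move=> cu cB dA dB cu0 subB x.
have -> : tscale a x = comb a b x [tuple 0 | i < n].
  by apply: eq_from_tnth => i; rewrite !tnth_mktuple mulr0 addr0.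
have dlin (g g' : n.-tuple R -> R) i t (s k d : R) :
    (forall t (s : R), is_derive s 1 (fun s : R => g (tupd t i s)) (g' (tupd t i s))) ->
    is_derive s 1 (fun s : R => k * g (comb a b x (tupd t i s)) - d)
      (k * (b * g' (comb a b x (tupd t i s)))).
  move=> dg; rewrite comb_tupd.
  have -> : (fun s : R => k * g (comb a b x (tupd t i s)) - d) = fun s : R =>
      k * ((fun s : R => g (tupd (comb a b x t) i s)) \o (fun s : R => a * tnth x i + b * s)) s - d.
    by apply/funext => s' /=; rewrite comb_tupd.
  have d1 := dg (comb a b x t) (a * tnth x i + b * s).
  by apply: is_derive_eq; rewrite /GRing.scale/=; ring.
apply: (@gauss_submean n (fun y => u (comb a b x y) - c)
  (fun i y => b * A i (comb a b x y)) (fun i y => b * (b * B i (comb a b x y)))).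
- by apply: tcontD; [exact: tcont_comb|exact: tcont_cst].
- move=> i; apply: tcontM; first exact: tcont_cst.
  by apply: tcontM; [exact: tcont_cst|exact: tcont_comb].
- move=> i t s; have := dlin u (A i) i t s 1 c (dA i); rewrite mul1r.
  by under [X in is_derive _ _ X _ -> _]funext do rewrite mul1r.
- move=> i t s; have := dlin (A i) (B i) i t s b 0 (dB i).
  by under [X in is_derive _ _ X _ -> _]funext do rewrite subr0.
- by move=> t; rewrite subr_ge0.
- by move=> t; rewrite -2!mulr_sumr mulrA mulr_ge0// -expr2 sqr_ge0.
Qed.

End slices.

(** * Real-analytic functions *)

Section power_series.
Context {R : realType} {m : nat}.
Local Notation K := {ffun 'I_m -> nat}.

Definition box_ext N (k : {ffun 'I_m -> 'I_N}) : K := [ffun i => nat_of_ord (k i)].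

Definition boxsum (F : K -> R) N : R := \sum_(k : {ffun 'I_m -> 'I_N}) F (box_ext k).

Lemma boxsum_nd F : (forall k, 0 <= F k) -> nondecreasing_seq (boxsum F).
Proof.
move=> F0 N M NM; rewrite /boxsum.
pose w (k : {ffun 'I_m -> 'I_N}) : {ffun 'I_m -> 'I_M} := [ffun i => widen_ord NM (k i)].
have winj : injective w.
  move=> k l /ffunP kl; apply/ffunP => i; have := kl i.
  by rewrite !ffunE => /(congr1 val)/= ?; exact: val_inj.
have wE k : box_ext (w k) = box_ext k by apply/ffunP => i; rewrite !ffunE.
have -> : \sum_(k : {ffun 'I_m -> 'I_N}) F (box_ext k) = \sum_(l in w @: {: {ffun 'I_m -> 'I_N}}) F (box_ext l).
  rewrite big_imset/=; last by move=> k l _ _; exact: winj.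
  by apply: eq_big => [k|k _]; rewrite ?wE.
by rewrite big_mkcond/=; apply: ler_sum => l _; case: ifP.
Qed.

Lemma le_boxsum F G N : (forall k, F k <= G k) -> boxsum F N <= boxsum G N.
Proof. by move=> h; apply: ler_sum => k _; exact: h. Qed.

Lemma ler_norm_boxsum F G N : (forall k, `|F k| <= G k) -> `|boxsum F N| <= boxsum G N.
Proof.
by move=> h; apply: le_trans (ler_norm_sum _ _ _) _; apply: ler_sum => k _; exact: h.
Qed.

Lemma boxsumD F G N : boxsum (fun k => F k + G k) N = boxsum F N + boxsum G N.
Proof. exact: big_split. Qed.

Lemma boxsumN F N : boxsum (fun k => - F k) N = - boxsum F N.
Proof. exact: sumrN. Qed.

Lemma boxsumZ a F N : boxsum (fun k => a * F k) N = a * boxsum F N.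
Proof. by rewrite /boxsum mulr_sumr. Qed.

(** Writes [F] as [(F + G) - G], a difference of nonnegative families with bounded sums. *)
Lemma cvg_boxsum F G (C : R) : (forall k, `|F k| <= G k) -> (forall N, boxsum G N <= C) ->
  cvgn (boxsum F).
Proof.
move=> FG GC.
have -> : boxsum F = (fun N => boxsum (fun k => F k + G k) N - boxsum G N).
  by apply/funext => N; rewrite boxsumD addrK.
have G0 k : 0 <= G k by exact: le_trans (FG k).
have bnd k : - G k <= F k <= G k by rewrite -ler_norml.
apply: is_cvgB; apply: nondecreasing_is_cvgn.
- by apply: boxsum_nd => k; case/andP: (bnd k) => h _; rewrite -(opprK (F k)) addrC subr_ge0 lerNl.
- exists (C + C) => _ [N _ <-]; rewrite boxsumD lerD//.
  by apply: le_trans (GC N); apply: le_boxsum => k; case/andP: (bnd k).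
- exact: boxsum_nd.
- by exists C => _ [N _ <-].
Qed.

Lemma cvg_norm_bound (u : nat -> R) (l C : R) :
  u @ \oo --> l -> (forall N, `|u N| <= C) -> `|l| <= C.
Proof.
move=> /cvgrPdist_le ul uC; apply/ler_addgt0Pr => e /ul [N _ /(_ N (leqnn N)) h].
by rewrite -(subrK (u N) l) addrC (le_trans (ler_normD _ _))// lerD.
Qed.

(** The factor that grows with [n] is paid for by doubling the radius: at half the radius of a power
    series, the remainders of all its terms are controlled by the series at the full radius. *)
Lemma expr_taylor1 (a s b : R) n : `|a| <= b -> `|a + s| <= b ->
  b ^+ 2 * `|(a + s) ^+ n - a ^+ n - n%:R * s * a ^+ n.-1| <= s ^+ 2 * (2 * b) ^+ n.
Proof.
move=> ab sb; have b0 : 0 <= b by exact: le_trans ab.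
elim: n => [|[|n] IH].
- by rewrite !expr0 subrr !mul0r subrr normr0 mulr0 mulr1 sqr_ge0.
- rewrite expr1 !expr1 (_ : a + s - a - _ = 0); last by rewrite /= expr0; ring.
  by rewrite normr0 mulr0 mulr_ge0 ?sqr_ge0// mulr_ge0.
have -> : (a + s) ^+ n.+2 - a ^+ n.+2 - n.+2%:R * s * a ^+ n.+2.-1 =
    (a + s) * ((a + s) ^+ n.+1 - a ^+ n.+1 - n.+1%:R * s * a ^+ n.+1.-1) + n.+1%:R * s ^+ 2 * a ^+ n.
  by rewrite /= !(exprS _ n.+1) !(exprS _ n) -[n.+2%:R]natr1; ring.
have h1 : b ^+ 2 * `|(a + s) * ((a + s) ^+ n.+1 - a ^+ n.+1 - n.+1%:R * s * a ^+ n.+1.-1)|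
    <= b * (s ^+ 2 * (2 * b) ^+ n.+1).
  rewrite normrM mulrCA; apply: ler_pM => //.
  by rewrite mulr_ge0 ?sqr_ge0.
have h2 : b ^+ 2 * `|n.+1%:R * s ^+ 2 * a ^+ n| <= s ^+ 2 * (n.+1%:R * b ^+ n.+2).
  rewrite 2!normrM (ger0_norm (ler0n _ _)) (ger0_norm (sqr_ge0 _)) normrX.
  rewrite [leLHS](_ : _ = s ^+ 2 * (n.+1%:R * (b ^+ 2 * `|a| ^+ n))); last by ring.
  rewrite (_ : b ^+ n.+2 = b ^+ 2 * b ^+ n); last by rewrite -exprD.
  by rewrite ler_wpM2l ?sqr_ge0// ler_wpM2l// ler_wpM2l ?sqr_ge0// lerXn2r// nnegrE.
have h3 : n.+1%:R <= 2 ^+ n.+1 :> R by rewrite -natrX ler_nat ltnW// ltn_expl.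
apply: le_trans (ler_wpM2l (sqr_ge0 _) (ler_normD _ _)) _.
rewrite mulrDr (le_trans (lerD h1 h2))// mulrCA -mulrDr ler_wpM2l ?sqr_ge0//.
rewrite !exprMn (_ : b * _ + _ = (2 ^+ n.+1 + n.+1%:R) * b ^+ n.+2); last by rewrite !exprS; ring.
by rewrite ler_wpM2r ?exprn_ge0// (exprS 2 n.+1) mulr_natl mulr2n lerD2l.
Qed.

Definition monom (ka : 'I_m -> nat) (h : 'rV[R]_m) : R := \prod_(i < m) h 0 i ^+ ka i.

(* The exponents [ka] need not enumerate all multi-indices: this makes the class stable
   under termwise differentiation without reindexing the partial sums over boxes. *)
Definition pser (g : 'rV[R]_m -> R) := forall x, exists (rho C : R) (c : K -> R)
  (ka : K -> 'I_m -> nat), [/\ 0 < rho,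
    forall N, boxsum (fun k => `|c k| * rho ^+ (\sum_(i < m) ka k i)%N) N <= C &
    forall h : 'rV[R]_m, (forall i, `|h 0 i| <= rho) ->
      boxsum (fun k => c k * monom (ka k) h) @ \oo --> g (x + h)].

Lemma monom_le (P : pred 'I_m) ka (h : 'rV[R]_m) (r : R) : (forall i, `|h 0 i| <= r) ->
  `|\prod_(i < m | P i) h 0 i ^+ ka i| <= r ^+ (\sum_(i < m | P i) ka i)%N.
Proof.
move=> hr; rewrite normr_prod expr_sum; apply: ler_prod => i _.
by rewrite normr_ge0/= normrX lerXn2r// nnegrE// (le_trans _ (hr i)).
Qed.

(** In a box of half-width [d], every nonconstant term is at most [d / rho] times its bound at
    radius [rho], so that [g] varies by at most [d / rho * C]. *)
Lemma pser_continuous g : pser g -> forall x : 'rV[R]_m, forall e, 0 < e ->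
  exists2 d : R, 0 < d & forall y : 'rV[R]_m, (forall i, `|x 0 i - y 0 i| < d) -> `|g x - g y| < e.
Proof.
move=> pg x e e0; have [rho [C [c [ka [r0 hC hg]]]]] := pg x.
have C0 : 0 <= C.
  apply: le_trans (hC 0%N); apply: sumr_ge0 => k _.
  by rewrite mulr_ge0// exprn_ge0// ltW.
have C1 : 0 < C + 1 by rewrite ltr_wpDl.
pose d := Num.min rho (e * rho / (C + 1) / 2).
have d0 : 0 < d by rewrite lt_min r0/= !divr_gt0// mulr_gt0.
have dr : d <= rho by rewrite ge_min lexx.
exists d => // y xy.
pose h := y - x.
have hd i : `|h 0 i| <= d by rewrite !mxE distrC ltW.
have cvy := hg h (fun i => le_trans (hd i) dr).
have cvx : boxsum (fun k => c k * monom (ka k) 0) @ \oo --> g (x + 0).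
  by apply: hg => i; rewrite mxE normr0 ltW.
rewrite addrC subrK in cvy; rewrite addr0 in cvx.
have cvB : (fun N => boxsum (fun k => c k * monom (ka k) 0) N - boxsum (fun k => c k * monom (ka k) h) N)
    @ \oo --> g x - g y by exact: cvgB cvx cvy.
have bnd : `|g x - g y| <= d / rho * C.
  apply: (cvg_norm_bound cvB) => N; rewrite -boxsumN -boxsumD.
  apply: le_trans (ler_wpM2l _ (hC N)); last by rewrite divr_ge0// ltW.
  rewrite -boxsumZ; apply: ler_norm_boxsum => k.
  rewrite -mulrBr normrM mulrCA ler_wpM2l//.
  have [k0|k0] := posnP (\sum_(i < m) ka k i)%N.
    have z i : ka k i = 0%N by apply/eqP; move/eqP: k0; rewrite sum_nat_eq0 => /forallP/(_ i).
    rewrite /monom !big1 ?subrr ?normr0 ?mulr_ge0 ?invr_ge0 ?(ltW d0) ?(ltW r0) ?exprn_ge0 ?(ltW r0)//.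
    - by move=> i _; rewrite z expr0.
    - by move=> i _; rewrite z expr0.
  have -> : monom (ka k) 0 = 0.
    have [i ki] : exists i, (0 < ka k i)%N.
      apply/existsP; rewrite -[X in is_true X]negbK negb_exists; apply/negP => /forallP z.
      by move: k0; rewrite big1// => i _; apply/eqP; rewrite -leqn0 leqNgt.
    by rewrite /monom (bigD1 i)//= mxE expr0n eqn0Ngt ki/= mul0r.
  rewrite sub0r normrN (le_trans (monom_le predT _ hd))//.
  have [j jE] : exists j, (\sum_(i < m) ka k i = j.+1)%N by case: (\sum_(i < m) _)%N k0 => // j _; exists j.
  rewrite jE !exprS mulrA divfK ?gt_eqF// ler_wpM2l ?(ltW d0)//.
  by rewrite lerXn2r ?nnegrE ?(ltW d0) ?(ltW r0).
apply: le_lt_trans bnd _.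
have h1 : d / rho <= e / (C + 1) / 2.
  rewrite ler_pdivrMr// ge_min; apply/orP; right.
  by rewrite le_eqVlt; apply/orP; left; apply/eqP; field; rewrite gt_eqF.
apply: (le_lt_trans (ler_wpM2r C0 h1)).
rewrite mulrAC ltr_pdivrMr// mulrAC ltr_pdivrMr// -mulrA ltr_pM2l//; lra.
Qed.

Section term_derivative.
Variables (x : 'rV[R]_m) (i : 'I_m) (g : 'rV[R]_m -> R) (rho C : R).
Variables (c : K -> R) (ka : K -> 'I_m -> nat).
Hypotheses (r0 : 0 < rho)
  (hC : forall N, boxsum (fun k => `|c k| * rho ^+ (\sum_(i < m) ka k i)%N) N <= C)
  (hg : forall h : 'rV[R]_m, (forall i, `|h 0 i| <= rho) ->
      boxsum (fun k => c k * monom (ka k) h) @ \oo --> g (x + h)).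

(** The ratio 4 serves twice: the exponent brought down by differentiation is absorbed through
    [n <= 4 ^ n], and increments of size [r] from a point of the box of half-width [r] stay within
    [rho / 2], as [expr_taylor1] requires. *)
Let r := rho / 4.
Let dc k := c k * (ka k i)%:R.
Let dka k j := if j == i then (ka k j).-1 else ka k j.

Let rr0 : 0 < r. Proof. by rewrite divr_gt0. Qed.

Lemma pser_term_bound N : boxsum (fun k => `|dc k| * r ^+ (\sum_(i < m) dka k i)%N) N <= C / r.
Proof.
rewrite ler_pdivlMr// mulrC -boxsumZ; apply: le_trans (hC N); apply: le_boxsum => k.
rewrite normrM (ger0_norm (ler0n _ _)) mulrCA -mulrA ler_wpM2l//.
have [->|k0] := posnP (ka k i); first by rewrite mul0r exprn_ge0// ltW.
have SE : (\sum_(j < m) ka k j = (\sum_(j < m) dka k j).+1)%N.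
  rewrite (bigD1 i)//= [in RHS](bigD1 i)//= {1}/dka eqxx -addSn prednK//; congr (_ + _)%N.
  by apply: eq_bigr => j /negbTE ji; rewrite /dka ji.
rewrite -exprS -SE.
rewrite (_ : rho = 4 * r); last by rewrite mulrC divfK.
rewrite [leRHS]exprMn ler_wpM2r ?exprn_ge0 ?(ltW rr0)//.
rewrite -natrX ler_nat (@leq_trans (\sum_(j < m) ka k j)%N)//.
  by rewrite (bigD1 i)//= leq_addr.
by rewrite ltnW// ltn_expl.
Qed.

Let Dser (h : 'rV[R]_m) := boxsum (fun k => dc k * monom (dka k) h).

Lemma cvg_pser_term (h : 'rV[R]_m) : (forall j, `|h 0 j| <= r) -> cvgn (Dser h).
Proof.
move=> hr; apply: cvg_boxsum pser_term_bound => k.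
by rewrite normrM ler_wpM2l// (monom_le predT).
Qed.

(** Each term's first-order Taylor remainder in [s] is at most its bound at radius [rho] times
    [s ^+ 2 / (rho / 2) ^+ 2]; these bounds sum to the quadratic estimate asked by
    [is_derive_taylor1]. *)
Lemma pser_term_derive (h : 'rV[R]_m) : (forall j, `|h 0 j| <= r) ->
  is_derive (0 : R) 1 (fun s : R => g (x + h + s *: delta_mx 0 i)) (limn (Dser h)).
Proof.
move=> hr; have r1 := r0; have rE : r = rho / 4 by [].
apply: (@is_derive_taylor1 _ _ _ _ (C / (rho / 2) ^+ 2) r) => // s sr.
have hs j : `|(h + s *: delta_mx 0 i) 0 j| <= rho / 2.
  rewrite !mxE eqxx/=; have := hr j; case: (j == i); rewrite ?mulr1 ?mulr0 ?addr0 => h1.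
    by apply: le_trans (ler_normD _ _) _; lra.
  by apply: le_trans h1 _; lra.
have l2 : rho / 2 <= rho by lra.
have l4 : r <= rho by lra.
have l3 : r <= rho / 2 by lra.
have cv1 := @hg (h + s *: delta_mx 0 i) (fun j => le_trans (hs j) l2).
have cv0 := @hg h (fun j => le_trans (hr j) l4).
have cv : (fun N => boxsum (fun k => c k * monom (ka k) (h + s *: delta_mx 0 i)) N -
     boxsum (fun k => c k * monom (ka k) h) N - Dser h N * s) @ \oo -->
   g (x + (h + s *: delta_mx 0 i)) - g (x + h) - limn (Dser h) * s.
  by apply: cvgB; [exact: cvgB|apply: cvgMl; exact: cvg_pser_term].
rewrite add0r scale0r addr0 -(addrA x h); apply: (cvg_norm_bound cv) => N.
rewrite mulrC /Dser -boxsumZ -!boxsumN -!boxsumD.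
have b0 : 0 < (rho / 2) ^+ 2 by rewrite exprn_gt0// divr_gt0.
rewrite mulrAC ler_pdivlMr//.
apply: le_trans (ler_wpM2r (sqr_ge0 s) (hC N)).
rewrite [leRHS]mulrC -boxsumZ mulrC -(gtr0_norm b0) -normrM -boxsumZ.
apply: ler_norm_boxsum => k.
pose P := \prod_(j < m | j != i) h 0 j ^+ ka k j.
have mE (u : R) (ka0 : 'I_m -> nat) : (forall j, j != i -> ka0 j = ka k j) ->
    monom ka0 (h + u *: delta_mx 0 i) = (h 0 i + u) ^+ ka0 i * P.
  move=> kaE; rewrite /monom (bigD1 i)//= !mxE !eqxx mulr1; congr (_ * _).
  by apply: eq_bigr => j ji; rewrite !mxE (negbTE ji) mulr0 addr0 kaE.
have mE0 ka0 := mE 0 ka0; rewrite scale0r !addr0 in mE0.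
have -> : c k * monom (ka k) (h + s *: delta_mx 0 i) + - (c k * monom (ka k) h) +
    - (s * (dc k * monom (dka k) h)) = c k * P *
    ((h 0 i + s) ^+ ka k i - h 0 i ^+ ka k i - (ka k i)%:R * s * h 0 i ^+ (ka k i).-1).
  rewrite (mE s)// !mE0//; last by move=> j /negbTE ji; rewrite /dka ji.
  by rewrite /dc /dka eqxx; ring.
have tay := @expr_taylor1 (h 0 i) s (rho / 2) (ka k i) (le_trans (hr i) l3).
have his : `|h 0 i + s| <= rho / 2 by have := hs i; rewrite !mxE !eqxx mulr1.
have {tay his} := tay his.
rewrite (_ : 2 * (rho / 2) = rho); last by lra.
rewrite normrM (gtr0_norm b0) [`|c k * _ * _|]normrM [`|c k * _|]normrM.
set E := `|_ - _ - _| => tay.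
rewrite [leLHS](_ : _ = `|c k| * (`|P| * ((rho / 2) ^+ 2 * E))); last by ring.
rewrite [leRHS]mulrCA ler_wpM2l// (bigD1 i)//= exprD [leRHS]mulrA [leRHS]mulrC.
apply: ler_pM => //; first by rewrite mulr_ge0 ?sqr_ge0 ?normr_ge0.
by apply: monom_le => j; apply: le_trans (hr j) l4.
Qed.

End term_derivative.

(** The series depends on the centre, so [g'] is first defined globally as a derivative and then
    identified near each centre with the differentiated series. *)
Lemma pser_derive g (i : 'I_m) : pser g -> exists2 g', pser g' &
  forall x, is_derive (0 : R) 1 (fun s : R => g (x + s *: delta_mx 0 i)) (g' x).
Proof.
move=> pg; pose g' x := derive1 (fun s : R => g (x + s *: delta_mx 0 i)) 0.
exists g' => x.
  have [rho [C [c [ka [r0 hC hg]]]]] := pg x.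
  exists (rho / 4), (C / (rho / 4)), (fun k => c k * (ka k i)%:R),
    (fun k j => if j == i then (ka k j).-1 else ka k j); split.
  - by rewrite divr_gt0.
  - exact: pser_term_bound.
  - move=> h hr; have dg := pser_term_derive i r0 hC hg hr.
    rewrite /g' derive1E derive_val.
    exact: (@cvg_pser_term i rho C c ka r0 hC h hr).
have [rho [C [c [ka [r0 hC hg]]]]] := pg x.
have h0 j : `|(0 : 'rV[R]_m) 0 j| <= rho / 4 by rewrite mxE normr0 divr_ge0// ltW.
have := pser_term_derive i r0 hC hg h0; rewrite addr0 => dg.
by rewrite /g' derive1E derive_val.
Qed.

Definition box_seq N : seq K :=
  [seq box_ext k | k <- index_enum {ffun 'I_m -> 'I_N}].

Lemma boxsum_fsbig G N :
  (boxsum G N)%:E = (\sum_(k \in [set` box_seq N]) (G k)%:E)%E.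
Proof.
have us : uniq (box_seq N).
  rewrite map_inj_uniq ?index_enum_uniq// => k l /ffunP kl; apply/ffunP => i.
  by have := kl i; rewrite !ffunE => ?; exact: val_inj.
by rewrite -fsbig_seq// big_map sumEFin.
Qed.

Lemma boxsum_esum G N : (forall k, 0 <= G k) ->
  ((boxsum G N)%:E <= \esum_(k in [set: K]) (G k)%:E)%E.
Proof.
move=> G0; apply: esum_ge; exists [set` box_seq N].
  by split => //; exact: finite_seq.
by rewrite boxsum_fsbig.
Qed.

Lemma real_analytic_pser (f : 'rV[R]_m -> R[i]) (prt : {additive R[i] -> R}) :
  (forall z (r : R), prt (z * r%:C%C) = prt z * r) -> (forall z, `|prt z| <= normc z) ->
  real_analytic f -> pser (prt \o f).
Proof.
move=> prtM prt_le fa x; have [c /nbhs_ballP[d /= d0 hd]] := fa x.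
pose rho := d / 2; have r0 : 0 < rho by rewrite divr_gt0.
have rd : rho < d by rewrite /rho ltr_pdivrMr// ltr_pMr// ltr1n.
have hb (h : 'rV[R]_m) : (forall i, `|h 0 i| <= rho) -> ball (0 : 'rV[R]_m) d h.
  move=> hr; split=> // j i; rewrite ord1 mxE /ball/= sub0r normrN.
  exact: le_lt_trans (hr i) rd.
(* Absolute convergence at the corner of the box bounds the series at all its points. *)
have [] := hd _ (hb (const_mx rho) ltac:(by move=> i; rewrite mxE gtr0_norm)).
set E := esum _ _ => Efin _.
have E0 : (0 <= E)%E by apply: esum_ge0 => k _; rewrite lee_fin mulr_ge0//; case: (c k) => ? ?; exact: sqrtr_ge0.
exists rho, (fine E), (prt \o c), (fun k i => k i); split=> //.
  move=> N; rewrite -lee_fin fineK ?ge0_fin_numE//.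
  apply: le_trans (boxsum_esum _ _) _ => [k|]; first by rewrite mulr_ge0// exprn_ge0// ltW.
  apply: le_esum => k _; rewrite lee_fin ler_pM ?exprn_ge0 ?(ltW r0)//=.
  rewrite /multi_monomial (eq_bigr (fun i => rho ^+ k i)); last by move=> i _; rewrite mxE.
  by rewrite -expr_sum ger0_norm// exprn_ge0// ltW.
move=> h hr; have [_ hcv] := hd h (hb h hr).
apply/cvgrPdist_lt => e e0.
have eC : 0 < (e%:C)%C :> R[i] by rewrite ltcR.
move/cvgrPdist_lt : hcv => /(_ _ eC); apply: filterS => N.
have -> : boxsum (fun k => (prt \o c) k * monom (fun i => k i) h) N =
   prt (\sum_(k : {ffun 'I_m -> 'I_N}) c [ffun i => nat_of_ord (k i)] *
       (multi_monomial [ffun i => nat_of_ord (k i)] h)%:C%C).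
  by rewrite raddf_sum; apply: eq_bigr => k _; rewrite prtM.
rewrite -raddfB/= => hN; apply: le_lt_trans (prt_le _) _.
by rewrite -ltcR.
Qed.

End power_series.

(** * Log-subharmonic functions *)

Section analytic_slices.
Context {R : realType} {m : nat}.
Implicit Types (x y : 'rV[R]_m) (g : 'rV[R]_m -> R) (i : 'I_m).

Definition line_derive g g' i := forall x,
  is_derive (0 : R) 1 (fun s : R => g (x + s *: delta_mx 0 i)) (g' x).

Lemma line_derive_affine g g' i x (al be s : R) : line_derive g g' i ->
  is_derive s 1 (fun s : R => g (x + (al * s + be) *: delta_mx 0 i))
    (al * g' (x + (al * s + be) *: delta_mx 0 i)).
Proof.
move=> dg; set z := x + (al * s + be) *: delta_mx 0 i.
have -> : (fun s : R => g (x + (al * s + be) *: delta_mx 0 i)) =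
    (fun r : R => g (z + r *: delta_mx 0 i)) \o (fun s' : R => al * (s' - s)).
  apply/funext => s' /=; rewrite /z -addrA -scalerDl; congr (g (_ + _ *: _)); ring.
have h := dg z.
have h0 : is_derive (al * (s - s)) 1 (fun r : R => g (z + r *: delta_mx 0 i)) (g' z).
  by rewrite subrr mulr0.
by apply: is_derive_eq; rewrite /GRing.scale/=; ring.
Qed.

Lemma derive_lineE (u : 'rV[R]_m -> R) (v z : 'rV[R]_m) :
  'D_v u z = 'D_1 (fun s : R => u (z + s *: v)) 0.
Proof.
rewrite /derive (_ : (fun h : R => h^-1 *: ((u \o shift z) (h *: v) - u z)) = fun h : R =>
  h^-1 *: (((fun s : R => u (z + s *: v)) \o shift 0) (h *: (1 : R)) - u (z + 0 *: v)))//.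
apply/funext => h /=.
by rewrite addr0 scale0r addr0 [h *: 1]mulr1 [h *: v + z]addrC.
Qed.

Lemma pser_C2 g : pser g -> exists A B : 'I_m -> 'rV[R]_m -> R,
  (forall i, [/\ pser (A i), pser (B i), line_derive g (A i) i & line_derive (A i) (B i) i]).
Proof.
move=> pg.
have /choice[AB hAB] i : exists AB : ('rV[R]_m -> R) * ('rV[R]_m -> R),
    [/\ pser AB.1, pser AB.2, line_derive g AB.1 i & line_derive AB.1 AB.2 i].
  have [A pA dA] := pser_derive i pg; have [B pB dB] := pser_derive i pA.
  by exists (A, B).
by exists (fun i => (AB i).1), (fun i => (AB i).2) => i; exact: hAB.
Qed.

Lemma pser_tcont g (sig : R) : pser g -> tcont (fun t : m.-tuple R => g (rV_of_tuple (tscale sig t))).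
Proof.
move=> pg t e e0; have [d d0 hd] := pser_continuous pg (rV_of_tuple (tscale sig t)) e0.
have s1 : 0 < `|sig| + 1 by rewrite ltr_wpDl.
exists (d / (`|sig| + 1)); first by rewrite divr_gt0.
move=> t' h; apply: hd => i; rewrite !mxE !tnth_mktuple -mulrBr normrM.
apply: (@le_lt_trans _ _ ((`|sig| + 1) * `|tnth t i - tnth t' i|)); first by rewrite ler_wpM2r// lerDl.
by rewrite mulrC -ltr_pdivlMr.
Qed.

Lemma line_derive_tupd g g' i (sig : R) (t : m.-tuple R) (s : R) : line_derive g g' i ->
  is_derive s 1 (fun s : R => g (rV_of_tuple (tscale sig (tupd t i s))))
    (sig * g' (rV_of_tuple (tscale sig (tupd t i s)))).
Proof.
move=> dg; pose y := rV_of_tuple (tscale sig (tupd t i 0)).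
have yE s' : rV_of_tuple (tscale sig (tupd t i s')) = y + (sig * s' + 0) *: delta_mx 0 i.
  apply/rowP => j; rewrite !mxE eqxx/= !tnth_mktuple addr0.
  by case: (j == i); rewrite ?mulr1 ?mulr0 ?addr0 ?add0r.
have := line_derive_affine y sig 0 s dg; rewrite -yE.
by under [X in is_derive _ _ X _ -> _]funext do rewrite -yE.
Qed.

Section log_subharmonic_slices.
Variables (f : 'rV[R]_m -> R[i]) (A1 A2 B1 B2 : 'I_m -> 'rV[R]_m -> R).
Let a x := complex.Re (f x).
Let b x := complex.Im (f x).
Hypotheses (dA1 : forall i, line_derive a (A1 i) i) (dA2 : forall i, line_derive (A1 i) (A2 i) i)
  (dB1 : forall i, line_derive b (B1 i) i) (dB2 : forall i, line_derive (B1 i) (B2 i) i).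

(** The square of [|f|], unlike [|f|], is smooth at the zeros of [f]; [F1] and [F2] are its first
    two derivatives along the axes. *)
Let F x := a x ^+ 2 + b x ^+ 2.
Let F1 i x := 2 * (a x * A1 i x + b x * B1 i x).
Let F2 i x := 2 * (A1 i x ^+ 2 + a x * A2 i x + (B1 i x ^+ 2 + b x * B2 i x)).

Lemma line_derive_sqr_norm i : line_derive F (F1 i) i.
Proof.
move=> x; have d1 := dA1 i x; have d2 := dB1 i x.
by apply: is_derive_eq; rewrite !scale0r !addr0 /F1 /GRing.scale/=; ring.
Qed.

Lemma line_derive2_sqr_norm i : line_derive (F1 i) (F2 i) i.
Proof.
move=> x; have d1 := dA1 i x; have d2 := dB1 i x; have d3 := dA2 i x; have d4 := dB2 i x.
by apply: is_derive_eq; rewrite !scale0r !addr0 /F2 /GRing.scale/=; ring.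
Qed.

Lemma sqr_norm_ge0 x : 0 <= F x. Proof. by rewrite addr_ge0 ?sqr_ge0. Qed.

Lemma ln_normcE x : ln (normc (f x)) = 2^-1 * ln (F x).
Proof.
rewrite /F /a /b; case: (f x) => u v /=.
by rewrite -powR12_sqrt ?addr_ge0 ?sqr_ge0// ln_powR.
Qed.

Lemma laplacian_ln_normc x : F x != 0 ->
  laplacian (fun y => ln (normc (f y))) x =
  2^-1 * \sum_(i < m) (F2 i x / F x - (F1 i x / F x) ^+ 2).
Proof.
move=> Fx; rewrite /laplacian mulr_sumr; apply: eq_bigr => i _.
have Fgt0 y : F y != 0 -> 0 < F y by rewrite lt_def sqr_norm_ge0 andbT.
have D1 y : F y != 0 -> 'D_(delta_mx 0 i) (fun y => ln (normc (f y))) y = 2^-1 * (F1 i y / F y).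
  move=> Fy; rewrite derive_lineE; apply: derive_val.
  under [X in is_derive _ _ X _]funext do rewrite ln_normcE.
  have d1 := line_derive_sqr_norm i y.
  have Fy0 : 0 < F (y + 0 *: delta_mx 0 i) by rewrite scale0r addr0 Fgt0.
  have d2 := is_derive1_ln Fy0.
  by apply: is_derive_eq; rewrite scale0r addr0 /GRing.scale/=; field.
rewrite derive_lineE.
have d1 := line_derive_sqr_norm i x; have d2 := line_derive2_sqr_norm i x.
have cF : {for 0, continuous (fun s : R => F (x + s *: delta_mx 0 i))}.
  by apply/differentiable_continuous/derivable1_diffP.
rewrite (@near_eq_derive _ _ _ _ (fun s : R => 2^-1 * (F1 i (x + s *: delta_mx 0 i) / F (x + s *: delta_mx 0 i)))); last first.
  have : F (x + 0 *: delta_mx 0 i) != 0 by rewrite scale0r addr0.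
  by move=> /(cvgr_neq0 _ cF); apply: filterS => s /D1.
apply: derive_val.
have Fx0 : F (x + 0 *: delta_mx 0 i) != 0 by rewrite scale0r addr0.
by apply: is_derive_eq; rewrite scale0r addr0 /GRing.scale/=; field.
Qed.

(** Multiplied by the denominator, each summand becomes [F2 - F1 ^+ 2 / F], which only grows when
    [F] is replaced by [F + eps]. At a zero of [f], [F1] vanishes and [F2] is a sum of squares. *)
Lemma log_subharmonic_reg (eps : R) x : log_subharmonic f -> 0 < eps ->
  0 <= \sum_(i < m) (F2 i x / (F x + eps) - (F1 i x / (F x + eps)) ^+ 2).
Proof.
move=> lsf e0; have F0 := sqr_norm_ge0 x.
have Fe : 0 < F x + eps by rewrite ltr_wpDl.
have [Fx|Fx] := eqVneq (F x) 0.
  have [ax bx] : a x = 0 /\ b x = 0.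
    move/eqP: Fx; rewrite paddr_eq0 ?sqr_ge0// !sqrf_eq0 => /andP[/eqP ? /eqP ?].
    by [].
  apply: sumr_ge0 => i _; rewrite /F1 /F2 ax bx !mul0r !addr0 mulr0 mul0r expr0n/= subr0.
  by rewrite divr_ge0 ?(ltW Fe)// mulr_ge0// addr_ge0// sqr_ge0.
have Fgt0 : 0 < F x by rewrite lt_def Fx.
have fx : f x != 0.
  apply: contra_neq Fx; rewrite /F /a /b => ->.
  by rewrite /= expr0n/= addr0.
have := lsf x fx; rewrite laplacian_ln_normc// pmulr_rge0//.
rewrite -(pmulr_rge0 _ Fgt0) => h.
rewrite -(pmulr_rge0 _ Fe); apply: le_trans h _.
rewrite !mulr_sumr; apply: ler_sum => i _.
have E (y u v : R) : 0 < y -> y * (u / y - (v / y) ^+ 2) = u - v ^+ 2 / y.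
  by move=> y0; field; rewrite gt_eqF.
by rewrite !E// lerD2l lerN2 ler_wpM2l ?sqr_ge0// lef_pV2 ?posrE// lerDl ltW.
Qed.

End log_subharmonic_slices.

Lemma normc_sqrE (z : R[i]) : normc z ^+ 2 = complex.Re z ^+ 2 + complex.Im z ^+ 2.
Proof. by case: z => u v /=; rewrite sqr_sqrtr// addr_ge0 ?sqr_ge0. Qed.

Let ler_normc (u v : R) : `|u| <= Num.sqrt (u ^+ 2 + v ^+ 2).
Proof. by rewrite -sqrtr_sqr ler_sqrt ?addr_ge0 ?sqr_ge0// lerDl sqr_ge0. Qed.

Lemma real_analytic_Re (f : 'rV[R]_m -> R[i]) : real_analytic f -> pser (@complex.Re R \o f).
Proof.
move=> fa; apply: real_analytic_pser fa => [[u v] r|[u v]] /=; last exact: ler_normc.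
by rewrite mulr0 subr0.
Qed.

Lemma real_analytic_Im (f : 'rV[R]_m -> R[i]) : real_analytic f -> pser (@complex.Im R \o f).
Proof.
move=> fa; apply: real_analytic_pser fa => [[u v] r|[u v]] /=; last by rewrite addrC; exact: ler_normc.
by rewrite mulr0 add0r.
Qed.

Lemma logsub_submean (f : 'rV[R]_m -> R[i]) (k sig eps : R)
    (phi := fun t : m.-tuple R => k * ln (normc (f (rV_of_tuple (tscale sig t))) ^+ 2 + eps)) :
  real_analytic f -> log_subharmonic f -> 0 <= k -> 0 < eps ->
  [/\ tcont phi, (forall t, k * ln eps <= phi t) & forall (a b : R) (x : m.-tuple R),
    ((phi (tscale a x) - k * ln eps)%:E <=
     \int[gauss_tuple m]_y (phi (comb a b x y) - k * ln eps)%:E)%E].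
Proof.
move=> fa lsf k0 e0.
have pa := real_analytic_Re fa; have pb := real_analytic_Im fa.
have [A1 [A2 hA]] := pser_C2 pa; have [B1 [B2 hB]] := pser_C2 pb.
have dA1 i : line_derive (@complex.Re R \o f) (A1 i) i by case: (hA i).
have dA2 i : line_derive (A1 i) (A2 i) i by case: (hA i).
have dB1 i : line_derive (@complex.Im R \o f) (B1 i) i by case: (hB i).
have dB2 i : line_derive (B1 i) (B2 i) i by case: (hB i).
pose X (g : 'rV[R]_m -> R) (t : m.-tuple R) := g (rV_of_tuple (tscale sig t)).
pose F x := complex.Re (f x) ^+ 2 + complex.Im (f x) ^+ 2.
pose F1 i x := 2 * (complex.Re (f x) * A1 i x + complex.Im (f x) * B1 i x).
pose F2 i x := 2 * (A1 i x ^+ 2 + complex.Re (f x) * A2 i x + (B1 i x ^+ 2 + complex.Im (f x) * B2 i x)).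
have phiE : phi = fun t => k * ln (X F t + eps).
  by apply/funext => t; rewrite /phi normc_sqrE.
have F0 x : 0 <= F x by rewrite addr_ge0 ?sqr_ge0.
have Fe x : 0 < F x + eps by rewrite ltr_wpDl.
have sq (g : m.-tuple R -> R) : tcont g -> tcont (fun t => g t ^+ 2).
  by move=> cg; exact: (tcontM cg cg).
have ca := pser_tcont sig pa; have cb := pser_tcont sig pb.
have cF : tcont (X F) by apply: tcontD; apply: sq.
have cF1 i : tcont (X (F1 i)).
  have [pA1 _ _ _] := hA i; have [pB1 _ _ _] := hB i.
  apply: tcontM; first exact: tcont_cst.
  by apply: tcontD; apply: tcontM => //; exact: pser_tcont.
have cF2 i : tcont (X (F2 i)).
  have [pA1 pA2 _ _] := hA i; have [pB1 pB2 _ _] := hB i.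
  apply: tcontM; first exact: tcont_cst.
  by apply: tcontD; apply: tcontD; [apply: sq|apply: tcontM|apply: sq|apply: tcontM];
    by [exact: pser_tcont|exact: ca|exact: cb].
have ce (y : R) : 0 < `|y| + eps by rewrite ltr_wpDl.
(* Since [F] is nonnegative, the absolute value changes nothing; it makes the outer functions
   continuous on the whole line, as [tcont_comp] demands. *)
have cabs : continuous (fun y : R => `|y| + eps).
  by move=> y; apply: cvgD; [exact: norm_continuous|exact: cvg_cst].
have cln : tcont phi.
  have -> : phi = fun t => k * (fun y : R => ln (`|y| + eps)) (X F t).
    by rewrite phiE; apply/funext => t; rewrite (ger0_norm (F0 _)).
  apply: tcontM; first exact: tcont_cst.
  apply: (@tcont_comp _ _ (fun y : R => ln (`|y| + eps)) _ _ cF) => y.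
  apply: (@continuous_comp _ _ _ (fun y : R => `|y| + eps) (@ln R)); first exact: cabs.
  exact: continuous_ln.
have cinv : tcont (fun t => (X F t + eps)^-1).
  have -> : (fun t => (X F t + eps)^-1) = fun t => (fun y : R => (`|y| + eps)^-1) (X F t).
    by apply/funext => t; rewrite (ger0_norm (F0 _)).
  apply: (@tcont_comp _ _ (fun y : R => (`|y| + eps)^-1) _ _ cF) => y.
  apply: (@continuous_comp _ _ _ (fun y : R => `|y| + eps) (fun y : R => y^-1)); first exact: cabs.
  by apply: inv_continuous; rewrite gt_eqF.
have philow t : k * ln eps <= phi t.
  rewrite phiE ler_wpM2l// ler_ln ?posrE//; last exact: Fe.
  by rewrite lerDr; exact: F0.
split=> // a b x.
pose G1 i t := k * (sig * (X (F1 i) t / (X F t + eps))).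
pose G2 i t := k * (sig ^+ 2 * (X (F2 i) t / (X F t + eps) - (X (F1 i) t / (X F t + eps)) ^+ 2)).
apply: (@gauss_submean_comb _ _ phi G1 G2); [exact: cln| | | |exact: philow|].
- move=> i; apply: tcontM; first exact: tcont_cst.
  apply: tcontM; first exact: tcont_cst.
  by apply: tcontD; [exact: tcontM|apply/tcontN/sq/tcontM].
- move=> i t s; rewrite phiE.
  have d1 := line_derive_tupd sig t s (line_derive_sqr_norm dA1 dB1 i).
  have d2 := is_derive1_ln (Fe (rV_of_tuple (tscale sig (tupd t i s)))).
  apply: is_derive_eq; rewrite /G1 /X /F1 /GRing.scale/=.
  by set w := (_ + eps)^-1; ring.
- move=> i t s.
  have d1 := line_derive_tupd sig t s (line_derive_sqr_norm dA1 dB1 i).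
  have d2 := line_derive_tupd sig t s (line_derive2_sqr_norm dA1 dA2 dB1 dB2 i).
  have Fn : F (rV_of_tuple (tscale sig (tupd t i s))) + eps != 0 by rewrite gt_eqF.
  apply: is_derive_eq; rewrite /G2 /X /GRing.scale/=.
  rewrite -/(F1 i _) -/(F2 i _); move: (F1 i _) (F2 i _) (F _ + eps) Fn => u v w w0.
  by field.
- move=> t; rewrite /G2 -mulr_sumr -mulr_sumr mulr_ge0// mulr_ge0 ?sqr_ge0//.
  exact: log_subharmonic_reg.
Qed.

Lemma real_analytic_normc_tcont (f : 'rV[R]_m -> R[i]) :
  real_analytic f -> tcont (fun t : m.-tuple R => normc (f (rV_of_tuple t))).
Proof.
move=> fa.
have ca := pser_tcont 1 (real_analytic_Re fa); have cb := pser_tcont 1 (real_analytic_Im fa).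
have sqt := tcont_comp (@sqrt_continuous R) (tcontD (tcontM ca ca) (tcontM cb cb)).
rewrite (_ : (fun t => _) = fun t : m.-tuple R => Num.sqrt (
  (@complex.Re R \o f) (rV_of_tuple (tscale 1 t)) * (@complex.Re R \o f) (rV_of_tuple (tscale 1 t)) +
  (@complex.Im R \o f) (rV_of_tuple (tscale 1 t)) * (@complex.Im R \o f) (rV_of_tuple (tscale 1 t))))//.
apply/funext => t; have -> : tscale 1 t = t.
  by apply: eq_from_tnth => i; rewrite tnth_mktuple mul1r.
by rewrite /=; case: (f _) => u v /=; rewrite !expr2.
Qed.

End analytic_slices.

(** * Contraction of the norms *)

Section gauss_norm.
Context {R : realType}.
Local Notation mR := (measurableTypeR R).
Local Notation gamma := (@normal_prob R 0 1).

Lemma ge0_lebesgue_tupleS n (f : n.+1.-tuple mR -> \bar R) :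
  measurable_fun setT f -> (forall x, 0 <= f x)%E ->
  (\int[@lebesgue_tuple R n.+1]_t f t =
   \int[lebesgue_measure]_x \int[@lebesgue_tuple R n]_t f (tuple_cons (x, t)))%E.
Proof.
move=> mf f0.
rewrite [LHS](ge0_integral_pushforward (@measurable_tuple_cons R n) _ measurableT mf (fun y _ => f0 y)).
rewrite preimage_setT.
exact: (fubini_tonelli1 _ (measurableT_comp mf (@measurable_tuple_cons R n)) (fun x => f0 _)).
Qed.

Definition tpdf n (mu : n.-tuple R) (s : R) (t : n.-tuple R) : R :=
  \prod_(i < n) normal_pdf (tnth mu i) s (tnth t i).

Lemma tpdf_ge0 n (mu : n.-tuple R) s t : 0 <= tpdf mu s t.
Proof. by apply: prodr_ge0 => i _; exact: normal_pdf_ge0. Qed.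

Lemma measurable_tpdf n (mu : n.-tuple R) s : measurable_fun setT (tpdf mu s : n.-tuple mR -> R).
Proof.
apply: measurable_prod => i _; apply: measurableT_comp; first exact: measurable_normal_pdf.
exact: measurable_tnth.
Qed.

Lemma lebesgue_tuple_gauss n (mu : n.-tuple R) (s : R) (F : n.-tuple mR -> \bar R) : 0 < s ->
  measurable_fun setT F -> (forall t, 0 <= F t)%E ->
  (\int[@lebesgue_tuple R n]_t (F t * (tpdf mu s t)%:E) =
   \int[gauss_tuple n]_y F (comb 1 s mu y))%E.
Proof.
move=> s0; elim: n mu F => [|n IH] mu F mF F0.
  transitivity (F [tuple]).
    rewrite integral_dirac//; last first.
      by apply: emeasurable_funM => //; apply/measurable_EFinP; exact: measurable_tpdf.
    by rewrite diracT mul1e /tpdf big_ord0 mule1.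
  rewrite integral_dirac//; last by apply: measurableT_comp => //; exact: measurable_comb.
  by rewrite diracT mul1e; congr F; rewrite [RHS]tuple0.
have [mu0 [mu' ->]] : exists mu0 (mu' : n.-tuple R), mu = tuple_cons (mu0, mu').
  by exists (thead mu), [tuple of behead mu]; rewrite [LHS]tuple_eta; exact: val_inj.
have mFc : measurable_fun setT (F \o @tuple_cons R n) by exact: (measurableT_comp mF (@measurable_tuple_cons R n)).
have mp0 : measurable_fun setT (fun t => F t * (tpdf (tuple_cons (mu0, mu')) s t)%:E)%E.
  by apply: emeasurable_funM => //; apply/measurable_EFinP; exact: measurable_tpdf.
rewrite ge0_lebesgue_tupleS//; last by move=> t; rewrite mule_ge0// lee_fin tpdf_ge0.
have mFy : measurable_fun setT (fun y => F (comb 1 s (tuple_cons (mu0, mu')) y)).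
  by apply: measurableT_comp => //; exact: measurable_comb.
rewrite ge0_gauss_tupleS//.
pose G x := (\int[gauss_tuple n]_y F (tuple_cons (x, comb 1 s mu' y)))%E.
have mG : measurable_fun setT G.
  have mq : measurable_fun setT (fun z : mR * n.-tuple mR => F (tuple_cons (z.1, comb 1 s mu' z.2))).
    apply: (measurableT_comp mFc); apply/measurable_fun_pair => //.
    by apply: (measurableT_comp (measurable_comb 1 s mu')).
  exact: (measurable_fun_fubini_tonelli_F _ mq).
have G0 x : (0 <= G x)%E by apply: integral_ge0.
transitivity (\int[gamma]_x G (mu0 + s * x)%R)%E; last first.
  apply: eq_integral => x _; apply: eq_integral => y _.
  by rewrite comb_tuple_cons/= mul1r.
rewrite -(ge0_normal_prob_affine mu0 s0 mG G0).
rewrite (ge0_integral_normal_prob _ _ mG G0).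
apply: eq_integral => x _.
have mFx : measurable_fun setT (fun t => F (tuple_cons (x, t))).
  by apply: (measurableT_comp mFc).
rewrite /G -(IH mu' (fun t => F (tuple_cons (x, t))) mFx (fun t => F0 _)).
rewrite muleC -ge0_integralZl//; last 3 first.
- by apply: emeasurable_funM => //; apply/measurable_EFinP; exact: measurable_tpdf.
- by move=> t _; rewrite mule_ge0// lee_fin tpdf_ge0.
- by rewrite lee_fin normal_pdf_ge0.
apply: eq_integral => t _; rewrite muleCA -EFinM; congr (_ * _%:E)%E.
rewrite /tpdf big_ord_recl; congr (_ * _).
by apply: eq_bigr => i _; rewrite !tnthS.
Qed.

Lemma enorm_sqr m (x : 'rV[R]_m) : enorm x ^+ 2 = \sum_(i < m) x 0 i ^+ 2.
Proof.
rewrite /enorm sqr_sqrtr; first by apply: eq_bigr => i _; rewrite expr2.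
by apply: sumr_ge0 => i _; rewrite -expr2 sqr_ge0.
Qed.

Definition psigma (p alpha : R) : R := (Num.sqrt (alpha * p))^-1.

Lemma psigma_gt0 p alpha : 0 < p -> 0 < alpha -> 0 < psigma p alpha.
Proof. by move=> p0 a0; rewrite invr_gt0 sqrtr_gt0 mulr_gt0. Qed.

Lemma cst_pa_gt0 m (p alpha : R) : 0 < p -> 0 < alpha -> 0 < cst_pa m p alpha.
Proof. by move=> p0 a0; rewrite powR_gt0// divr_gt0 ?mulr_gt0 ?pi_gt0. Qed.

Lemma cst_paE m (p alpha : R) : 0 < p -> 0 < alpha ->
  cst_pa m p alpha = ((Num.sqrt (2 * pi))^-1 * (psigma p alpha)^-1) ^+ m.
Proof.
move=> p0 a0; have ap : 0 < alpha * p by rewrite mulr_gt0.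
have pp : 0 < 2 * pi :> R by rewrite mulr_gt0// pi_gt0.
rewrite /cst_pa [m%:R / 2]mulrC powRrM powR12_sqrt ?divr_ge0 ?ltW// powR_mulrn ?sqrtr_ge0//.
by rewrite sqrtrM ?(ltW ap)// sqrtrV ?(ltW pp)// invrK mulrC.
Qed.

(** Completing the square: the exponents add up to [- (alpha * p / 2) * |x - a| ^ 2]. The case
    [a = 0] identifies the weight of the norm with a Gaussian density; general [a] shows that [f_a]
    has norm one for every exponent, whence equality. *)
Lemma exp_weightE m (p alpha : R) (a : 'rV[R]_m) (t : m.-tuple R) (x := rV_of_tuple t) :
  0 < p -> 0 < alpha ->
  cst_pa m p alpha * (expR (alpha * dotp a x - alpha / 2 * enorm a ^+ 2) `^ p *
    expR (- (alpha / 2 * p * enorm x ^+ 2))) = tpdf [tuple a 0 i | i < m] (psigma p alpha) t.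
Proof.
move=> p0 a0; have ap : 0 < alpha * p by rewrite mulr_gt0.
rewrite cst_paE// -expRM -expRD /tpdf.
under eq_bigr do rewrite normal_pdf_gt0E ?psigma_gt0//.
rewrite big_split/= prodr_const card_ord -expR_sum; congr (_ * expR _).
transitivity (\sum_(i < m) (alpha * p * (a 0 i * x 0 i) - alpha / 2 * p * a 0 i ^+ 2 -
  alpha / 2 * p * x 0 i ^+ 2)).
  by rewrite !sumrB -!mulr_sumr !enorm_sqr /dotp; ring.
apply: eq_bigr => i _; rewrite tnth_mktuple mxE /psigma exprVn sqr_sqrtr ?(ltW ap)//.
by field; rewrite !gt_eqF.
Qed.

Lemma norm_paE m (p alpha : R) (f : 'rV[R]_m -> R[i]) : 0 < p -> 0 < alpha ->
  measurable_fun setT (fun t : m.-tuple mR => normc (f (rV_of_tuple t))) ->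
  norm_pa p alpha f =
  ((\int[gauss_tuple m]_y (normc (f (rV_of_tuple (tscale (psigma p alpha) y))) `^ p)%:E) `^ p^-1)%E.
Proof.
move=> p0 a0 mf; rewrite /norm_pa /lebesgue_int; congr (_ `^ _)%E.
have s0 := psigma_gt0 p0 a0; have c0 := cst_pa_gt0 m p0 a0.
pose G (t : m.-tuple mR) := (normc (f (rV_of_tuple t)) `^ p)%:E.
have mG : measurable_fun setT G by apply/measurable_EFinP/(measurableT_comp (measurable_powR _)).
have G0 t : (0 <= G t)%E by rewrite lee_fin powR_ge0.
pose z : m.-tuple R := [tuple (0 : 'rV[R]_m) 0 i | i < m].
have mw : measurable_fun setT (fun t => G t * (tpdf z (psigma p alpha) t)%:E)%E.
  by apply: emeasurable_funM => //; apply/measurable_EFinP; exact: measurable_tpdf.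
have w0 t : (0 <= G t * (tpdf z (psigma p alpha) t)%:E)%E by rewrite mule_ge0// lee_fin tpdf_ge0.
pose X := (\int[@lebesgue_tuple R m]_t (G t * (tpdf z (psigma p alpha) t)%:E))%E.
transitivity X.
  have c1 : 0 <= (cst_pa m p alpha)^-1 by rewrite invr_ge0 ltW.
  have -> : X = ((cst_pa m p alpha)%:E * (((cst_pa m p alpha)^-1)%:E * X))%E.
    by rewrite muleA -EFinM mulfV ?gt_eqF// mul1e.
  congr (_ * _)%E; rewrite /X -ge0_integralZl//; apply: eq_integral => t _.
  rewrite muleCA -!EFinM; congr (_ * _)%:E.
  rewrite /z -exp_weightE// mulKf ?gt_eqF//.
  have -> : enorm (0 : 'rV[R]_m) ^+ 2 = 0.
    by rewrite enorm_sqr big1// => i _; rewrite mxE expr0n.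
  have -> : dotp 0 (rV_of_tuple t) = 0 by rewrite /dotp big1// => i _; rewrite mxE mul0r.
  by rewrite !mulr0 subr0 expR0 powR1 mul1r.
rewrite /X (lebesgue_tuple_gauss _ s0 mG G0); apply: eq_integral => y _.
rewrite /G; congr ((normc (f (rV_of_tuple _))) `^ _)%:E.
by apply: eq_from_tnth => i; rewrite !tnth_mktuple mxE mulr0 add0r.
Qed.

(** Uniform in [x], this removes [eps] from the integral without a limit theorem. With [e = u * u]:
    for [x >= u] the shift multiplies [x] by at most [1 + u], and [(1 + u) ^ k <= 1 + d]; for
    [x < u] the sum is below [2 * u <= d ^ (1 / k)]. *)
Lemma powR_reg (k d : R) : 0 < k -> 0 < d ->
  exists2 e, 0 < e & forall x, 0 <= x -> (x + e) `^ k <= (1 + d) * x `^ k + d.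
Proof.
move=> k0 d0; have d1 : 0 < ln (1 + d) by rewrite ln_gt0// ltrDl.
pose u := Num.min 1 (Num.min (ln (1 + d) / k) (d `^ k^-1 / 2)).
have u0 : 0 < u by rewrite !lt_min ltr01/= !divr_gt0// powR_gt0.
have [u1 [u2 u3]] : u <= 1 /\ u <= ln (1 + d) / k /\ u <= d `^ k^-1 / 2.
  by rewrite !ge_min !lexx/= !orbT.
exists (u * u) => [|x x0]; first exact: mulr_gt0.
have xk := powR_ge0 x k.
have [ux|ux] := leP u x.
  apply: (@le_trans _ _ ((1 + u) `^ k * x `^ k)).
    rewrite -powRM ?addr_ge0 ?(ltW u0)//; apply: ge0_ler_powR; rewrite ?nnegrE ?(ltW k0)//.
    - by rewrite addr_ge0// mulr_ge0 ?(ltW u0).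
    - by rewrite mulr_ge0// addr_ge0// ltW.
    - by rewrite mulrDl mul1r lerD2l ler_wpM2l// ltW.
  rewrite -[leLHS]addr0 lerD ?(ltW d0)// ler_wpM2r//.
  have u1p : 0 < 1 + u by rewrite addr_gt0.
  rewrite -[1 + u]lnK ?posrE// -expRM -[leRHS]lnK ?posrE ?addr_gt0// ler_expR.
  have : ln (1 + u) <= u by rewrite -[leRHS](expRK) ler_ln ?posrE ?expR_gt0// expR_ge1Dx.
  move=> h; apply: (le_trans (ler_wpM2r (ltW k0) h)).
  by rewrite -ler_pdivlMr.
rewrite -[leLHS]add0r lerD ?mulr_ge0 ?addr_ge0 ?(ltW d0)//.
rewrite -[leRHS]powRr1 ?(ltW d0)// -(mulVf (lt0r_neq0 k0)) powRrM.
apply: ge0_ler_powR; rewrite ?nnegrE ?(ltW k0) ?powR_ge0//.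
  by rewrite addr_ge0// mulr_ge0 ?(ltW u0).
have : u * u <= u * 1 by rewrite ler_wpM2l// ltW.
move: u3; lra.
Qed.

Lemma normc_ge0 (z : R[i]) : 0 <= normc z.
Proof. by case: z => u v; exact: sqrtr_ge0. Qed.

Lemma ge0_lty_EFin (x : \bar R) : (0 <= x)%E -> (x < +oo)%E -> exists r : R, x = r%:E.
Proof. by case: x => // r _ _; exists r. Qed.

Section contraction.
Context {m : nat} (p q alpha : R) (hp : 0 < p) (hpq : p < q) (halpha : 0 < alpha).
Variable f : 'rV[R]_m -> R[i].
Hypotheses (fa : real_analytic f) (lsf : log_subharmonic f).

Let lam := q / p.
Let a := Num.sqrt (p / q).
Let b := Num.sqrt (1 - p / q).

Lemma contraction_reg (eps J : R) : 0 < eps ->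
  (\int[gauss_tuple m]_y ((normc (f (rV_of_tuple (tscale (psigma p alpha) y))) ^+ 2 + eps) `^ (p / 2))%:E
    <= J%:E)%E ->
  (\int[gauss_tuple m]_y (normc (f (rV_of_tuple (tscale (psigma q alpha) y))) `^ q)%:E
    <= (J `^ lam)%:E)%E.
Proof.
move=> e0 hJ.
have hq : 0 < q by exact: lt_trans hpq.
have pq0 : 0 < p / q by rewrite divr_gt0.
have pq1 : p / q < 1 by rewrite ltr_pdivrMr// mul1r.
have a0 : 0 < a by rewrite sqrtr_gt0.
have b0 : 0 < b by rewrite sqrtr_gt0 subr_gt0.
have a2 : a ^+ 2 = p / q by rewrite sqr_sqrtr// ltW.
have b2 : b ^+ 2 = 1 - p / q by rewrite sqr_sqrtr// ltW// subr_gt0.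
have ab : a ^+ 2 + b ^+ 2 = 1 by rewrite a2 b2 addrC subrK.
have lamE : a ^- 2 = lam by rewrite a2 invf_div.
have sE : psigma q alpha = psigma p alpha * a.
  have aE : a = Num.sqrt p / Num.sqrt q by rewrite /a sqrtrM ?ltW// sqrtrV ?ltW.
  rewrite /psigma aE !(sqrtrM _ (ltW halpha)).
  by field; rewrite !gt_eqF ?sqrtr_gt0.
have p2 : 0 <= p / 2 by rewrite divr_ge0// ltW.
pose phi (t : m.-tuple R) :=
  p / 2 * ln (normc (f (rV_of_tuple (tscale (psigma p alpha) t))) ^+ 2 + eps).
have [cphi philow sub] := logsub_submean (psigma p alpha) fa lsf p2 e0.
have Fe t : 0 < normc (f (rV_of_tuple (tscale (psigma p alpha) t))) ^+ 2 + eps.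
  by rewrite ltr_wpDl// sqr_ge0.
have phiE t : expR (phi t) =
    (normc (f (rV_of_tuple (tscale (psigma p alpha) t))) ^+ 2 + eps) `^ (p / 2).
  by rewrite /phi mulrC expRM lnK// posrE.
have mphi : measurable_fun setT (fun t : m.-tuple mR => expR (phi t)).
  by apply: measurableT_comp => //; exact: tcont_measurable.
set I0 := (\int[gauss_tuple m]_y (expR (phi y))%:E)%E.
have hI0 : (I0 <= J%:E)%E by rewrite /I0; under eq_integral do rewrite phiE.
have I0ge : ((expR (p / 2 * ln eps))%:E <= I0)%E.
  have bc : bmeas (fun _ : m.-tuple mR => expR (p / 2 * ln eps)) by exact: bmeas_cst.
  rewrite -(mean_cst (gauss_tuple m) (expR _)) (EFin_mean _ bc) /I0.
  apply: ge0_le_integral => //.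
  - exact/measurable_EFinP.
  - by move=> t _; rewrite lee_fin ler_expR; exact: philow.
have [I IE] : exists I : R, I0 = I%:E.
  apply: ge0_lty_EFin _ (le_lt_trans hI0 (ltry _)).
  by apply: le_trans I0ge; rewrite lee_fin expR_ge0.
move: hI0 I0ge; rewrite IE !lee_fin => IJ Ige.
have I_gt0 : 0 < I by apply: lt_le_trans Ige; exact: expR_gt0.
have := gauss_strong_hyper a0 b0 ab cphi philow (sub a b) IE.
rewrite lamE => h; apply: le_trans (le_trans h _); last first.
  rewrite lee_fin mulrC expRM lnK ?posrE//; apply: ge0_ler_powR => //; rewrite ?nnegrE ?ltW//.
    by rewrite divr_gt0.
  exact: lt_le_trans IJ.
apply: ge0_le_integral => //.
- by move=> t _; rewrite lee_fin powR_ge0.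
- apply/measurable_EFinP/(measurableT_comp (measurable_powR _)).
  exact: (measurableT_comp (tcont_measurable (real_analytic_normc_tcont fa)) (measurable_tscale _)).
- apply/measurable_EFinP/measurableT_comp => //; apply: measurable_funM => //.
  exact: (measurableT_comp (tcont_measurable cphi) (measurable_tscale _)).
- move=> t _; rewrite lee_fin.
  have -> : tscale (psigma q alpha) t = tscale (psigma p alpha) (tscale a t).
    by apply: eq_from_tnth => i; rewrite !tnth_mktuple sE mulrA.
  have := Fe (tscale a t); rewrite /phi; set z := normc _ => Fz.
  have z0 : 0 <= z by exact: normc_ge0.
  rewrite mulrA (_ : lam * (p / 2) = q / 2); last by rewrite /lam; field; rewrite gt_eqF.
  rewrite mulrC expRM lnK ?posrE//.
  rewrite (_ : z `^ q = (z ^+ 2) `^ (q / 2)); last first.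
    by rewrite -powR_mulrn// -powRrM mulrCA mulfV ?mulr1.
  by apply: ge0_ler_powR; rewrite ?nnegrE ?sqr_ge0 ?divr_ge0 ?(ltW hq) ?(ltW Fz) ?lerDl ?(ltW e0).
Qed.

Lemma norm_pa_contraction : (norm_pa p alpha f < +oo)%E ->
  (norm_pa q alpha f <= norm_pa p alpha f)%E.
Proof.
have hq : 0 < q by exact: lt_trans hpq.
have mf := tcont_measurable (real_analytic_normc_tcont fa).
rewrite !norm_paE//.
set I := (\int[_]_y _)%E; set X := (\int[_]_y _)%E => Ifin.
have IdefE := erefl I; rewrite {1}/I in IdefE; have XdefE := erefl X; rewrite {1}/X in XdefE.
clearbody I X.
have I0 : (0 <= I)%E by rewrite -IdefE; apply: integral_ge0 => y _; rewrite lee_fin powR_ge0.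
have X0 : (0 <= X)%E by rewrite -XdefE; apply: integral_ge0 => y _; rewrite lee_fin powR_ge0.
have [i IE] : exists i : R, I = i%:E.
  apply: ge0_lty_EFin I0 _; rewrite ltey; apply/eqP => Iy.
  by move: Ifin; rewrite Iy poweRyr// invr_eq0 gt_eqF.
have i0 : 0 <= i by rewrite -lee_fin -IE.
have ms : measurable_fun setT (fun y : m.-tuple mR => normc (f (rV_of_tuple (tscale (psigma p alpha) y)))).
  exact: (measurableT_comp mf (measurable_tscale _)).
have hX d : 0 < d -> (X <= (((1 + d) * i + d) `^ lam)%:E)%E.
  move=> d0; have [e e0 he] := powR_reg (divr_gt0 hp (ltr0Sn R 1)) d0.
  rewrite -XdefE; apply: (contraction_reg e0).
  apply: (@le_trans _ _ (\int[gauss_tuple m]_y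
    ((1 + d)%:E * (normc (f (rV_of_tuple (tscale (psigma p alpha) y))) `^ p)%:E + d%:E))%E).
    apply: ge0_le_integral => //.
    - by move=> y _; rewrite lee_fin powR_ge0.
    - apply/measurable_EFinP/(measurableT_comp (measurable_powR _)).
      by apply: measurable_funD => //; exact: measurable_funX.
    - apply: emeasurable_funD => //; apply: emeasurable_funM => //.
      exact/measurable_EFinP/(measurableT_comp (measurable_powR _)).
    - move=> y _; rewrite -EFinM -EFinD lee_fin; set z := normc _.
      have z0 : 0 <= z by exact: normc_ge0.
      apply: le_trans (he _ (sqr_ge0 _)) _.
      rewrite (_ : (z ^+ 2) `^ (p / 2) = z `^ p)//.
      by rewrite -powR_mulrn// -powRrM mulrCA mulfV ?mulr1.
  have d1 : 0 <= 1 + d by rewrite addr_ge0// ltW.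
  have mp : measurable_fun setT (fun y : m.-tuple mR =>
      (normc (f (rV_of_tuple (tscale (psigma p alpha) y))) `^ p)%:E).
    exact/measurable_EFinP/(measurableT_comp (measurable_powR _)).
  rewrite ge0_integralD//.
  - rewrite ge0_integralZl//; last by move=> y _; rewrite lee_fin powR_ge0.
    have bc : bmeas (fun _ : m.-tuple mR => d) by exact: bmeas_cst.
    by rewrite -(EFin_mean _ bc) mean_cst IdefE IE -EFinM -EFinD.
  - by move=> y _; rewrite mule_ge0// lee_fin powR_ge0.
  - exact: emeasurable_funM.
  - by move=> y _; rewrite lee_fin ltW.
have [x XE] : exists x : R, X = x%:E.
  apply: ge0_lty_EFin X0 _; exact: le_lt_trans (hX 1 ltr01) (ltry _).
have x0 : 0 <= x by rewrite -lee_fin -XE.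
have lam0 : 0 < lam by rewrite divr_gt0.
have hx : x `^ lam^-1 <= i.
  (* This [d] solves [(1 + d) * i + d = i + e]. *)
  apply/ler_addgt0Pr => e e0; have d0 : 0 < e / (i + 1) by rewrite divr_gt0// ltr_wpDl.
  set d := e / (i + 1) in d0.
  have -> : i + e = (1 + d) * i + d.
    by rewrite /d; field; rewrite gt_eqF// ltr_wpDl.
  set J := _ + d; have d1 := ltW d0.
  have J0 : 0 <= J := addr_ge0 (mulr_ge0 (addr_ge0 ler01 d1) i0) d1.
  have := hX d d0; rewrite XE lee_fin -/J => h.
  have -> : J = (J `^ lam) `^ lam^-1 by rewrite -powRrM mulfV ?gt_eqF// powRr1.
  by apply: ge0_ler_powR; rewrite ?nnegrE ?invr_ge0 ?(ltW lam0) ?powR_ge0.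
rewrite IE XE !poweR_EFin lee_fin.
rewrite (_ : q^-1 = lam^-1 * p^-1); last by rewrite /lam invf_div mulrAC mulfV ?mul1r ?gt_eqF.
rewrite powRrM; apply: ge0_ler_powR; rewrite ?nnegrE ?invr_ge0 ?(ltW hp) ?powR_ge0//.
Qed.

Lemma logsub_space_contraction : (norm_pa p alpha f < +oo)%E ->
  logsub_space q alpha f /\ (norm_pa q alpha f <= norm_pa p alpha f)%E.
Proof.
move=> h; have hle := norm_pa_contraction h.
by split=> //; split=> //; exact: le_lt_trans hle h.
Qed.

End contraction.

End gauss_norm.

(** * The functions f_a *)

Section exp_fa.
Context {R : realType} {m : nat}.
Local Notation mR := (measurableTypeR R).
Local Notation K := {ffun 'I_m -> nat}.

Lemma esum_le_boxsum (G : K -> R) (C : R) : (forall k, 0 <= G k) ->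
  (forall N, boxsum G N <= C) -> (\esum_(k in [set: K]) (G k)%:E <= C%:E)%E.
Proof.
move=> G0 GC; apply: ge_ereal_sup => _ [X [finX _] <-].
have [N hN] : exists N, forall k, X k -> forall i, (k i < N)%N.
  have /finite_seqP[s ->] := finX.
  exists (\sum_(k <- s) \sum_(i < m) (k : K) i)%N.+1 => k Xk i.
  rewrite ltnS (big_rem k)//=.
  by rewrite (bigD1 i)//= -!addnA leq_addr.
apply: (@le_trans _ _ (boxsum G N)%:E); last by rewrite lee_fin.
rewrite boxsum_fsbig.
apply: lee_fsum_nneg_subset => //; first exact: finite_seq.
  move=> k /set_mem Xk; rewrite mem_set//=.
  apply/mapP; exists [ffun i => Ordinal (hN k Xk i)]; first exact: mem_index_enum.
  by apply/ffunP => i; rewrite !ffunE.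
by move=> k _; rewrite lee_fin.
Qed.

Lemma boxsum_prod (F : 'I_m -> nat -> R) N :
  boxsum (fun k => \prod_(i < m) F i (k i)) N = \prod_(i < m) \sum_(n < N) F i n.
Proof.
rewrite bigA_distr_bigA/=; apply: eq_bigr => k _.
by apply: eq_bigr => i _; rewrite ffunE.
Qed.

Lemma cvg_exp_prod (b : 'I_m -> R) :
  (fun N => \prod_(i < m) \sum_(n < N) (b i ^+ n / n`!%:R)) @ \oo --> \prod_(i < m) expR (b i).
Proof.
elim: (index_enum 'I_m) => [|i r IH].
  by rewrite big_nil; under eq_fun do rewrite big_nil; exact: cvg_cst.
rewrite big_cons; under eq_fun do rewrite big_cons.
apply: cvgM => //.
rewrite (_ : (fun N => _) = series (exp_coeff (b i))); first exact: is_cvg_series_exp_coeff.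
by apply/funext => N; rewrite /series/= big_mkord.
Qed.

(** The value at [x + h] is the value at [x] times the product of the
    [expR (alpha * a 0 i * h 0 i)]. Over boxes of multi-indices, partial sums of the product series
    are products of partial sums of exponential series. *)
Lemma real_analytic_exp_fa (alpha : R) (a : 'rV[R]_m) : real_analytic (exp_fa alpha a).
Proof.
move=> x.
pose C := expR (alpha * dotp a x - alpha / 2 * enorm a ^+ 2).
pose b i := alpha * a 0 i.
pose c (k : K) : R := C * \prod_(i < m) (b i ^+ k i / (k i)`!%:R).
have monE (k : K) (h : 'rV[R]_m) :
    c k * multi_monomial k h = C * \prod_(i < m) ((b i * h 0 i) ^+ k i / (k i)`!%:R).
  rewrite /c -mulrA -big_split/=; congr (_ * _); apply: eq_bigr => i _.
  by rewrite [(b i * h 0 i) ^+ _]exprMn [LHS]mulrAC.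
have C0 : 0 <= C by exact: expR_ge0.
have boxE (h : 'rV[R]_m) N : boxsum (fun k => c k * multi_monomial k h) N =
    C * \prod_(i < m) \sum_(n < N) ((b i * h 0 i) ^+ n / n`!%:R).
  rewrite -(boxsum_prod (fun i n => (b i * h 0 i) ^+ n / n`!%:R)) -boxsumZ.
  by apply: eq_bigr => k _; rewrite monE.
have FF : Filter (nbhs (0 : 'rV[R]_m)) by exact: nbhs_filter.
exists (fun k => (c k)%:C%C); apply: (@nearW _ _ _ FF) => h; split; last first.
  have cv : boxsum (fun k => c k * multi_monomial k h) @ \oo --> C * \prod_(i < m) expR (b i * h 0 i).
    rewrite (_ : boxsum _ = fun N => C * \prod_(i < m) \sum_(n < N) ((b i * h 0 i) ^+ n / n`!%:R));
      last by apply/funext => N; exact: boxE.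
    by apply: cvgMr; exact: cvg_exp_prod.
  have -> : exp_fa alpha a (x + h) = (C * \prod_(i < m) expR (b i * h 0 i))%:C%C.
    rewrite -expR_sum -expRD /exp_fa; congr ((expR _)%:C%C).
    rewrite addrAC; congr (_ + _); rewrite /dotp mulr_sumr [alpha * _]mulr_sumr -big_split/=.
    by apply: eq_bigr => i _; rewrite mxE /b; ring.
  apply/cvgrPdist_lt => -[er ei]; rewrite ltcE/= => /andP[/eqP -> er0].
  move/cvgrPdist_lt : cv => /(_ er er0); apply: filterS => N hN.
  rewrite (_ : \sum_(k : {ffun 'I_m -> 'I_N}) _ =
    (boxsum (fun k => c k * multi_monomial k h) N)%:C%C).
    by rewrite -rmorphB/= normc_def/= expr0n/= addr0 sqrtr_sqr ltcR.
  by rewrite [RHS]rmorph_sum; apply: eq_bigr => k _; rewrite [RHS]rmorphM.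
pose g (k : K) := C * \prod_(i < m) (`|b i * h 0 i| ^+ k i / (k i)`!%:R).
have gE N : boxsum g N = C * \prod_(i < m) \sum_(n < N) (`|b i * h 0 i| ^+ n / n`!%:R).
  by rewrite -(boxsum_prod (fun i n => `|b i * h 0 i| ^+ n / n`!%:R)) -boxsumZ.
have cg : boxsum g @ \oo --> C * \prod_(i < m) expR `|b i * h 0 i|.
  rewrite (_ : boxsum g = fun N => C * \prod_(i < m) \sum_(n < N) (`|b i * h 0 i| ^+ n / n`!%:R)).
    by apply: cvgMr; exact: cvg_exp_prod.
  by apply/funext => N; exact: gE.
have g0 k : 0 <= g k.
  by rewrite mulr_ge0// prodr_ge0// => i _; rewrite divr_ge0// exprn_ge0.
apply: (@le_lt_trans _ _ (limn (boxsum g))%:E); last exact: ltry.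
apply: esum_le_boxsum => [k|N]; first by rewrite mulr_ge0//; exact: normc_ge0.
apply: le_trans (nondecreasing_cvgn_le (boxsum_nd g0) (cvgP _ cg) N).
apply: le_boxsum => k; rewrite /= expr0n/= addr0 sqrtr_sqr -normrM monE normrM (ger0_norm C0).
rewrite /g ler_wpM2l// normr_prod le_eqVlt; apply/orP; left; apply/eqP.
by apply: eq_bigr => i _; rewrite normrM normrX normfV (@ger0_norm _ (_%:R)).
Qed.

Lemma exp_fa_normc (alpha : R) (a x : 'rV[R]_m) :
  normc (exp_fa alpha a x) = expR (alpha * dotp a x - alpha / 2 * enorm a ^+ 2).
Proof. by rewrite /exp_fa /= expr0n/= addr0 sqrtr_sqr ger0_norm ?expR_ge0. Qed.

(** The logarithm of the modulus is affine, hence harmonic. *)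
Lemma log_subharmonic_exp_fa (alpha : R) (a : 'rV[R]_m) : log_subharmonic (exp_fa alpha a).
Proof.
move=> x _; rewrite /laplacian big1// => i _.
rewrite (_ : (fun y => ln _) = fun y => alpha * dotp a y - alpha / 2 * enorm a ^+ 2); last first.
  by apply/funext => y; rewrite exp_fa_normc expRK.
have dE z : 'D_(delta_mx 0 i) (fun y => alpha * dotp a y - alpha / 2 * enorm a ^+ 2) z = alpha * a 0 i.
  rewrite derive_lineE; apply: derive_val.
  rewrite (_ : (fun s : R => _) = fun s : R => alpha * (dotp a z + s * a 0 i) - alpha / 2 * enorm a ^+ 2).
    by apply: is_derive_eq; rewrite /GRing.scale/=; ring.
  apply/funext => s; congr (_ * _ - _); rewrite /dotp (bigD1 i)//= [in RHS](bigD1 i)//= !mxE !eqxx.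
  rewrite mulr1 mulrDr [RHS]addrAC [a 0 i * s]mulrC; congr (_ + _).
  by apply: eq_bigr => j ji; rewrite !mxE (negbTE ji) mulr0 addr0.
rewrite (_ : 'D_(delta_mx 0 i) _ = fun=> alpha * a 0 i); last by apply/funext => z; exact: dE.
by rewrite derive_cst.
Qed.

Lemma norm_pa_exp_fa (p alpha : R) (a : 'rV[R]_m) : 0 < p -> 0 < alpha ->
  norm_pa p alpha (exp_fa alpha a) = 1%E.
Proof.
move=> p0 a0; rewrite /norm_pa /lebesgue_int.
have c0 := cst_pa_gt0 m p0 a0.
pose z : m.-tuple R := [tuple a 0 i | i < m].
pose s := psigma p alpha.
rewrite (_ : (_ * _)%E = 1%E) ?poweR1r//.
have c1 : 0 <= (cst_pa m p alpha)^-1 by rewrite invr_ge0 ltW.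
transitivity ((cst_pa m p alpha)%:E * ((cst_pa m p alpha)^-1%:E *
  \int[@lebesgue_tuple R m]_t (1%:E * (tpdf z s t)%:E)))%E.
  congr (_ * _)%E; rewrite -ge0_integralZl//; last 2 first.
  - by apply: emeasurable_funM => //; apply/measurable_EFinP; exact: measurable_tpdf.
  - by move=> t _; rewrite mul1e lee_fin tpdf_ge0.
  apply: eq_integral => t _; rewrite mul1e -EFinM; congr (_%:E).
  by rewrite exp_fa_normc /z /s -exp_weightE// mulKf// gt_eqF.
rewrite (@lebesgue_tuple_gauss _ _ _ _ (fun=> 1%:E)%E) ?psigma_gt0//.
have b1 : bmeas (fun _ : m.-tuple mR => 1 : R) by exact: bmeas_cst.
by rewrite -(EFin_mean _ b1) mean_cst -!EFinM mulr1 mulfV ?gt_eqF.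
Qed.

End exp_fa.

Theorem theorem2p4 (R : realType) (m : nat) (hm : (1 <= m)%N)
    (p q alpha : R) (hp : 0 < p) (hpq : p < q) (halpha : 0 < alpha) :
  (forall f : 'rV[R]_m -> R[i], logsub_space p alpha f ->
     logsub_space q alpha f /\ (norm_pa q alpha f <= norm_pa p alpha f)%E) /\
  (forall a : 'rV[R]_m,
     logsub_space p alpha (exp_fa alpha a) /\
     norm_pa q alpha (exp_fa alpha a) = norm_pa p alpha (exp_fa alpha a)).
Proof.
have hq : 0 < q by exact: lt_trans hpq.
split=> [f [fa lsf fp]|a]; first exact: logsub_space_contraction.
rewrite !norm_pa_exp_fa//; split=> //; split.
- exact: real_analytic_exp_fa.
- exact: log_subharmonic_exp_fa.
- by rewrite norm_pa_exp_fa// ltry.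
Qed.
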